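(* Let $R(t)\in\mathbb{C}(t)$ be a rational function that is not a homography, such that $R(0)=0$ and $R'(0)=q$, where $q\in\mathbb{C}$ is non-zero and not a root of unity. Let $\sigma\in\mathbb{C}[[t]]$ be a formal solution of the functional equation $$R(\sigma(t))=\sigma(qt).$$ Then $\sigma$ is differentially algebraic over $\mathbb{C}(t)$ if and only if there exist integers $r,j\in\mathbb{Z}$ with $r\neq 0$ and a rational function $A\in\mathbb{C}(t)$ such that $$(\sigma'(t))^r=t^j A(\sigma(t)).$$
   Context: A homography is a rational function of the form $\frac{at+b}{ct+d}$ with $ad-bc\neq 0$. A formal power series $\sigma\in\mathbb{C}[[t]]$ is differentially algebraic over $\mathbb{C}(t)$ if there exist a non-negative integer $n$ and a non-zero polynomial $P\in\mathbb{C}[t,X_0,X_1,\dots,X_n]$ such that $P(t,\sigma,\sigma',\dots,\sigma^{(n)})=0$, where $'$ denotes the derivation $d/dt$. A differential equation of the form $(y')^r=t^jA(y)$ with $r,j\in\mathbb{Z}$ and $A(t)\in\mathbb{C}(t)$ is called ''of Ritt type $(A)$''. *)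

(* Defs.v *)
From HB Require Import structures.
From mathcomp Require Import all_boot all_order all_algebra.
From mathcomp Require Import complex mpoly.
From mathcomp Require Import boolp functions reals.
From mathcomp Require Import ring.

Set Implicit Arguments.
Unset Strict Implicit.
Unset Printing Implicit Defensive.

Import Order.TTheory GRing.Theory Num.Theory.
Local Open Scope ring_scope.

(* Formal power series K[[t]]: a series is its sequence of coefficients, so
   that the additive structure is the pointwise one; the product is the Cauchy
   product. *)
Definition fps (K : fieldType) : Type := nat -> K.

Section FpsRing.
Variable K : fieldType.
Implicit Types f g h : fps K.

HB.instance Definition _ := GRing.Zmodule.copy (fps K) (nat -> K).

Definition fpsC (c : K) : fps K := fun n => if n is 0%N then c else 0.
Definition fpsX : fps K := fun n => (n == 1%N)%:R.
Definition fps_mul f g : fps K := fun n => \sum_(i < n.+1) f i * g (n - i)%N.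

Lemma fpsP f g : f = g <-> forall n, f n = g n.
Proof. by split=> [->//|fg]; apply/funext. Qed.

Lemma fps0E n : (0 : fps K) n = 0. Proof. by []. Qed.
Lemma fpsDE f g n : (f + g) n = f n + g n. Proof. by []. Qed.
Lemma fpsNE f n : (- f) n = - f n. Proof. by []. Qed.

Fact fps_mulC : commutative fps_mul.
Proof.
move=> f g; apply/fpsP => n; rewrite /fps_mul (reindex_inj rev_ord_inj) /=.
by apply: eq_bigr => i _; rewrite mulrC subSS subKn // -ltnS.
Qed.

Fact fps_mulA : associative fps_mul.
Proof.
move=> f g h; apply/fpsP => n; rewrite /fps_mul.
pose T j k := f j * (g (n - j - k)%N * h k).
transitivity (\sum_(j < n.+1) \sum_(k < n.+1 | (k <= n - j)%N) T j k).
  apply: eq_bigr => /= j _; rewrite mulr_sumr (reindex_inj rev_ord_inj) /=.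
  rewrite (big_ord_narrow_leq (leq_subr j n) (F := fun k : 'I_n.+1 => T j k)).
  by apply: eq_bigr => i _; rewrite /T subSS subKn ?leq_ord.
rewrite (exchange_big_dep predT) //= (reindex_inj rev_ord_inj) /=.
apply: eq_bigr => k _; rewrite subSS.
transitivity (\sum_(j < n.+1 | (j <= k)%N) T j (n - k)%N).
  by apply: eq_bigl => j; rewrite leq_sub2lE ?leq_ord.
rewrite (big_ord_narrow_leq (leq_ord k) (F := fun j : 'I_n.+1 => T j (n - k)%N)).
rewrite mulr_suml; apply: eq_bigr => j _; rewrite /T mulrA /=.
by rewrite subnAC subKn ?leq_ord.
Qed.

Fact fps_mul1 : left_id (fpsC 1) fps_mul.
Proof.
move=> f; apply/fpsP => n; rewrite /fps_mul big_ord_recl /= mul1r subn0.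
by rewrite big1 ?addr0 // => i _; rewrite mul0r.
Qed.

Fact fps_mulDl : left_distributive fps_mul +%R.
Proof.
move=> f g h; apply/fpsP => n; rewrite fpsDE /fps_mul -big_split /=.
by apply: eq_bigr => i _; rewrite fpsDE mulrDl.
Qed.

Fact fps_1neq0 : fpsC 1 != 0.
Proof. by apply/eqP => /fpsP/(_ 0%N)/eqP; rewrite oner_eq0. Qed.

HB.instance Definition _ := GRing.Zmodule_isComNzRing.Build (fps K)
  fps_mulA fps_mulC fps_mul1 fps_mulDl fps_1neq0.

Lemma fpsME f g n : (f * g) n = \sum_(i < n.+1) f i * g (n - i)%N.
Proof. by []. Qed.

(* Units are the elements having an inverse, which is picked classically. *)
Definition fps_unit : pred (fps K) := fun f => `[< exists g, g * f = 1 >].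
Definition fps_inv f : fps K :=
  if pselect (exists g, g * f = 1) is left ex then projT1 (cid ex) else f.

Fact fps_mulVx : {in fps_unit, left_inverse 1 fps_inv *%R}.
Proof.
move=> f /asboolP fU; rewrite /fps_inv; case: pselect => // ex.
exact: projT2 (cid ex).
Qed.

Fact fps_unitPl f g : g * f = 1 -> fps_unit f.
Proof. by move=> gf; apply/asboolP; exists g. Qed.

Fact fps_inv_out : {in [predC fps_unit], fps_inv =1 id}.
Proof.
move=> f; rewrite inE => /asboolP fNU.
by rewrite /fps_inv; case: pselect.
Qed.

HB.instance Definition _ := GRing.ComNzRing_hasMulInverse.Build (fps K)
  fps_mulVx fps_unitPl fps_inv_out.

Lemma fps_neq0_min f :
  f != 0 -> exists m, f m != 0 /\ forall i, (i < m)%N -> f i = 0.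
Proof.
move=> f0; have exf : exists n, f n != 0.
  apply: contrapT => fN; move/eqP: f0; apply; apply/fpsP => n.
  by apply/eqP; apply: contrapT => /negP fn; apply: fN; exists n.
exists (ex_minn exf); case: ex_minnP => m fm mmin; split => // i im.
by apply/eqP; apply: contraLR im => /mmin; rewrite -leqNgt.
Qed.

Fact fps_idomain : GRing.integral_domain_axiom (fps K).
Proof.
move=> f g fg0; apply/norP => -[] /fps_neq0_min[m [fm fm0]].
move=> /fps_neq0_min[n [gn gn0]].
have /eqP := congr1 (fun h : fps K => h (m + n)%N) fg0.
rewrite fpsME fps0E.
have mP : (m < (m + n).+1)%N by rewrite ltnS leq_addr.
rewrite (bigD1 (Ordinal mP)) //= addKn big1 ?addr0 ?mulf_eq0.
  by rewrite (negPf fm) (negPf gn).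
move=> i; rewrite -val_eqE /= neq_ltn => /orP[/fm0->|mi]; first by rewrite mul0r.
by rewrite (gn0 (m + n - i)%N) ?mulr0 // ltn_subLR ?ltn_add2r // -ltnS.
Qed.

HB.instance Definition _ :=
  GRing.ComUnitRing_isIntegral.Build (fps K) fps_idomain.

Fact fpsC_zmod : zmod_morphism fpsC.
Proof. by move=> a b; apply/fpsP => -[|n]; rewrite /= ?fpsDE ?fpsNE /= ?subr0. Qed.

Fact fpsC_monoid : monoid_morphism fpsC.
Proof.
split=> // a b; apply/fpsP => n; rewrite fpsME big_ord_recl /= subn0.
rewrite big1 ?addr0; last by move=> i _; rewrite mul0r.
by case: n => //= n; rewrite mulr0.
Qed.

HB.instance Definition _ := GRing.isZmodMorphism.Build K (fps K) fpsC fpsC_zmod.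
HB.instance Definition _ :=
  GRing.isMonoidMorphism.Build K (fps K) fpsC fpsC_monoid.

Definition fps_deriv f : fps K := fun n => f n.+1 *+ n.+1.

(* fps_dilate q f is f(qt). *)
Definition fps_dilate (q : K) f : fps K := fun n => q ^+ n * f n.

End FpsRing.

Arguments fpsX {K}.

Notation tofrac := (@FracField.tofrac _).
Notation "x %:F" := (tofrac x) : ring_scope.

(* The field of formal Laurent series K((t)), as the fraction field of K[[t]]. *)
Notation laurent K := {fraction (fps K)}.

Notation ratfun K := {fraction {poly K}}.

Section RationalFunctions.
Variable K : fieldType.
Implicit Types A : ratfun K.

(* A is defined at the point x of the extension iota : K -> L, and takes the
   value y there: some representative p / d of A satisfies d(x) <> 0 and
   y = p(x) / d(x). *)
Definition rat_value (L : fieldType) (iota : {rmorphism K -> L}) A (x y : L) :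
    Prop :=
  exists p d : {poly K},
    [/\ A = p%:F / d%:F, (map_poly iota d).[x] != 0
      & y = (map_poly iota p).[x] / (map_poly iota d).[x]].

Lemma frac_eqE (D : idomainType) (a b c d : D) : b != 0 -> d != 0 ->
  (a%:F / b%:F == c%:F / d%:F) = (a * d == c * b).
Proof.
by move=> b0 d0; rewrite eqr_div ?tofrac_eq0 // -!tofracM tofrac_eq.
Qed.

Lemma rat_value_uniq (L : fieldType) (iota : {rmorphism K -> L}) A x y z :
  rat_value iota A x y -> rat_value iota A x z -> y = z.
Proof.
have nz (d : {poly K}) : (map_poly iota d).[x] != 0 -> d != 0.
  by apply: contra_neq => ->; rewrite rmorph0 horner0.
move=> [p [d [-> dx ->]]] [p' [d' [/eqP + d'x ->]]].
rewrite frac_eqE ?nz // => /eqP/(congr1 (fun r => (map_poly iota r).[x])).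
rewrite !rmorphM !hornerM /= => E.
by apply/eqP; rewrite eqr_div // E.
Qed.

Definition rat_at A (a b : K) : Prop := rat_value (idfun : {rmorphism K -> K}) A a b.

(* The composite A(s), computed in K((t)). *)
Definition rat_comp A (s : fps K) (y : laurent K) : Prop :=
  rat_value ((@FracField.tofrac (fps K)) \o (@fpsC K)) A s%:F y.

(* The derivative dA/dt; by rat_derivE the choice of representative of A is
   immaterial. *)
Definition rat_deriv A : ratfun K :=
  let p := \n_(repr A) in let d := \d_(repr A) in
  (p^`() * d - p * d^`())%:F / (d ^+ 2)%:F.

Lemma frac_reprE (D : idomainType) (x : {fraction D}) :
  x = (\n_(repr x))%:F / (\d_(repr x))%:F.
Proof.
have d0 := denom_ratioP (repr x).
rewrite -[LHS]reprK; unlock FracField.tofrac.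
rewrite -[X in _ * X]FracField.pi_inv -[RHS]FracField.pi_mul.
rewrite /FracField.mulf /FracField.invf /=.
by rewrite !numden_Ratio ?oner_eq0 // mulr1 mul1r Ratio_numden.
Qed.

Lemma rat_derivE (p d : {poly K}) : d != 0 ->
  rat_deriv (p%:F / d%:F) = (p^`() * d - p * d^`())%:F / (d ^+ 2)%:F.
Proof.
move=> d0; set A := p%:F / d%:F; rewrite /rat_deriv.
have m0 := denom_ratioP (repr A).
have := frac_reprE A; set n := \n_(repr A); set m := \d_(repr A) in m0 *.
rewrite {1}/A => /eqP; rewrite frac_eqE // => /eqP E.
have E' : p^`() * m + p * m^`() = n^`() * d + n * d^`() by rewrite -!derivM E.
apply/eqP; rewrite frac_eqE ?expf_neq0 //; apply/eqP.
have E2 : n^`() * d = p^`() * m + p * m^`() - n * d^`() by rewrite E' addrK.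
have -> : (n^`() * m - n * m^`()) * d ^+ 2 =
  m * d * (n^`() * d) - (n * d) * (m^`() * d) by ring.
by rewrite E2 -E mulrBr (_ : m * d * (n * d^`()) = n * d * (m * d^`()));
  [rewrite -E|]; ring.
Qed.

Definition homography A : Prop :=
  exists a b c d : K, a * d - b * c != 0 /\
    A = (a *: 'X + b%:P)%:F / (c *: 'X + d%:P)%:F.

(* The variable X_0 of the multivariate polynomial stands for t, and X_(i+1)
   for the i-th derivative of s. *)
Definition diff_algebraic (s : fps K) : Prop :=
  exists (n : nat) (P : {mpoly K[n.+2]}),
    P != 0 /\
    mmap (@fpsC K)
      (fun i : 'I_n.+2 => if val i is k.+1 then iter k (@fps_deriv K) s else fpsX)
      P = 0.

(* (s')^r = t^j A(s) in K((t)), both sides being defined. *)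
Definition ritt_type (r j : int) A (s : fps K) : Prop :=
  exists y : laurent K,
    [/\ rat_comp A s y, r < 0 -> fps_deriv s != 0
      & (fps_deriv s)%:F ^ r = fpsX%:F ^ j * y].

End RationalFunctions.

(* Main.v *)
Require Import Defs.
From mathcomp Require Import all_boot all_order all_algebra.
From mathcomp Require Import complex reals.
From HB Require Import structures.
From mathcomp Require Import boolp ring mpoly zify perm.

Set Implicit Arguments.
Unset Strict Implicit.
Unset Printing Implicit Defensive.

Import Order.TTheory GRing.Theory Num.Theory.
Local Open Scope ring_scope.

(** The operator [phi f (t) = f (q t)] on [C((t))] commutes with
[theta = t d/dt], and since [q] is not a root of unity its invariants are the
constants. Put [x = 1/sigma]: then [phi x = S(x)], where [S = 1/R(1/x)] fixes
infinity without ramification. If [sigma] is differentially algebraic, let [n]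
be least such that [theta^n x] is algebraic over [t, x, ..., theta^(n-1) x].
Taking coefficients of its minimal polynomial, [theta^n x] even lies in the
field they generate. The reparametrisation fields [s^m d/ds], prolonged to the
jets of [x], are derivations of that field commuting with [phi], and their
brackets force [n <= 3] (Lie: no geometry on a line beyond the projective one).
For [n = 1] one gets a rational [A] with [A o S = c S'^m A]; for [n = 2, 3] one
gets a rational [h] with [S'^2 (h o S) = h + Schwarzian of S].

In the latter case, follow the poles of [h] backwards along [S]: growing orders
would yield infinitely many poles, so that all poles are at most double. If
[b_p] is the coefficient of [(z - p)^-2], then [f = 1 + 2 b] satisfies
[f(p) = e_p^2 f(S(p))], with [e_p] the ramification index, and by the same
argument [f(p)] is [0] or [1/m^2]. These are the weights of an orbifold whose
Riemann-Hurwitz formula makes [prod_p (x - p)^(N (1 - sqrt f(p)))] a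
semi-invariant density [A] as for [n = 1]. Finally [(theta x)^m / A(x)] is an
eigenvector of [phi], hence a monomial. *)

(** * Adjunction and derivations *)

(** Everything is algebra inside [C((t))]; no convergence of [sigma] is used. The coordinate
    [x = 1/sigma] puts the fixed point at infinity, so that all preimages of a finite point and all
    critical points of [S] are finite: fibres are polynomials of constant degree, and
    Riemann-Hurwitz becomes a comparison of degrees. That [R] is not a homography enters as degree
    at least two, which makes backward orbits grow. The same growth shows that a rational function
    of [x] which is an eigenvector of [phi] is constant; with [q] not a root of unity, this makes
    [t] transcendental over [C(x)], and [t] can then be eliminated. In bounding [n], the obstacle is
    that [theta^n x] is an unknown rational function of the lower jets. Derivations are prescribed
    on the free generators only, and their value on [theta^n x] is found up to a constant multiple
    of [theta x]. From [m = 2] on the fields kill [theta x], so these constants drop out of the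
    bracket that bounds [n]; for [n = 2, 3] they are absorbed in [h] or shown to vanish. *)

Section Adjunction.
Variable L : fieldType.
Implicit Types (E : divringClosed L) (x y f g : L) (p d : {poly L}).

(** The field [E(x)], encoded as a predicate on the ambient [L]: the maps [phi] and [theta] of [L]
    then act on every field of a tower without transport. *)
Definition adj_pred E x : {pred L} := fun f =>
  `[< exists p d, [/\ p \is a polyOver E, d \is a polyOver E, d.[x] != 0
      & f = p.[x] / d.[x]] >].

Lemma adj_closed E x : divring_closed (adj_pred E x).
Proof.
split=> [|f g /asboolP[p [d [pE dE d0 ->]]] /asboolP[p' [d' [p'E d'E d'0 ->]]]
         |f g /asboolP[p [d [pE dE d0 ->]]] /asboolP[p' [d' [p'E d'E d'0 ->]]]].
- apply/asboolP; exists 1, 1; rewrite hornerC divr1 oner_eq0.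
  by split; rewrite // rpred1.
- apply/asboolP; exists (p * d' - p' * d), (d * d').
  rewrite rpredB ?rpredM // hornerM hornerD hornerN !hornerM mulf_neq0 //; split=> //.
  by field; rewrite d0 d'0.
- apply/asboolP; have [p'0|p'0] := eqVneq p'.[x] 0.
    exists 0, 1; rewrite p'0 mul0r invr0 mulr0 hornerC hornerC mul0r oner_eq0.
    by split; rewrite ?rpred0 ?rpred1.
  exists (p * d'), (d * p'); rewrite !rpredM // !hornerM mulf_neq0 //; split=> //.
  by field; rewrite d0 d'0 p'0.
Qed.

HB.instance Definition _ E x :=
  GRing.isDivringClosed.Build L (adj_pred E x) (adj_closed E x).

Definition adj E x : divringClosed L := adj_pred E x.

Lemma adjP E x f :
  reflect (exists p d, [/\ p \is a polyOver E, d \is a polyOver E, d.[x] != 0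
      & f = p.[x] / d.[x]]) (f \in adj E x).
Proof. exact: asboolP. Qed.

Lemma sub_adj E x f : f \in E -> f \in adj E x.
Proof.
move=> fE; apply/adjP; exists f%:P, 1; rewrite !hornerC divr1 oner_eq0.
by rewrite polyOverC fE rpred1.
Qed.

Lemma adj_gen E x : x \in adj E x.
Proof.
apply/adjP; exists 'X, 1; rewrite hornerX hornerC divr1 oner_eq0.
by rewrite polyOverX rpred1.
Qed.

Lemma adj_min E E' x : {subset E <= E'} -> x \in E' -> {subset adj E x <= E'}.
Proof.
move=> sE xE' f /adjP[p [d [pE dE _ ->]]].
by rewrite rpred_div // rpred_horner //; apply: polyOverS pE || apply: polyOverS dE.
Qed.

Lemma adj_morph E E' (phi : {rmorphism L -> L}) x :
    (forall f, f \in E -> phi f \in E') -> phi x \in E' ->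
  forall f, f \in adj E x -> phi f \in E'.
Proof.
move=> sE xE' f /adjP[p [d [/polyOverP pE /polyOverP dE _ ->]]].
rewrite rmorphM fmorphV -!horner_map /=.
by rewrite rpred_div // rpred_horner //; apply/polyOverP => i;
  rewrite coef_map sE.
Qed.

Definition transc E x := forall p, p \is a polyOver E -> p.[x] = 0 -> p = 0.

Lemma transc_notin E x : transc E x -> x \notin E.
Proof.
move=> tx; apply/negP => xE; have := tx ('X - x%:P).
rewrite rpredB ?polyOverX ?polyOverC // hornerXsubC subrr => /(_ isT erefl)/eqP.
by rewrite polyXsubC_eq0.
Qed.

Lemma transc_horner_neq0 E x p : transc E x -> p \is a polyOver E ->
  p != 0 -> p.[x] != 0.
Proof. by move=> tx pE; apply: contra_neq; apply: tx. Qed.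

Lemma transc_inj E x p d : transc E x -> p \is a polyOver E ->
  d \is a polyOver E -> p.[x] = d.[x] -> p = d.
Proof.
move=> tx pE dE pd; apply/eqP; rewrite -subr_eq0; apply/eqP/tx.
  by rewrite rpredB.
by rewrite hornerD hornerN pd subrr.
Qed.

Lemma min_poly_exists E y : ~ transc E y -> exists p,
  [/\ p \is monic, p \is a polyOver E, p.[y] = 0, (1 < size p)%N
   & forall p', p' \is a polyOver E -> p'.[y] = 0 -> (size p' < size p)%N ->
     p' = 0].
Proof.
move=> ntr.
pose P n := `[< exists p, [/\ p \is a polyOver E, p.[y] = 0, p != 0 & size p = n] >].
have exP : exists n, P n.
  apply: contrapT => nP; apply: ntr => p pE py; apply: contrapT => /eqP p0.
  by apply: nP; exists (size p); apply/asboolP; exists p.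
have [p [pE py p0 sp]] := asboolP _ (xchooseP exP).
case: (ex_minnP exP) => n /asboolP[{}p [{}pE {}py {}p0 {}sp]] nmin.
have lc0 : lead_coef p != 0 by rewrite lead_coef_eq0.
have lcE : lead_coef p \in E by apply: polyOverP.
pose p1 := (lead_coef p)^-1 *: p.
have sp1 : size p1 = n by rewrite size_scale ?invr_eq0.
exists p1; split.
- by rewrite monicE lead_coefZ mulVf.
- by rewrite polyOverZ // rpredV.
- by rewrite hornerZ py mulr0.
- rewrite ltnNge; apply/negP => sp1_le.
  have sple : (size p <= 1)%N by rewrite sp -sp1.
  move: py p0; rewrite (size1_polyC sple) hornerC => ->; by rewrite polyC0 eqxx.
- move=> p' p'E p'y; rewrite sp1 => lt; apply: contrapT => /eqP p'0.
  have := nmin (size p'); rewrite leqNgt lt => /(_ _)/negP; case=> //.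
  by apply/asboolP; exists p'.
Qed.

(* Uniqueness of the minimal polynomial, applied to its image under [phi]. *)
Lemma min_poly_invariant E (phi : {rmorphism L -> L}) y a b :
    (forall f, f \in E -> phi f \in E) -> ~ transc E y ->
    a \in E -> a != 0 -> b \in E -> phi y = a * y + b ->
  exists p, [/\ p \is a polyOver E, p \is monic, p.[y] = 0 /\ (1 < size p)%N,
    (forall p', p' \is a polyOver E -> p'.[y] = 0 -> (size p' < size p)%N ->
     p' = 0)
  & map_poly phi p \Po (a *: 'X + b%:P) = a ^+ (size p).-1 *: p].
Proof.
move=> phiE /min_poly_exists[p [pm pE py sp pmin]] aE a0 bE phiy.
exists p; split=> //.
have phip : map_poly phi p \is a polyOver E.
  by apply/polyOverP => i; rewrite coef_map phiE //; apply/polyOverP.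
have slin : size (a *: 'X + b%:P) = 2%N.
  by rewrite size_polyDl size_scale ?size_polyX // (leq_ltn_trans (size_polyC_leq1 _)).
have lclin : lead_coef (a *: 'X + b%:P) = a.
  by rewrite lead_coefDl ?lead_coefZ ?lead_coefX ?mulr1 // size_scale //
    size_polyX (leq_ltn_trans (size_polyC_leq1 _)).
set p1 := _ \Po _.
have p1E : p1 \is a polyOver E.
  by rewrite polyOver_comp // rpredD ?polyOverZ ?polyOverX ?polyOverC.
have sp1 : size p1 = size p.
  by rewrite size_comp_poly2 // size_map_poly.
have lcp1 : lead_coef p1 = a ^+ (size p).-1.
  rewrite lead_coef_comp ?slin // lclin size_map_poly lead_coef_map.
  by rewrite (monicP pm) rmorph1 mul1r.
apply/eqP; rewrite -subr_eq0; apply/eqP; apply: pmin.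
- by rewrite rpredB // polyOverZ // rpredX.
- rewrite hornerD hornerN hornerZ py mulr0 subr0 /p1 horner_comp.
  rewrite hornerD hornerZ hornerX hornerC -phiy horner_map py.
  exact: rmorph0.
- set c := a ^+ _; have c0 : c != 0 by rewrite expf_neq0.
  have sle : (size (p1 - c *: p)%R <= size p)%N.
    by rewrite (leq_trans (size_polyD _ _)) // size_polyN size_scale // sp1 maxnn.
  rewrite ltn_neqAle sle andbT; apply/negP => /eqP sE.
  have /eqP : lead_coef (p1 - c *: p) = 0.
    rewrite lead_coefE sE coefB coefZ.
    have -> : p1`_(size p).-1 = c by rewrite /c -lcp1 lead_coefE sp1.
    by rewrite -lead_coefE (monicP pm) mulr1 subrr.
  by rewrite lead_coef_eq0 -size_poly_eq0 sE; case: (size p) sp.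
Qed.

(** The witness [b] is the constant coefficient of the minimal polynomial of [y], up to sign its
    norm, and [m] is the degree: evaluate the invariance of the minimal polynomial at 0. *)
Lemma semi_invariant E (phi : {rmorphism L -> L}) y a :
    (forall f, f \in E -> phi f \in E) -> ~ transc E y -> y != 0 ->
    a \in E -> a != 0 -> phi y = a * y ->
  exists m b, [/\ (0 < m)%N, b \in E, b != 0 & phi b = a ^+ m * b].
Proof.
move=> phiE ntr y0 aE a0 phiy.
have phiy' : phi y = a * y + 0 by rewrite addr0.
have [p [pE pm [py sp] pmin]] :=
  min_poly_invariant phiE ntr aE a0 (rpred0 E) phiy'.
rewrite polyC0 addr0 => inv; exists (size p).-1, p`_0; split.
- by case: (size p) sp => [|[]].
- exact: polyOverP.
(* If the constant coefficient vanished, dividing by ['X] would contradict minimality, as [y] is not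
   0. *)
- apply/eqP => p00; have := pmin (p %/ 'X).
  have dX : p = (p %/ 'X) * 'X.
    by rewrite divpK // -['X]subr0 -polyC0 dvdp_XsubCl rootE horner_coef0 p00.
  have p0 : p != 0 by apply: monic_neq0.
  have q0 : p %/ 'X != 0 by apply: contra_neq p0 => q0; rewrite dX q0 mul0r.
  have sz : (size p).-1 = size (p %/ 'X) by rewrite {1}dX size_mulX.
  have qE : p %/ 'X \is a polyOver E.
    apply/polyOverP => i; have -> : (p %/ 'X)`_i = p`_i.+1.
      by rewrite [in RHS]dX coefMX.
    exact: polyOverP.
  move=> /(_ qE) H; case/eqP: q0; apply: H.
    by apply/eqP; have /eqP := py; rewrite {1}dX hornerMX mulf_eq0 (negPf y0) orbF.
  by rewrite -sz; case: (size p) sp => [|[]].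
- have := congr1 (fun r => r.[0]) inv.
  rewrite horner_comp hornerZ hornerX mulr0 hornerZ !horner_coef0.
  by rewrite coef_map.
Qed.

(** The mean of the conjugates of [y] transforms like [y]. It is minus the second coefficient of the
    minimal polynomial divided by the degree, whence characteristic zero. *)
Lemma affine_invariant E (phi : {rmorphism L -> L}) y a b :
    [pchar L] =i pred0 ->
    (forall f, f \in E -> phi f \in E) -> ~ transc E y ->
    a \in E -> a != 0 -> b \in E -> phi y = a * y + b ->
  exists2 c, c \in E & phi c = a * c + b.
Proof.
move=> char0 phiE ntr aE a0 bE phiy.
have [p [pE pm [py sp] pmin inv]] := min_poly_invariant phiE ntr aE a0 bE phiy.
have ders n : (map_poly phi p \Po (a *: 'X + b%:P))^`(n) =
    a ^+ n *: ((map_poly phi p)^`(n) \Po (a *: 'X + b%:P)).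
  elim: n => [|n IH]; first by rewrite expr0 scale1r.
  rewrite derivnS IH derivZ deriv_comp -derivnS derivD derivZ derivX derivC addr0.
  by rewrite -scalerAr mulr1 scalerA -exprSr.
have [m sd] : exists m, size p = m.+2 by case: (size p) sp => [|[|m]] //; exists m.
(* The degree being [m.+1], the [m]-th derivative is an affine polynomial whose root is that
   mean. *)
have {}inv := congr1 (fun r => r^`(m).[0]) inv.
move: inv; rewrite derivnZ ders !hornerZ horner_comp hornerD hornerZ hornerX.
rewrite mulr0 add0r hornerC sd /=.
have dnE (r : {poly L}) : size r = m.+2 ->
    r^`(m) = (r`_m.+1 * (m.+1`!)%:R)%:P * 'X + (r`_m * (m`!)%:R)%:P.
  move=> sr; apply/polyP => i; rewrite coef_derivn coefD coefMX !coefC !mulr_natr.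
  case: i => [|[|i]] /=.
  - by rewrite addn0 ffactnn add0r.
  - by rewrite addn1 addr0 -ffactnn ffactnSr subSn // subnn muln1.
  - by rewrite addr0 nth_default ?mul0rn // sr !addnS !ltnS leq_addr.
rewrite (dnE p) // dnE ?size_map_poly //.
rewrite !hornerD !hornerM !hornerX !hornerC mulr0 add0r !coef_map /=.
have -> : p`_m.+1 = 1 by have /monicP := pm; rewrite lead_coefE sd.
rewrite rmorph1 factS exprS natrM => inv.
have nat0 k : (0 < k)%N -> k%:R != 0 :> L.
  by move=> k0; rewrite ((pcharf0P L).1 char0) -lt0n.
exists (- p`_m / m.+1%:R).
  by rewrite rpredM ?rpredN ?rpredV ?rpred_nat //; apply: polyOverP.
have m1 := nat0 _ (ltn0Sn m); have mf := nat0 _ (fact_gt0 m).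
have am : a ^+ m != 0 by rewrite expf_neq0.
rewrite rmorphM rmorphN fmorphV rmorph_nat.
have E1 : phi p`_m = a * p`_m - m.+1%:R * b.
  apply: (mulfI mf); apply: (mulfI am).
  have -> : a ^+ m * (m`!%:R * (a * p`_m - m.+1%:R * b)) =
    a * a ^+ m * (p`_m * m`!%:R) - a ^+ m * (m.+1%:R * m`!%:R * b) by ring.
  by rewrite -inv; ring.
by move: (m.+1%:R) m1 E1 => M m1 ->; field.
Qed.

End Adjunction.

Section Derivations.
Variable L : fieldType.
Implicit Types (E : divringClosed L) (x y f g : L) (p d : {poly L}).

Lemma adj_ind E x (P : L -> Prop) :
    (forall f, f \in E -> P f) -> P x ->
    (forall f g, P f -> P g -> P (f - g)) ->
    (forall f g, P f -> P g -> P (f * g)) -> (forall f, P f -> P f^-1) ->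
  forall f, f \in adj E x -> P f.
Proof.
move=> PE Px PB PM PV.
have P0 : P 0 by apply: PE; rewrite rpred0.
have PD f g : P f -> P g -> P (f + g).
  by move=> Pf Pg; rewrite -[g]opprK; apply: (PB) => //; rewrite -sub0r; apply: (PB).
have Pp p : p \is a polyOver E -> P p.[x].
  elim/poly_ind: p => [|p c IH] pE; first by rewrite horner0.
  have cE : c \in E by have := polyOverP pE 0; rewrite coefD coefMX coefC add0r.
  have {}/IH Pp : p \is a polyOver E.
    by apply/polyOverP => i; have := polyOverP pE i.+1;
      rewrite coefD coefMX coefC addr0.
  by rewrite hornerMXaddC; apply: PD; [apply: PM|apply: PE].
by move=> f /adjP[p [d [pE dE _ ->]]]; apply: PM; [|apply: PV]; apply: Pp.
Qed.

(** The twist serves the defect [X \o phi - phi \o X], a derivation along [phi]; ordinary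
    derivations have [tau = idfun]. The laws are asked on [E] only, since the derivations built on a
    tower are arbitrary functions elsewhere. *)
Definition der_on (tau : {rmorphism L -> L}) (E : {pred L}) (Z : L -> L) :=
  (forall f g, f \in E -> g \in E -> Z (f - g) = Z f - Z g) /\
  (forall f g, f \in E -> g \in E -> Z (f * g) = tau f * Z g + Z f * tau g).

Section DerTheory.
Variables (tau : {rmorphism L -> L}) (E : divringClosed L) (Z : L -> L).
Hypothesis dZ : der_on tau E Z.

Lemma der0 : Z 0 = 0.
Proof. by have := dZ.1 _ _ (rpred0 E) (rpred0 E); rewrite !subrr. Qed.

Lemma derB f g : f \in E -> g \in E -> Z (f - g) = Z f - Z g.
Proof. exact: dZ.1. Qed.

Lemma derN f : f \in E -> Z (- f) = - Z f.
Proof. by move=> fE; rewrite -sub0r derB ?rpred0 // der0 sub0r. Qed.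

Lemma derD f g : f \in E -> g \in E -> Z (f + g) = Z f + Z g.
Proof.
by move=> fE gE; rewrite -[g in LHS]opprK derB ?rpredN // derN // opprK.
Qed.

Lemma derM f g : f \in E -> g \in E -> Z (f * g) = tau f * Z g + Z f * tau g.
Proof. exact: dZ.2. Qed.

Lemma der1 : Z 1 = 0.
Proof.
have := derM (rpred1 E) (rpred1 E); rewrite !mulr1 rmorph1 mul1r mulr1 => /eqP.
by rewrite -subr_eq subrr eq_sym => /eqP.
Qed.

Lemma derV f : f \in E -> Z f^-1 = - Z f / tau f ^+ 2.
Proof.
move=> fE; have [->|f0] := eqVneq f 0.
  by rewrite invr0 der0 oppr0 mul0r.
have fVE : f^-1 \in E by rewrite rpredV.
have := derM fE fVE; rewrite divff // der1 fmorphV => /eqP.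
have tf0 : tau f != 0 by rewrite fmorph_eq0.
rewrite eq_sym addr_eq0 => /eqP E1; apply: (mulfI tf0); rewrite E1.
by field.
Qed.

Lemma der_div f g : f \in E -> g \in E -> g != 0 ->
  Z (f / g) = (Z f * tau g - tau f * Z g) / tau g ^+ 2.
Proof.
move=> fE gE g0; rewrite derM ?rpredV // derV // fmorphV.
by field; rewrite fmorph_eq0.
Qed.

Lemma der_sum (I : Type) (s : seq I) (F : I -> L) :
  (forall i, F i \in E) -> Z (\sum_(i <- s) F i) = \sum_(i <- s) Z (F i).
Proof.
move=> FE; elim: s => [|i s IH]; first by rewrite !big_nil der0.
by rewrite !big_cons derD ?IH // rpred_sum.
Qed.

Lemma derMn f n : f \in E -> Z (f *+ n) = Z f *+ n.
Proof.
move=> fE; elim: n => [|n IH]; first by rewrite !mulr0n der0.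
by rewrite !mulrS derD ?IH // rpredMn.
Qed.

Lemma der_nat n : Z n%:R = 0.
Proof. by rewrite derMn ?rpred1 // der1 mul0rn. Qed.

End DerTheory.

Lemma der_vanish tau E x Z : der_on tau (adj E x) Z ->
  (forall f, f \in E -> Z f = 0) -> Z x = 0 ->
  forall f, f \in adj E x -> Z f = 0.
Proof.
move=> dZ ZE Zx f fA.
suff [] : f \in adj E x /\ Z f = 0 by [].
elim/adj_ind: fA => {f} [f fE||f g [fA Zf] [gA Zg]|f g [fA Zf] [gA Zg]|f [fA Zf]].
- by split; rewrite ?sub_adj ?ZE.
- by split; rewrite ?adj_gen.
- by rewrite (derB dZ) // Zf Zg subr0 rpredB.
- by rewrite (derM dZ) // Zf Zg mulr0 mul0r addr0 rpredM.
- by split; [rewrite rpredV|rewrite (derV dZ) // Zf oppr0 mul0r].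
Qed.

Lemma der_stable E x E' Z : der_on idfun (adj E x) Z ->
    {subset adj E x <= E'} -> (forall f, f \in E -> Z f \in E') -> Z x \in E' ->
  forall f, f \in adj E x -> Z f \in E'.
Proof.
move=> dZ sE ZE Zx f fA.
suff [] : f \in adj E x /\ Z f \in E' by [].
elim/adj_ind: fA => {f} [f fE||f g [fA Zf] [gA Zg]|f g [fA Zf] [gA Zg]|f [fA Zf]].
- by split; rewrite ?sub_adj ?ZE.
- by split; rewrite ?adj_gen.
- by rewrite (derB dZ) // !rpredB.
- split; first by rewrite rpredM.
  by rewrite (derM dZ) //= rpredD // rpredM // sE.
- split; first by rewrite rpredV.
  by rewrite (derV dZ) //= rpred_div ?rpredN // rpredX // sE.
Qed.

Lemma der_horner (A : divringClosed L) Z p x : der_on idfun A Z -> p \is a polyOver A -> x \in A ->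
  Z p.[x] = (map_poly Z p).[x] + p^`().[x] * Z x.
Proof.
move=> dZ + xA; elim/poly_ind: p => [|p c IH] pE.
  by rewrite map_poly0 deriv0 !horner0 (der0 dZ) mul0r addr0.
have cE : c \in A by have := polyOverP pE 0; rewrite coefD coefMX coefC add0r.
have {}pE : p \is a polyOver A.
  by apply/polyOverP => i; have := polyOverP pE i.+1;
    rewrite coefD coefMX coefC addr0.
have -> : map_poly Z (p * 'X + c%:P) = map_poly Z p * 'X + (Z c)%:P.
  apply/polyP => i; rewrite coef_map_id0 ?(der0 dZ) // !coefD !coefMX !coefC.
  by case: i => [|i] /=; rewrite ?add0r ?addr0 ?coef_map_id0 ?(der0 dZ).
have pxA : p.[x] \in A by rewrite rpred_horner.
rewrite hornerMXaddC (derD dZ) ?rpredM // (derM dZ) // IH //= derivMXaddC.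
by rewrite hornerMXaddC !hornerD hornerM hornerX; ring.
Qed.

Lemma deriv_eq0_char0 p : [pchar L] =i pred0 -> p^`() = 0 -> p = (p`_0)%:P.
Proof.
move=> char0 p'0; apply/polyP => -[|i]; rewrite coefC //=.
have /eqP := congr1 (fun r : {poly L} => r`_i) p'0.
rewrite coef_deriv coef0 -mulr_natr mulf_eq0 ((pcharf0P L).1 char0) orbF.
by move/eqP.
Qed.

(** If [f = p(x) / d(x)] is killed, then [p' d = p d'], so [f] is also [p'(x) / d'(x)], with a
    smaller denominator. The descent stops at [d' = 0], where [p] and [d] are constant. *)
Lemma der_const E x Z f : [pchar L] =i pred0 -> transc E x ->
    der_on idfun (adj E x) Z -> (forall g, g \in E -> Z g = 0) -> Z x != 0 ->
  f \in adj E x -> Z f = 0 -> f \in E.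
Proof.
move=> char0 tx dZ ZE Zx /adjP[p [d [pE dE dx0 fE]]] Zf.
have Zp r : r \is a polyOver E -> Z r.[x] = r^`().[x] * Z x.
  move=> rE; rewrite (@der_horner (adj E x)) ?adj_gen //; last first.
    by apply: polyOverS rE => g; apply: sub_adj.
  rewrite [map_poly Z r](_ : _ = 0) ?horner0 ?add0r //.
  apply/polyP => i; rewrite coef_map_id0 ?(der0 dZ) // coef0 ZE //.
  exact: polyOverP.
have hA r : r \is a polyOver E -> r.[x] \in adj E x.
  by move=> rE; rewrite rpred_horner ?adj_gen //; apply: polyOverS rE => g;
    apply: sub_adj.
have [n] := ubnP (size d); elim: n => // n IH in p d pE dE dx0 fE *.
rewrite ltnS => sd.
have id0 : p^`() * d = p * d^`().
  apply: (transc_inj tx); rewrite ?rpredM ?polyOver_deriv // !hornerM.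
  move: Zf; rewrite fE (der_div dZ) ?hA //= !Zp // => /eqP.
  rewrite mulf_eq0 invr_eq0 expf_eq0 (negPf dx0) /= orbF subr_eq0 => /eqP E1.
  by apply: (mulIf Zx); rewrite mulrAC E1 mulrA.
have d0 : d != 0 by apply: contra_neq dx0 => ->; rewrite horner0.
have [d'0|d'0] := eqVneq d^`() 0.
  move: id0; rewrite d'0 mulr0 => /eqP; rewrite mulf_eq0 (negPf d0) orbF => /eqP.
  move=> /(deriv_eq0_char0 char0) p0; move/(deriv_eq0_char0 char0): d'0 => dC.
  by rewrite fE p0 dC !hornerC rpredM ?rpredV //; apply: polyOverP.
have d'x : d^`().[x] != 0 by rewrite (transc_horner_neq0 tx) ?polyOver_deriv.
apply: (IH p^`() d^`()); rewrite ?polyOver_deriv //; last first.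
  by rewrite (leq_trans _ sd) // lt_size_deriv.
rewrite fE; apply/eqP; rewrite eqr_div //.
by rewrite -!hornerM id0.
Qed.

(** On polynomials the extension is forced: apply [X] to the coefficients and add the formal
    derivative times [y]. By transcendence of [x], the quotient rule then gives the same value for
    all fractions representing an element. *)
Lemma der_extend E x X y : transc E x -> der_on idfun E X ->
  exists X', [/\ der_on idfun (adj E x) X', forall f, f \in E -> X' f = X f
               & X' x = y].
Proof.
move=> tx dX; pose D p := (map_poly X p).[x] + p^`().[x] * y.
have X0 := der0 dX.
have DB p q : p \is a polyOver E -> q \is a polyOver E -> D (p - q) = D p - D q.
  move=> pE qE; rewrite /D.
  have -> : map_poly X (p - q) = map_poly X p - map_poly X q.
    apply/polyP => i; rewrite coefB !coef_map_id0 // coefB (derB dX) //;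
      exact: polyOverP.
  by rewrite derivB !(hornerD, hornerN); ring.
have DM p q : p \is a polyOver E -> q \is a polyOver E ->
    D (p * q) = p.[x] * D q + D p * q.[x].
  move=> pE qE; rewrite /D.
  have -> : map_poly X (p * q) = p * map_poly X q + map_poly X p * q.
    apply/polyP => i; rewrite coefD !coef_map_id0 // !coefM (der_sum dX).
      rewrite -big_split; apply: eq_bigr => j _; rewrite (derM dX) //=.
      - by rewrite !coef_map_id0.
      - exact: polyOverP.
      - exact: polyOverP.
    by move=> j; rewrite rpredM //; apply: polyOverP.
  by rewrite derivM !(hornerD, hornerM); ring.
pose Rv f v := exists p d, [/\ p \is a polyOver E, d \is a polyOver E,
  d.[x] != 0, f = p.[x] / d.[x] & v = (D p * d.[x] - p.[x] * D d) / d.[x] ^+ 2].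
have Rfun f v w : Rv f v -> Rv f w -> v = w.
  move=> [p [d [pE dE d0 -> ->]]] [p1 [d1 [p1E d1E d10 + ->]]] => /eqP.
  rewrite eqr_div // -!hornerM => /eqP /(transc_inj tx).
  rewrite !rpredM // => /(_ isT isT) pd.
  have := congr1 D pd; rewrite !DM // => E1.
  have := congr1 (fun r => r.[x]) pd; rewrite !hornerM => E2.
  have Ep : p.[x] = p1.[x] * d.[x] / d1.[x] by rewrite -E2 mulfK.
  have EDp : D p = (p1.[x] * D d + D p1 * d.[x] - p.[x] * D d1) / d1.[x].
    by rewrite -E1 addrC addKr mulfK.
  by rewrite EDp Ep; field; rewrite d0 d10.
have /choice[X' X'P] : forall f, exists v, f \in adj E x -> Rv f v.
  move=> f; case: (boolP (f \in adj E x)) => [|fA]; last by exists 0.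
  by move=> /adjP[p [d [pE dE d0 fE]]]; eexists => _; exists p, d; split; eauto.
have X'E f v : Rv f v -> X' f = v.
  move=> fv; apply: (Rfun f) => //; apply: X'P.
  by case: fv => p [d [pE dE d0 fE _]]; apply/adjP; exists p, d.
have DC c : D c%:P = X c.
  rewrite /D derivC horner0 mul0r addr0.
  rewrite [map_poly X _](_ : _ = (X c)%:P) ?hornerC //.
  by apply/polyP => i; rewrite coef_map_id0 // !coefC; case: (i == 0%N).
have D1 : D 1 = 0 by rewrite -polyC1 DC (der1 dX).
exists X'; split; first split.
- move=> f g /X'P[p [d [pE dE d0 fE ->]]] /X'P[p1 [d1 [p1E d1E d10 gE ->]]].
  apply: X'E; exists (p * d1 - p1 * d), (d * d1).
  rewrite rpredB ?rpredM // hornerM mulf_neq0 //; split=> //.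
    by rewrite fE gE hornerD hornerN !hornerM; field; rewrite d0 d10.
  rewrite DB ?rpredM // !DM // hornerD hornerN !hornerM.
  by field; rewrite d0 d10.
- move=> f g /X'P[p [d [pE dE d0 fE ->]]] /X'P[p1 [d1 [p1E d1E d10 gE ->]]].
  apply: X'E; exists (p * p1), (d * d1).
  rewrite ?rpredM // hornerM mulf_neq0 //; split=> //.
    by rewrite fE gE !hornerM; field; rewrite d0 d10.
  by rewrite !DM // !hornerM fE gE /=; field; rewrite d0 d10.
- move=> f fE; apply: X'E; exists f%:P, 1.
  rewrite polyOverC fE rpred1 !hornerC oner_eq0; split; rewrite ?divr1 //.
  by rewrite D1 mulr0 subr0 mulr1 expr1n divr1 DC.
- apply: X'E; exists 'X, 1; rewrite polyOverX rpred1 hornerX hornerC oner_eq0.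
  split; rewrite ?divr1 //.
  rewrite D1 mulr0 subr0 mulr1 expr1n divr1 /D derivX hornerC mul1r.
  rewrite [map_poly X 'X](_ : _ = 0) ?horner0 ?add0r //.
  apply/polyP => i; rewrite coef_map_id0 // coefX coef0.
  by case: eqP => _; rewrite ?(der1 dX).
Qed.

End Derivations.

Section TotalDerivations.
Variables (L : fieldType).

Definition total_pred : {pred L} := fun=> true.

Lemma total_closed : divring_closed total_pred. Proof. by split. Qed.

HB.instance Definition _ := GRing.isDivringClosed.Build L total_pred total_closed.

(** All of [L] as a subfield of itself, so that the theory of [der_on] covers everywhere defined
    derivations. *)
Definition total_field : divringClosed L := total_pred.

Variable D : L -> L.
Hypothesis dD : der_on idfun total_field D.

Lemma tderB f g : D (f - g) = D f - D g. Proof. exact: (derB dD). Qed.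
Lemma tderD f g : D (f + g) = D f + D g. Proof. exact: (derD dD). Qed.
Lemma tderM f g : D (f * g) = f * D g + D f * g. Proof. exact: (derM dD). Qed.

Lemma tder_div f g : g != 0 -> D (f / g) = (D f * g - f * D g) / g ^+ 2.
Proof. exact: (der_div dD). Qed.
Lemma tderV f : D f^-1 = - D f / f ^+ 2. Proof. exact: (derV dD). Qed.

Lemma tderXn f n : f != 0 -> D (f ^+ n) = n%:R * f ^+ n * (D f / f).
Proof.
move=> f0; elim: n => [|n IH]; first by rewrite expr0 (der1 dD) !mul0r.
by rewrite exprS tderM IH -[n.+1]add1n natrD; field.
Qed.

End TotalDerivations.

Section Constants.
Variables (K L : fieldType) (iota : {rmorphism K -> L}).

Definition const_pred : {pred L} := fun f => `[< exists c, f = iota c >].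

Lemma const_closed : divring_closed const_pred.
Proof.
split=> [|f g /asboolP[a ->] /asboolP[b ->]|f g /asboolP[a ->] /asboolP[b ->]].
- by apply/asboolP; exists 1; rewrite rmorph1.
- by apply/asboolP; exists (a - b); rewrite rmorphB.
- by apply/asboolP; exists (a / b); rewrite rmorphM fmorphV.
Qed.

HB.instance Definition _ := GRing.isDivringClosed.Build L const_pred const_closed.

Definition consts : divringClosed L := const_pred.

Lemma constsP f : reflect (exists c, f = iota c) (f \in consts).
Proof. exact: asboolP. Qed.

Lemma const_in c : iota c \in consts.
Proof. by apply/constsP; exists c. Qed.

End Constants.

(** * Root multiplicities and local rings *)

Section RootMultiplicity.
Variable K : fieldType.
Implicit Types (p q : {poly K}) (a : K).

Lemma mup_gt0 p a : p != 0 -> (0 < mup a p)%N = root p a.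
Proof. by move=> p0; rewrite -XsubC_dvd // dvdp_XsubCl. Qed.

Lemma mup_factor p a : p != 0 ->
  exists2 q, q.[a] != 0 & p = q * ('X - a%:P) ^+ mup a p.
Proof.
move=> p0; have [m [q qa pE]] := multiplicity_XsubC p a.
rewrite p0 /= in qa; exists q => //; rewrite {2}pE mupMr //.
by rewrite mup_XsubCX eqxx.
Qed.

Lemma mup_unique p q a n : q.[a] != 0 -> p = q * ('X - a%:P) ^+ n -> mup a p = n.
Proof. by move=> qa ->; rewrite mupMr // mup_XsubCX eqxx. Qed.

Lemma mupXn p a n : p != 0 -> mup a (p ^+ n) = (n * mup a p)%N.
Proof.
move=> p0; elim: n => [|n IH].
  by rewrite expr0 mul0n mupNroot // rootC oner_eq0.
by rewrite exprS mupM ?expf_neq0 // IH mulSn.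
Qed.

Lemma mup_prod (I : eqType) (s : seq I) (F : I -> {poly K}) a :
  (forall i, F i != 0) -> mup a (\prod_(i <- s) F i) = (\sum_(i <- s) mup a (F i))%N.
Proof.
move=> F0; elim: s => [|i s IH].
  by rewrite !big_nil mupNroot // rootC oner_eq0.
by rewrite !big_cons mupM ?IH // prodf_seq_neq0; apply/allP => j _; rewrite F0.
Qed.

(** The Wronskian is the numerator of the derivative of [p / q], and differentiation lowers the
    order [e] of a zero by one, the factor [e] being nonzero in characteristic zero. *)
Lemma mup_wronskian p q a : [pchar K] =i pred0 -> p != 0 -> root p a ->
  q.[a] != 0 -> mup a (p^`() * q - p * q^`()) = (mup a p).-1.
Proof.
move=> char0 p0 pa qa; have [p1 p1a pE] := mup_factor a p0.
have e0 : (0 < mup a p)%N by rewrite mup_gt0.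
case: (mup a p) e0 pE => // e _ ->.
apply: (@mup_unique _ (p1^`() * ('X - a%:P) * q + p1 * q * (e.+1%:R)%:P
  - p1 * ('X - a%:P) * q^`())).
  rewrite !(hornerD, hornerN, hornerM) hornerX !hornerC subrr.
  rewrite !mulr0 !mul0r add0r subr0 !mulf_neq0 //.
  by rewrite ((pcharf0P K).1 char0).
rewrite derivM deriv_exp derivB derivX derivC subr0 mul1r /= exprS.
by ring.
Qed.

End RootMultiplicity.

Section LocalRings.
Variables (K L : fieldType) (iota : {rmorphism K -> L}).
Implicit Types (z f g : L) (N D : {poly K}) (a c : K).

Definition hev z N := (map_poly iota N).[z].

Lemma hevD z N D : hev z (N + D) = hev z N + hev z D.
Proof. by rewrite /hev rmorphD hornerD. Qed.
Lemma hevN z N : hev z (- N) = - hev z N.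
Proof. by rewrite /hev rmorphN hornerN. Qed.
Lemma hevM z N D : hev z (N * D) = hev z N * hev z D.
Proof. by rewrite /hev rmorphM hornerM. Qed.
Lemma hevXn z N n : hev z (N ^+ n) = hev z N ^+ n.
Proof. by rewrite /hev rmorphXn horner_exp. Qed.
Lemma hevC z c : hev z c%:P = iota c.
Proof. by rewrite /hev map_polyC hornerC. Qed.
Lemma hevX z : hev z 'X = z.
Proof. by rewrite /hev map_polyX hornerX. Qed.
Lemma hevZ z c N : hev z (c *: N) = iota c * hev z N.
Proof. by rewrite -mul_polyC hevM hevC. Qed.
Lemma hev_prod z (I : Type) (s : seq I) (F : I -> {poly K}) :
  hev z (\prod_(i <- s) F i) = \prod_(i <- s) hev z (F i).
Proof. by rewrite /hev rmorph_prod horner_prod. Qed.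

Lemma consts_poly (p : {poly L}) : p \is a polyOver (consts iota) ->
  exists N, p = map_poly iota N.
Proof.
move=> /polyOverP pE; have /choice[F FE] i : exists c, p`_i = iota c.
  by apply/constsP.
exists (\poly_(i < size p) F i); apply/polyP => i.
rewrite coef_map coef_poly; case: ltnP => sp; first exact: FE.
by rewrite raddf0 nth_default.
Qed.

Lemma hev_polyOver N : map_poly iota N \is a polyOver (consts iota).
Proof. by apply/polyOverP => i; rewrite coef_map const_in. Qed.

Section Transcendental.
Variable z : L.
Hypothesis z_transc : transc (consts iota) z.

Lemma hev_eq0 N : (hev z N == 0) = (N == 0).
Proof.
apply/eqP/eqP => [|->]; last by rewrite /hev map_poly0 horner0.
by move/(z_transc (hev_polyOver N))/eqP; rewrite map_poly_eq0 => /eqP.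
Qed.

Lemma hev_inj : injective (hev z).
Proof.
by move=> N D /eqP; rewrite -subr_eq0 -hevN -hevD hev_eq0 subr_eq0 => /eqP.
Qed.

Lemma adj_constsP f : f \in adj (consts iota) z <->
  exists N D, [/\ D != 0, coprimep N D & f = hev z N / hev z D].
Proof.
split=> [/adjP[p [d [/consts_poly[N ->] /consts_poly[D ->] D0 ->]]]|].
  have {}D0 : D != 0 by rewrite -hev_eq0.
  have g0 : gcdp N D != 0 by rewrite gcdp_eq0 negb_and D0 orbT.
  exists (N %/ gcdp N D), (D %/ gcdp N D); split.
  - by rewrite dvdp_div_eq0 ?dvdp_gcdr.
  - by rewrite coprimep_div_gcd // D0 orbT.
  - rewrite -[N in LHS](divpK (dvdp_gcdl N D)) -[D in X in _ / X](divpK (dvdp_gcdr N D)).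
    rewrite -/(hev z _) -/(hev z _) !hevM -mulf_div divff ?mulr1 //.
    by rewrite hev_eq0.
move=> [N [D [D0 _ ->]]].
by apply: rpred_div; rewrite rpred_horner ?adj_gen //;
  apply: polyOverS (hev_polyOver _) => g; apply: sub_adj.
Qed.

(* [f] is regular at [z = a], with value [c] there. *)
Definition at_ a f c := exists N D,
  [/\ D.[a] != 0, f = hev z N / hev z D & c = N.[a] / D.[a]].

Lemma poly_neq0_at D a : D.[a] != 0 -> D != 0.
Proof. by apply: contra_neq => ->; rewrite horner0. Qed.

Lemma at_const a c : at_ a (iota c) c.
Proof.
by exists c%:P, 1; rewrite -polyC1 !hevC !hornerC rmorph1 !divr1 oner_eq0.
Qed.

Lemma at_hev a N : at_ a (hev z N) N.[a].
Proof. by exists N, 1; rewrite -polyC1 !hevC !hornerC rmorph1 !divr1 oner_eq0. Qed.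

Lemma at_add a f g c d : at_ a f c -> at_ a g d -> at_ a (f + g) (c + d).
Proof.
move=> [N [D [D0 -> ->]]] [N' [D' [D'0 -> ->]]].
exists (N * D' + N' * D), (D * D'); rewrite hornerM mulf_neq0 //; split=> //.
  by rewrite hevD !hevM addf_div ?hev_eq0 ?(poly_neq0_at D0) ?(poly_neq0_at D'0).
by rewrite hornerD !hornerM addf_div.
Qed.

Lemma at_mul a f g c d : at_ a f c -> at_ a g d -> at_ a (f * g) (c * d).
Proof.
move=> [N [D [D0 -> ->]]] [N' [D' [D'0 -> ->]]].
exists (N * N'), (D * D'); rewrite hornerM mulf_neq0 //; split=> //.
  by rewrite !hevM mulf_div.
by rewrite !hornerM mulf_div.
Qed.

Lemma at_opp a f c : at_ a f c -> at_ a (- f) (- c).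
Proof.
move=> fc; rewrite -mulN1r -[- c]mulN1r; apply: at_mul => //.
by rewrite -[-1 in X in at_ _ X _](rmorphN1 iota); apply: at_const.
Qed.

Lemma at_inv a f c : at_ a f c -> c != 0 -> at_ a f^-1 c^-1.
Proof.
move=> [N [D [D0 -> ->]]]; rewrite mulf_eq0 invr_eq0 (negPf D0) orbF => N0.
by exists D, N; rewrite !invf_div.
Qed.

Lemma at_exp a f c n : at_ a f c -> at_ a (f ^+ n) (c ^+ n).
Proof.
move=> fc; elim: n => [|n IH]; last by rewrite !exprS; apply: at_mul.
by rewrite !expr0 -[1 in X in at_ _ X _](rmorph1 iota); apply: at_const.
Qed.

Lemma at_uniq a f c d : at_ a f c -> at_ a f d -> c = d.
Proof.
move=> [N [D [D0 -> ->]]] [N' [D' [D'0 + ->]]] => /eqP.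
rewrite eqr_div ?hev_eq0 ?(poly_neq0_at D0) ?(poly_neq0_at D'0) // -!hevM.
move=> /eqP/hev_inj/(congr1 (fun p => p.[a])); rewrite !hornerM => E.
by apply/eqP; rewrite eqr_div // E.
Qed.

Lemma at_neq0 a f c : at_ a f c -> c != 0 -> f != 0.
Proof.
move=> [N [D [D0 -> ->]]]; rewrite mulf_eq0 => /norP[Na _].
by rewrite mulf_neq0 ?invr_eq0 ?hev_eq0 ?(poly_neq0_at D0) ?(poly_neq0_at Na).
Qed.

Lemma at_var a : at_ a z a.
Proof. by have := at_hev a 'X; rewrite hevX hornerX. Qed.

Lemma at_uniformizer a : at_ a (z - iota a) 0.
Proof.
rewrite -(subrr a); apply: at_add; first exact: at_var.
exact/at_opp/at_const.
Qed.

Lemma uniformizerE a : z - iota a = hev z ('X - a%:P).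
Proof. by rewrite hevD hevN hevX hevC. Qed.

Lemma uniformizer_neq0 a : z - iota a != 0.
Proof. by rewrite uniformizerE hev_eq0 polyXsubC_eq0. Qed.

Lemma hev_factor N a : N != 0 -> exists f c,
  [/\ at_ a f c, c != 0 & hev z N = f * (z - iota a) ^+ mup a N].
Proof.
move=> /(mup_factor a)[q qa NE]; exists (hev z q), q.[a]; split=> //.
  exact: at_hev.
by rewrite {1}NE hevM hevXn uniformizerE.
Qed.

(** Positivity of [n] makes [N] vanish at [a]; coprimality then keeps [D] from vanishing there, so
    that the numerator carries the whole order. *)
Lemma mup_num N D a f c n : coprimep N D -> D != 0 -> at_ a f c -> c != 0 ->
  (0 < n)%N -> hev z N / hev z D = f * (z - iota a) ^+ n -> mup a N = n.
Proof.
move=> cND D0 [U [V [V0 -> ->]]]; rewrite mulf_eq0 => /norP[U0 _] n0 /eqP.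
rewrite uniformizerE -hevXn mulrAC -hevM eqr_div ?hev_eq0 ?(poly_neq0_at V0) //.
rewrite -!hevM => /eqP/hev_inj E.
have Up := poly_neq0_at U0; have Vp := poly_neq0_at V0.
have X0 : ('X - a%:P) ^+ n != 0 by rewrite expf_neq0 // polyXsubC_eq0.
have N0 : N != 0.
  apply: contra_eq_neq E => ->; rewrite mul0r eq_sym !mulf_neq0 //.
have Na : root N a.
  have /eqP := congr1 (fun p : {poly K} => p.[a]) E.
  rewrite !hornerM horner_exp hornerXsubC subrr expr0n -[n == 0%N]negbK -lt0n n0.
  by rewrite mulr0 mul0r mulf_eq0 (negPf V0) orbF.
have Da : ~~ root D a by rewrite rootE (coprimep_root cND).
have := congr1 (mup a) E; have Va : ~~ root V a by rewrite rootE.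
have Ua : ~~ root U a by rewrite rootE.
by rewrite (mupMl _ Va) (mupMl _ Da) (mupMr _ Ua) mup_XsubCX eqxx.
Qed.

Lemma mup_den N D a f c n : coprimep N D -> N != 0 -> D != 0 -> at_ a f c ->
  c != 0 -> (0 < n)%N -> hev z N / hev z D = f / (z - iota a) ^+ n ->
  mup a D = n.
Proof.
move=> cND N0 D0 fc c0 n0 E; apply: (@mup_num D N a f^-1 c^-1) => //.
- by rewrite coprimep_sym.
- exact: at_inv.
- by rewrite invr_eq0.
- by rewrite -invf_div E invf_div mulrC.
Qed.

End Transcendental.
End LocalRings.

(** A polynomial relation splits into linear factors, one of which would make [z] a constant. *)
Lemma notin_consts_transc (K : closedFieldType) (L : fieldType)
    (iota : {rmorphism K -> L}) z : z \notin consts iota -> transc (consts iota) z.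
Proof.
move=> zK _ /consts_poly[N ->].
have [r NE] := closed_field_poly_normal N; move/eqP.
rewrite -/(hev iota z N) NE hevZ hev_prod mulf_eq0 fmorph_eq0 => /orP[/eqP->|].
  by rewrite scale0r map_poly0.
rewrite prodf_seq_eq0 => /hasP[a _ /=].
rewrite -uniformizerE subr_eq0 => /eqP zE.
by move: zK; rewrite zE const_in.
Qed.

(** * Elimination of the higher derivatives *)

Section AlgebraicIndependence.
Variables (K L : fieldType) (iota : {rmorphism K -> L}).

Lemma muni_inj n (p : {mpoly K[n.+1]}) : muni p = 0 -> p = 0.
Proof.
move=> p0; apply/mpolyP => m0; rewrite mcoeff0.
pose w (m : 'X_{1..n.+1}) := [multinom m (widen_ord (leqnSn n) i) | i < n].
have := congr1 (fun q : {poly {mpoly K[n]}} => (q`_(m0 ord_max))@_(w m0)) p0.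
rewrite coef0 mcoeff0 muniE coef_sum raddf_sum /= => <-.
have term m : (p@_m *: 'X_[w m] *: 'X^(m ord_max) : {poly {mpoly K[n]}})`_(m0 ord_max)@_(w m0)
    = p@_m *+ (m == m0).
  rewrite coefZ coefXn; have [->|mm0] := eqVneq m m0.
    by rewrite eqxx mulr1 mcoeffZ mcoeffX eqxx mulr1.
  case: eqP => [e|_]; last by rewrite mulr0 mcoeff0.
  rewrite mulr1 mcoeffZ mcoeffX; case: eqP => [we|_]; last by rewrite mulr0.
  case/eqP: mm0; apply/mnmP => i; case: (unliftP ord_max i) => [j ->|->] //.
  have /mnmP/(_ j) := we; rewrite !mnmE.
  suff -> : lift ord_max j = widen_ord (leqnSn n) j by [].
  by apply: val_inj; rewrite /= /bump leqNgt ltn_ord.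
rewrite (eq_bigr (fun m => p@_m *+ (m == m0))) => [|m _]; last exact: term.
have [m0p|m0p] := boolP (m0 \in msupp p).
  rewrite (bigD1_seq m0) ?msupp_uniq //= eqxx big1 ?addr0 // => m /negPf->.
  by rewrite mulr0n.
rewrite (memN_msupp_eq0 m0p) big_seq big1 // => m mp.
by rewrite (_ : m == m0 = false) // ; apply: contraNF m0p => /eqP <-.
Qed.

Lemma mmap_muni n (h : 'I_n.+1 -> L) (p : {mpoly K[n.+1]}) :
  mmap iota h p =
  (map_poly (mmap iota (fun i : 'I_n => h (widen_ord (leqnSn n) i))) (muni p)).[h ord_max].
Proof.
rewrite muniE raddf_sum horner_sum; apply: eq_bigr => m _ /=.
rewrite linearZ /= map_polyXn hornerZ hornerXn /mmap1 big_ord_recr /= mulrA.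
congr (_ * _); rewrite mmapZ mmapX; congr (_ * _); rewrite /mmap1.
by apply: eq_bigr => i _; rewrite mnmE.
Qed.

Lemma mmap_msym n (s : 'S_n) (h : 'I_n -> L) (p : {mpoly K[n]}) :
  mmap iota h (msym s p) = mmap iota (fun i => h (s i)) p.
Proof.
rewrite [msym s p]/mmap raddf_sum; apply: eq_bigr => m _ /=.
rewrite rmorphM /= mmapC; congr (_ * _); rewrite /mmap1 rmorph_prod.
by apply: eq_bigr => i _; rewrite rmorphXn /= mmapX mmap1U.
Qed.

(** Induction on the number of variables, singling out the last one: specialising the others gives a
    univariate polynomial over [F n] with a transcendental root, so each of its coefficients is a
    relation in fewer variables. *)
Lemma transc_family (F : nat -> divringClosed L) n (h : 'I_n -> L) :
    (forall i c, iota c \in F i) -> (forall i : 'I_n, transc (F i) (h i)) ->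
    (forall (i : 'I_n) j, (i < j)%N -> h i \in F j) ->
  forall p, mmap iota h p = 0 -> p = 0.
Proof.
move=> FK; elim: n h => [|n IH] h tr hF p.
  have -> : p = (p@_0%MM)%:MP.
    by apply/mpolyP => m; rewrite mcoeffC (_ : m = 0%MM) ?eqxx ?mulr1 //; apply/mnmP => -[].
  by rewrite mmapC => /eqP; rewrite fmorph_eq0 => /eqP->; rewrite mpolyC0.
rewrite mmap_muni; set h' := fun i => _; set q := map_poly _ _ => qh.
have mmF r : mmap iota h' r \in F n.
  rewrite rpred_sum // => m _; rewrite rpredM ?FK // rpred_prod // => i _.
  by rewrite rpredX // hF /=.
have qF : q \is a polyOver (F n).
  by apply/polyOverP => i; rewrite coef_map; apply: mmF.
have q0 := tr ord_max q qF qh.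
apply: muni_inj; apply/polyP => i; rewrite coef0; apply: (IH h') => [j|j k jk|].
- exact: tr (widen_ord _ j).
- exact: hF.
- by have := congr1 (fun r : {poly L} => r`_i) q0; rewrite coef_map coef0.
Qed.

End AlgebraicIndependence.

(** The Schwarzian derivative, the cocycle measuring how far [y] is from a projective change of
    coordinate. *)
Definition schwarz (L : fieldType) (D : L -> L) y :=
  D (D (D y)) / D y - 3%:R / 2%:R * (D (D y) / D y) ^+ 2.

(** * The tower of jets of [x] and the action of [phi] on it *)

Section Elimination.
Variables (K : numClosedFieldType) (L : fieldType) (iota : {rmorphism K -> L}).
Variables (phi : {rmorphism L -> L}) (theta : L -> L) (t : L) (q : K) (x : L).
Hypothesis phiK : forall c, phi (iota c) = iota c.
Hypothesis theta_der : forall E : divringClosed L, der_on idfun E theta.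
Hypothesis thetaK : forall c, theta (iota c) = 0.
Hypothesis phi_theta : forall f, phi (theta f) = theta (phi f).
Hypothesis t_neq0 : t != 0.
Hypothesis phit : phi t = iota q * t.
Hypothesis theta_t : theta t = t.
Hypothesis phi_fixed : forall f, phi f = f -> exists c, f = iota c.
Hypothesis q_neq0 : q != 0.

Notation K0 := (consts iota).
Definition base : divringClosed L := adj K0 x.
Notation B := base.
Notation u := (theta x).
(** On [base] this is d/dx, as it sends [x] to 1; thus [r'] is [S'(x)], where [phi x = S(x)]. *)
Definition dx f := theta f / u.
Notation r' := (dx (phi x)).

Hypothesis phix : phi x \in B.
Hypothesis u_neq0 : u != 0.
Hypothesis transc_t : transc B t.

Lemma char0L : [pchar L] =i pred0.
Proof. by move=> p; rewrite (fmorph_pchar iota) pchar_num. Qed.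

Lemma natr0 n : (n%:R == 0 :> L) = (n == 0%N).
Proof. exact: ((pcharf0P L).1 char0L). Qed.

Lemma phi_u : phi u = r' * u.
Proof. by rewrite phi_theta /dx divfK. Qed.

Lemma r'_neq0 : r' != 0.
Proof. by rewrite /dx mulf_neq0 ?invr_eq0 // -phi_theta fmorph_eq0. Qed.

Lemma dx_der (E : divringClosed L) : der_on idfun E dx.
Proof.
have d := theta_der E; split=> f g fE gE; rewrite /dx.
  by rewrite (derB d) // mulrBl.
by rewrite (derM d) //= mulrDl -!mulrA [u^-1 * g]mulrC.
Qed.

Lemma theta_dx f : theta f = dx f * u.
Proof. by rewrite /dx divfK. Qed.

Lemma dxK c : dx (iota c) = 0.
Proof. by rewrite /dx thetaK mul0r. Qed.

Lemma dx_base f : f \in B -> dx f \in B.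
Proof.
move: f; apply: (der_stable (dx_der _)) => // [f /constsP[c ->]|].
  by rewrite dxK rpred0.
by rewrite /dx divff ?rpred1.
Qed.

Lemma phi_base f : f \in B -> phi f \in B.
Proof.
by move: f; apply: adj_morph => // f /constsP[c ->]; rewrite phiK sub_adj ?const_in.
Qed.

Lemma phi_dx f : phi (dx f) = dx (phi f) / r'.
Proof.
have tx0 : theta (phi x) != 0 by rewrite -phi_theta fmorph_eq0.
by rewrite /dx fmorph_div !phi_theta; field; rewrite u_neq0.
Qed.

Lemma x_base : x \in B. Proof. exact: adj_gen. Qed.

Definition xk k := iter k theta x.
Arguments xk : simpl never.

(** [t] comes right after [x], over which it is transcendental: it can later be removed by taking
    leading coefficients in [t] or by means of [t d/dt]. *)
Fixpoint tower k : divringClosed L :=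
  if k is k'.+1 then adj (tower k') (xk k) else adj B t.
Notation E := tower.

Lemma towerS k : {subset E k <= E k.+1}.
Proof. by move=> f fE; apply: sub_adj. Qed.

Lemma tower_mono k m : (k <= m)%N -> {subset E k <= E m}.
Proof.
move=> /subnK <-; elim: (m - k)%N => [|i IH] f fE //.
by rewrite addSn; apply/towerS/IH.
Qed.

Lemma base_tower k : {subset B <= E k}.
Proof. by move=> f fB; apply: (@tower_mono 0) => //; apply: sub_adj. Qed.

Lemma t_tower k : t \in E k.
Proof. by apply: (@tower_mono 0) => //; apply: adj_gen. Qed.

Lemma xk_tower k m : (k <= m)%N -> xk k \in E m.
Proof.
case: k => [|k] km; first by rewrite base_tower // x_base.
exact/(tower_mono km)/adj_gen.
Qed.

Lemma const_tower c k : iota c \in E k.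
Proof. by rewrite base_tower // sub_adj // const_in. Qed.

Lemma theta_tower k f : f \in E k -> theta f \in E k.+1.
Proof.
elim: k f => [|k IH] /=.
  apply: (der_stable (theta_der _)) => [f|f fB|].
  - exact: sub_adj.
  - rewrite theta_dx rpredM ?(@xk_tower 1 1) //.
    by apply/(@base_tower 1)/dx_base.
  - by rewrite theta_t (t_tower 1).
apply: (der_stable (theta_der _)) => [f|f fE|].
- exact: sub_adj.
- exact/sub_adj/IH.
- exact: (@xk_tower k.+2 k.+2).
Qed.

(** By the chain rule the transform is affine in the highest derivative. Its slope [r'] is the same
    at all orders, so that corrections can be compared with [u], for which [phi u = r' * u]. *)
Lemma phi_xk k : exists2 l, l \in E k & phi (xk k.+1) = r' * xk k.+1 + l.
Proof.
elim: k => [|k [l lE IH]].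
  by exists 0; rewrite ?rpred0 // addr0 phi_u.
exists (theta r' * xk k.+1 + theta l).
  by rewrite rpredD ?rpredM ?xk_tower // theta_tower // base_tower // dx_base.
rewrite [in LHS]/xk iterS -/(xk k.+1) phi_theta IH.
have tE := theta_der (E k.+1).
have xE : xk k.+1 \in E k.+1 by rewrite xk_tower.
have rE : r' \in E k.+1 by rewrite base_tower // dx_base.
have lE' : l \in E k.+1 by apply: towerS.
rewrite (derD tE) //; last by rewrite rpredM.
rewrite (derM tE) //=.
by rewrite -[theta (xk k.+1)]/(xk k.+2) addrA.
Qed.

Lemma phi_tower k f : f \in E k -> phi f \in E k.
Proof.
elim: k f => [|k IH] /=.
  apply: adj_morph => [f fB|]; first by rewrite sub_adj // phi_base.
  by rewrite phit rpredM ?(t_tower 0) ?(const_tower _ 0).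
apply: adj_morph => [f fE|]; first by rewrite sub_adj ?IH.
have [l lE ->] := phi_xk k.
rewrite rpredD //; last exact: sub_adj.
by rewrite rpredM ?adj_gen //; apply: (@base_tower k.+1); apply: dx_base.
Qed.

Lemma der_onS tau (E1 E2 : divringClosed L) Z :
  {subset E1 <= E2} -> der_on tau E2 Z -> der_on tau E1 Z.
Proof. by move=> s [dB dM]; split=> f g /s fE /s gE; [apply: dB|apply: dM]. Qed.

Lemma tower_vanish tau m Z : der_on tau (E m) Z ->
    (forall c, Z (iota c) = 0) -> Z t = 0 ->
    (forall k, (k <= m)%N -> Z (xk k) = 0) ->
  forall f, f \in E m -> Z f = 0.
Proof.
move=> dZ ZK Zt; elim: m dZ => [|m IH] dZ Zx.
  apply: (der_vanish dZ) => //; apply: der_vanish (Zx 0 isT).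
    by apply: der_onS dZ => f fB; apply: sub_adj.
  by move=> f /constsP[c ->].
apply: (der_vanish dZ) => [|]; last exact: Zx.
by apply: IH => [|k km]; [apply: der_onS dZ; apply: towerS|apply/Zx/leqW].
Qed.

Lemma tower_stable m (E' : divringClosed L) Z :
    der_on idfun (E m) Z -> {subset E m <= E'} ->
    (forall f, f \in B -> Z f = 0) -> Z t \in E' ->
    (forall k, (k < m)%N -> Z (xk k.+1) \in E') ->
  forall f, f \in E m -> Z f \in E'.
Proof.
move=> dZ sE ZB Zt; elim: m dZ sE => [|m IH] dZ sE Zx.
  by apply: (der_stable dZ) => // f /ZB->; rewrite rpred0.
apply: (der_stable dZ) => [||]; [by []| |exact: Zx].
apply: IH => [||k km]; last exact/Zx/leqW.
  by apply: der_onS dZ; apply: towerS.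
by move=> f fE; apply/sE/towerS.
Qed.

Lemma tower_der m (yt : L) (y : nat -> L) :
    (forall k, (k < m)%N -> transc (E k) (xk k.+1)) ->
  exists X, [/\ der_on idfun (E m) X, forall f, f \in B -> X f = 0, X t = yt
    & forall k, (k < m)%N -> X (xk k.+1) = y k.+1].
Proof.
elim: m => [_|m IH tr].
  have d0 : der_on idfun B (fun=> 0).
    by split=> f g _ _; rewrite ?subrr // mulr0 mul0r addr0.
  by have [X [dX XB Xt]] := der_extend yt transc_t d0; exists X; split.
have [|X [dX XB Xt Xx]] := IH; first by move=> k km; apply/tr/leqW.
have [X' [dX' X'E X'x]] := der_extend (y m.+1) (tr m (leqnn _)) dX.
exists X'; split=> //.
- by move=> f fB; rewrite X'E ?XB // base_tower.
- by rewrite X'E ?t_tower.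
- move=> k; rewrite ltnS leq_eqVlt => /predU1P[->//|km].
  by rewrite X'E ?Xx // xk_tower.
Qed.

(** [semi_invariant] yields an eigenvector that may involve [t]. As [phi] multiplies [t] by [q],
    passing to leading coefficients in [t] gives one in [C(x)], at the price of the factor
    [q ^ j]. *)
Lemma semi_invariant_base : ~ transc (E 0) (xk 1) ->
  exists n (j : int) A, [/\ (0 < n)%N, A \in B, A != 0
    & phi A = iota (q ^ j) * r' ^+ n * A].
Proof.
move=> ntr.
have [|n [a [n0 /adjP[p [d [pE dE dt0 aE]]] a0 phia]]] :=
    semi_invariant (@phi_tower 0) ntr u_neq0 _ r'_neq0 phi_u.
  by rewrite base_tower // dx_base.
have p0 : p != 0 by apply: contra_neq a0 => p0; rewrite aE p0 horner0 mul0r.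
have d0 : d != 0 by apply: contra_neq dt0 => ->; rewrite horner0.
(* The polynomial whose value at [t] is [phi f.[t]]. *)
pose tw (f : {poly L}) := map_poly phi f \Po (iota q *: 'X).
have iq0 : iota q != 0 by rewrite fmorph_eq0.
have twE f : f \is a polyOver B -> tw f \is a polyOver B.
  move=> fE; rewrite polyOver_comp ?polyOverZ ?polyOverX ?sub_adj ?const_in //.
  by apply/polyOverP => i; rewrite coef_map phi_base //; apply/polyOverP.
have twt f : (tw f).[t] = phi f.[t].
  by rewrite horner_comp hornerZ hornerX -phit horner_map.
have lctw f : lead_coef (tw f) = phi (lead_coef f) * iota q ^+ (size f).-1.
  rewrite lead_coef_comp ?size_scale ?size_polyX //.
  by rewrite lead_coef_map lead_coefZ lead_coefX mulr1 size_map_poly.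
have rB : r' \in B by rewrite dx_base.
have : tw p * d = (r' ^+ n)%:P * p * tw d.
  apply: (transc_inj transc_t); rewrite ?rpredM ?twE ?polyOverC ?rpredX //.
  rewrite !hornerM hornerC !twt; move: phia; rewrite aE fmorph_div => /eqP.
  rewrite mulrA eqr_div ?fmorph_eq0 // => /eqP ->.
  by rewrite mulrAC.
move/(congr1 (fun f : {poly L} => lead_coef f)).
rewrite !lead_coefM lead_coefC !lctw => E1.
have lp0 : lead_coef p != 0 by rewrite lead_coef_eq0.
have ld0 : lead_coef d != 0 by rewrite lead_coef_eq0.
exists n, ((size d).-1%:Z - (size p).-1%:Z), (lead_coef p / lead_coef d).
split; rewrite ?mulf_neq0 ?invr_eq0 //.
  by rewrite rpred_div //; apply: polyOverP.
have pd0 : phi (lead_coef d) != 0 by rewrite fmorph_eq0.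
rewrite fmorph_div expfzDr // rmorphM -invr_expz fmorphV -!exprnP !rmorphXn.
set i := (size p).-1 in E1 *; set j := (size d).-1 in E1 *.
have qi : iota q ^+ i != 0 by rewrite expf_neq0.
have -> : phi (lead_coef p) =
    r' ^+ n * lead_coef p * (phi (lead_coef d) * iota q ^+ j)
      / (iota q ^+ i * lead_coef d).
  by apply: (canRL (mulfK _)); [rewrite mulf_neq0|rewrite mulrA E1].
by field; rewrite qi ld0 pd0.
Qed.

Lemma transc_affine (F : divringClosed L) y a b :
  transc F y -> a \in F -> a != 0 -> b \in F -> transc F (a * y + b).
Proof.
move=> ty aF a0 bF p pF py.
have slin : size (a *: 'X + b%:P) = 2%N.
  by rewrite size_polyDl size_scale ?size_polyX // (leq_ltn_trans (size_polyC_leq1 _)).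
have : p \Po (a *: 'X + b%:P) = 0.
  apply: ty; first by rewrite polyOver_comp // rpredD ?polyOverZ ?polyOverX ?polyOverC.
  by rewrite horner_comp hornerD hornerZ hornerX hornerC.
move/(congr1 (fun q : {poly L} => size q)); rewrite size_comp_poly2 // size_poly0.
by move/eqP; rewrite size_poly_eq0 => /eqP.
Qed.

(** * From the derivatives of [sigma] to the jets of [x = 1/sigma] *)

Section InverseCoordinate.
Variable D : nat -> L.
Hypothesis D0 : D 0 = x^-1.
Hypothesis theta_D : forall k, theta (D k) = t * D k.+1.

Lemma theta_tX k : theta (t ^+ k) = k%:R * t ^+ k.
Proof.
have tE := theta_der (E 0); have tt := t_tower 0.
elim: k => [|k IH]; first by rewrite expr0 (der1 tE) mul0r.
rewrite exprS (derM tE) ?rpredX // theta_t IH /= -[k.+1]add1n natrD; ring.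
Qed.

(** Iterates [theta x^-1 = - u / x ^+ 2]: modulo lower order, the derivative of [sigma] of order
    [k.+1] is a nonzero multiple of the jet of the same order. *)
Lemma D_tower k : t ^+ k.+1 * D k.+1 * x ^+ 2 + xk k.+1 \in E k.
Proof.
have x0 : x != 0.
  by apply: contra_neq u_neq0 => ->; apply: (der0 (theta_der B)).
elim: k => [|k eE].
  have tE := theta_der (E 0).
  have : theta (D 0) = - u / x ^+ 2 by rewrite D0 (derV tE) ?(@xk_tower 0).
  by rewrite theta_D => E1; rewrite expr1 E1 divfK ?expf_neq0 // addNr rpred0.
set e := _ + xk k.+1 in eE.
have xE j : x \in E j by apply: (@xk_tower 0).
have ye : t ^+ k.+1 * D k.+1 = (e - xk k.+1) / x ^+ 2.
  by rewrite /e addrK mulfK // expf_neq0.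
have yE : t ^+ k.+1 * D k.+1 \in E k.+1.
  by rewrite ye rpred_div ?rpredB ?rpredX ?xk_tower // towerS.
have tE := theta_der (total_field L).
have thx2 : theta (x ^+ 2) \in E k.+1.
  by apply: (@tower_mono 1) => //; apply: (@theta_tower 0); apply: rpredX (xE 0).
have := theta_tower eE; rewrite {1}/e (tderD tE) (tderM tE) (tderM tE) theta_tX.
rewrite theta_D -[theta (xk k.+1)]/(xk k.+2) => h.
have -> : t ^+ k.+2 * D k.+2 * x ^+ 2 + xk k.+2 =
    (t ^+ k.+1 * D k.+1 * theta (x ^+ 2) +
    (t ^+ k.+1 * (t * D k.+2) + k.+1%:R * t ^+ k.+1 * D k.+1) * x ^+ 2 + xk k.+2)
    - t ^+ k.+1 * D k.+1 * theta (x ^+ 2)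
    - k.+1%:R * (t ^+ k.+1 * D k.+1) * x ^+ 2 by rewrite exprS; ring.
apply: rpredB; first by apply: rpredB h _; apply: rpredM.
by apply: rpredM; [apply: rpredM yE; apply: rpred_nat|apply: rpredX (xE _)].
Qed.

Lemma D_affine k : exists a b, [/\ a \in E k, a != 0, b \in E k
  & D k.+1 = a * xk k.+1 + b].
Proof.
have x0 : x != 0.
  by apply: contra_neq u_neq0 => ->; apply: (der0 (theta_der B)).
have xE : x \in E k by apply: (@xk_tower 0).
have txE : t ^+ k.+1 * x ^+ 2 \in E k by rewrite rpredM ?rpredX ?t_tower.
have tx0 : t ^+ k.+1 * x ^+ 2 != 0 by rewrite mulf_neq0 ?expf_neq0.
exists (- (t ^+ k.+1 * x ^+ 2)^-1),
  ((t ^+ k.+1 * D k.+1 * x ^+ 2 + xk k.+1) / (t ^+ k.+1 * x ^+ 2)).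
rewrite rpredN rpredV txE oppr_eq0 invr_eq0 tx0 rpred_div ?D_tower //; split=> //.
have tk0 : t ^+ k.+1 != 0 by rewrite expf_neq0.
by move: (t ^+ k.+1) tk0 => T T0; field; rewrite T0 x0.
Qed.

Lemma D_in_tower k : D k \in E k.
Proof.
case: k => [|k]; first by rewrite D0 rpredV; apply: (@xk_tower 0).
have [a [b [aE _ bE ->]]] := D_affine k.
by rewrite rpredD ?rpredM ?xk_tower ?towerS.
Qed.

(** If every jet were transcendental over the preceding field, then [t], [sigma] and the derivatives
    of [sigma] would be algebraically independent. *)
Lemma algebraic_tower n (p : {mpoly K[n.+2]}) : transc K0 x -> p != 0 ->
    mmap iota (fun i : 'I_n.+2 => if val i is k.+1 then D k else t) p = 0 ->
  exists N, ~ transc (E N) (xk N.+1).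
Proof.
move=> tx p0 ph; apply: contrapT => ntr.
have tr N : transc (E N) (xk N.+1).
  by apply: contrapT => h; apply: ntr; exists N.
(* Independence is known in the order [x], [t], jets, but the variables come as [t], [sigma],
   derivatives: [s] swaps the first two, and [F] shifts the tower accordingly. *)
pose F k : divringClosed L := if k is k'.+1 then if k' is j.+1 then E j else B else K0.
pose i1 : 'I_n.+2 := Ordinal (isT : (1 < n.+2)%N).
pose s := tperm ord0 i1.
pose h (i : 'I_n.+2) := if val (s i) is k.+1 then D k else t.
have h0 : h ord0 = x^-1 by rewrite /h tpermL /= D0.
have h1 : h i1 = t by rewrite /h tpermR.
have hS (i : 'I_n.+2) k : val i = k.+2 -> h i = D k.+1.
  move=> ik; rewrite /h tpermD /= ?ik //; apply/eqP => e; move: ik;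
    by rewrite -e.
have x0 : x != 0.
  by apply: contra_neq u_neq0 => ->; apply: (der0 (theta_der B)).
have FK i c : iota c \in F i.
  case: i => [|[|j]] /=; [exact: const_in|exact/sub_adj/const_in|exact: const_tower].
case/eqP: p0; rewrite -[p](msym1m p) -(tperm2 ord0 i1) msymMm -/s.
suff -> : msym s p = 0 by rewrite msym0.
have mm : mmap iota h (msym s p) = 0.
  rewrite mmap_msym -[RHS]ph; apply: eq_bigr => m _; congr (_ * _).
  by apply: eq_bigr => i _; rewrite /h /s tpermK.
apply: (transc_family FK) mm => [i|i j ij].
- case iE : (val i) => [|[|k]].
  + have -> : i = ord0 by apply: val_inj.
    by rewrite h0; apply: notin_consts_transc; rewrite rpredV transc_notin.
  + have -> : i = i1 by apply: val_inj.
    by rewrite h1.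
  + rewrite (hS _ _ iE) /=.
    have [a [b [aE a0 bE ->]]] := D_affine k.
    exact: transc_affine.
- case iE : (val i) => [|[|k]].
  + have -> : i = ord0 by apply: val_inj.
    rewrite h0 rpredV; move: ij; rewrite iE.
    by case: j => [|[|j]] //= _; [exact: adj_gen|apply: (@xk_tower 0)].
  + have -> : i = i1 by apply: val_inj.
    rewrite h1; move: ij; rewrite iE.
    by case: j => [|[|j]] //= _; apply: t_tower.
  + rewrite (hS _ _ iE); move: ij; rewrite iE.
    case: j => [|[|j]] //= kj.
    by apply: (@tower_mono k.+1) => //; apply: D_in_tower.
Qed.

End InverseCoordinate.

(** * Jet fields commuting with [phi], and Lie's bound on the order *)

Section HigherOrder.
Variable N : nat.
Hypothesis N_gt0 : (0 < N)%N.
Hypothesis transc_lower : forall k, (k < N)%N -> transc (E k) (xk k.+1).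
Hypothesis alg_top : ~ transc (E N) (xk N.+1).

Lemma phi_r'_eigen f : phi f = r' * f -> exists c, f = iota c * u.
Proof.
move=> fE; have [|c cE] := phi_fixed (f := f / u).
  by rewrite fmorph_div fE phi_u -mulf_div divff ?r'_neq0 // mul1r.
by exists c; rewrite -cE divfK.
Qed.

(** [affine_invariant] finds in [E N] an element with the transformation law of [xk N.+1]. Their
    difference is multiplied by [r'] under [phi], like [u], so it is a constant multiple of [u]. *)
Lemma top_in : xk N.+1 \in E N.
Proof.
have [l lE phix1] := phi_xk N.
have rE : r' \in E N by rewrite base_tower // dx_base.
have [c cE phic] :=
  affine_invariant char0L (@phi_tower N) alg_top rE r'_neq0 lE phix1.
have [k kE] : exists k, xk N.+1 - c = iota k * u.
  by apply: phi_r'_eigen; rewrite rmorphB phix1 phic; ring.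
rewrite -[xk N.+1](subrK c) kE rpredD // rpredM ?const_tower //.
exact: (@xk_tower 1).
Qed.

Lemma theta_top f : f \in E N -> theta f \in E N.
Proof.
by move=> fE; apply: (adj_min (E' := E N) _ top_in (theta_tower fE)).
Qed.

Definition commutes X := forall f, f \in E N -> X (phi f) = phi (X f).

(** The defect [X \o phi - phi \o X] is a derivation along [phi], so it suffices to kill it on
    generators. On jets this is an induction: [xk k.+1] is [T (xk k)], and the bracket of [X] and
    [T] is [Xm], which already commutes with [phi]. The bracket is asked on [E N.-1] only, as
    [T (xk N)] is not a free generator. *)
Lemma der_commutes T X Xm :
    der_on idfun (E N) X ->
    (forall f, f \in E N -> T f \in E N) -> (forall f, f \in E N -> X f \in E N) ->
    (forall f, f \in B -> X f = 0) -> X (phi t) = phi (X t) ->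
    (forall k, (k < N)%N -> T (xk k) = xk k.+1) ->
    (forall f, f \in E N.-1 -> X (T f) = T (X f) + Xm f) ->
    commutes T -> commutes Xm ->
  commutes X.
Proof.
move=> dX TE XE XB Xt Tx rel cT cXm f fE; apply/eqP; rewrite -subr_eq0; apply/eqP.
pose Z f := X (phi f) - phi (X f).
have dZ : der_on phi (E N) Z.
  split=> g h gE hE; rewrite /Z; have pg := phi_tower gE; have ph := phi_tower hE.
    by rewrite rmorphB !(derB dX) // rmorphB; ring.
  by rewrite rmorphM !(derM dX) //= rmorphD !rmorphM; ring.
apply: (tower_vanish dZ) fE; rewrite /Z.
- by move=> c; rewrite phiK !XB ?sub_adj ?const_in // rmorph0 subr0.
- by rewrite Xt subrr.
elim=> [_|k IH kN]; first by rewrite !XB ?phi_base ?x_base // rmorph0 subr0.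
have kN' := ltnW kN; have xE : xk k \in E N by rewrite xk_tower.
have xE1 : xk k \in E N.-1 by rewrite xk_tower // -ltnS prednK.
have Xk : X (phi (xk k)) = phi (X (xk k)) by apply/eqP; rewrite -subr_eq0 IH.
rewrite -Tx // -cT // rel ?phi_tower // Xk cT ?XE // cXm // -rmorphD -rel //.
by rewrite subrr.
Qed.

Lemma defect_der T X Xm :
    der_on idfun (E N) T -> der_on idfun (E N) X -> der_on idfun (E N) Xm ->
    (forall f, f \in E N -> T f \in E N) -> (forall f, f \in E N -> X f \in E N) ->
  der_on idfun (E N) (fun f => X (T f) - T (X f) - Xm f).
Proof.
move=> dT dX dXm TE XE; split=> f g fE gE.
  by rewrite (derB dX) // !(derB dT) ?XE // (derB dX) ?TE // (derB dXm) //; ring.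
rewrite (derM dX) // (derM dT) //= (derM dXm) //=.
by rewrite (derD dX) ?(derD dT) ?rpredM ?TE ?XE // !(derM dX) ?(derM dT) ?TE ?XE //=; ring.
Qed.

(* [xk k |-> 'C(k, m) * xk (k + 1 - m)] is the prolongation to jets of the
   reparametrisation field [s^m/m! d/ds], where [theta] is [d/ds]. *)
Record jet_der (T : L -> L) m X : Prop := JetDer {
  jet_der_on : der_on idfun (E N) X;
  jet_stable : forall f, f \in E N -> X f \in E N;
  jet_commutes : commutes X;
  jet_const : forall c, X (iota c) = 0;
  jet_base : (0 < m)%N -> forall f, f \in B -> X f = 0;
  jet_t : X t = 0;
  jet_xk : forall k, (k <= N)%N -> X (xk k) = 'C(k, m)%:R * xk (k.+1 - m);
  jet_top : (0 < m)%N -> exists c,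
    X (xk N.+1) = 'C(N.+1, m)%:R * xk (N.+2 - m) + iota c * u }.

(** This is [t d/dt] in the independent coordinates [t], [x] and the jets. *)
Lemma exists_t_der : exists X, [/\ der_on idfun (E N) X,
  forall f, f \in E N -> X f \in E N, forall f, f \in B -> X f = 0,
  X t = t & forall k, (k < N)%N -> X (xk k.+1) = 0].
Proof.
have [X [dX XB Xt Xx]] := tower_der t (fun=> 0) transc_lower.
exists X; split=> //; apply: (tower_stable dX) => //; first by rewrite Xt t_tower.
by move=> k kN; rewrite Xx ?rpred0.
Qed.

Lemma t_der_commutes X : der_on idfun (E N) X ->
    (forall f, f \in E N -> X f \in E N) -> (forall f, f \in B -> X f = 0) ->
    X t = t -> (forall k, (k < N)%N -> X (xk k.+1) = 0) ->
  commutes X.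
Proof.
move=> dX XE XB Xt Xx.
have d0 : der_on idfun (E N) (fun=> 0).
  by split=> f g _ _; rewrite ?subrr // mulr0 mul0r addr0.
have t0 : theta 0 = 0 by rewrite (der0 (theta_der B)).
have Xx' k : (k <= N)%N -> X (xk k) = 0.
  by case: k => [_|k]; [apply/XB/x_base|apply: Xx].
apply: (@der_commutes theta X (fun=> 0)) => //.
- exact: theta_top.
- by rewrite phit (derM dX) ?const_tower ?t_tower //= Xt phit (XB (iota q))
    ?sub_adj ?const_in // mul0r addr0.
- move=> f fE; apply/eqP; rewrite -subr_eq0 opprD addrA; apply/eqP; move: f fE.
  apply: tower_vanish.
  + apply: (@der_onS _ _ (E N)); first by apply/tower_mono/leq_pred.
    by apply: defect_der => //; apply: theta_top.
  + by move=> c; rewrite thetaK !XB ?sub_adj ?const_in // ?rpred0 // t0; ring.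
  + by rewrite theta_t Xt theta_t; ring.
  + move=> k kN; rewrite -[theta (xk k)]/(xk k.+1).
    have kN' : (k < N)%N by rewrite -(prednK N_gt0) ltnS.
    by rewrite Xx // Xx' ?(ltnW kN') // t0; ring.
- by move=> f _; rewrite rmorph0.
Qed.

(** [T] is [theta] minus [t d/dt]: it shifts the jets but treats [t] as a constant, and it is the
    field of index 0. Each further field is built from the previous one so that its bracket with [T]
    is that previous field, which is Pascal's rule on the coefficients. *)
Lemma exists_jets : exists T, forall m, exists X, jet_der T m X.
Proof.
have [Xt [dXt XtE XtB Xtt Xtx]] := exists_t_der.
have cXt := t_der_commutes dXt XtE XtB Xtt Xtx.
have Xtx' k : (k <= N)%N -> Xt (xk k) = 0.
  by case: k => [_|k]; [apply/XtB/x_base|apply: Xtx].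
pose T f := theta f - Xt f.
have dT : der_on idfun (E N) T.
  have dth := theta_der (E N); split=> f g fE gE; rewrite /T.
    by rewrite (derB dth) // (derB dXt) //; ring.
  by rewrite (derM dth) // (derM dXt) //=; ring.
have TE f : f \in E N -> T f \in E N.
  by move=> fE; rewrite rpredB ?theta_top ?XtE.
have cT : commutes T.
  by move=> f fE; rewrite /T -phi_theta cXt // rmorphB.
have TK c : T (iota c) = 0.
  by rewrite /T thetaK XtB ?subr0 // sub_adj ?const_in.
have Tt : T t = 0 by rewrite /T theta_t Xtt subrr.
have Tx k : (k <= N)%N -> T (xk k) = xk k.+1.
  by move=> kN; rewrite /T Xtx' ?subr0.
exists T; elim=> [|m [Xm jXm]].
  exists T; split=> // k kN; rewrite Tx // bin0 mul1r subn0 //.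
pose y k := 'C(k, m.+1)%:R * xk (k - m).
have [X [dX XB Xtv Xx]] := tower_der 0 y transc_lower.
have XE f : f \in E N -> X f \in E N.
  move: f; apply: (tower_stable dX) => //; first by rewrite Xtv rpred0.
  move=> k kN; rewrite Xx // rpredM ?rpred_nat // xk_tower //.
  by rewrite (leq_trans (leq_subr _ _)).
have T0 : T 0 = 0 by rewrite (der0 dT).
have Xx' k : (k <= N)%N -> X (xk k) = 'C(k, m.+1)%:R * xk (k - m).
  by case: k => [_|k kN]; [rewrite XB ?x_base // mul0r|rewrite Xx].
have XK c : X (iota c) = 0 by rewrite XB ?sub_adj ?const_in.
have X0 := der0 dX.
have dZ := defect_der dT dX (jet_der_on jXm) TE XE.
have TXx k : (k <= N)%N -> T (X (xk k)) + Xm (xk k) = 'C(k.+1, m.+1)%:R * xk (k.+1 - m).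
  move=> kN; rewrite Xx' // (jet_xk jXm) // (derM dT) ?rpred_nat //=; last first.
    by rewrite xk_tower // (leq_trans (leq_subr _ _)).
  rewrite (der_nat dT) mul0r addr0 Tx ?(leq_trans (leq_subr _ _)) //.
  rewrite binS natrD mulrDl; have [mk|km] := leqP m k.
    by rewrite subSn.
  by rewrite (bin_small km) (bin_small (leqW km)) mulr0n !mul0r.
have Zlow f : f \in E N.-1 -> X (T f) - T (X f) - Xm f = 0.
  move: f; apply: tower_vanish.
  + by apply: der_onS dZ; apply/tower_mono/leq_pred.
  + by move=> c; rewrite TK X0 XK T0 (jet_const jXm); ring.
  + by rewrite Tt X0 Xtv T0 (jet_t jXm); ring.
  + move=> k kN; have kN' : (k < N)%N by rewrite -(prednK N_gt0) ltnS.
    by rewrite Tx ?(ltnW kN') // -addrA -opprD TXx ?(ltnW kN') // Xx' // subrr.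
have cX : commutes X.
  apply: (@der_commutes T X Xm) => //.
  - by rewrite phit (derM dX) ?const_tower ?t_tower //= XK Xtv rmorph0; ring.
  - by move=> k kN; rewrite Tx ?(ltnW kN).
  - move=> f fE; apply/eqP; rewrite -subr_eq0 opprD addrA; apply/eqP.
    exact: Zlow.
  - exact: (jet_commutes jXm).
exists X; split=> // _.
have xE : xk N \in E N by rewrite xk_tower.
(* On the last jet the bracket relation may fail. As the defect kills [E N.-1], it only sees the top
   term of [phi (xk N)], so [phi] multiplies [dl] by [r']. *)
pose dl := X (T (xk N)) - T (X (xk N)) - Xm (xk N).
have [|c cE] := phi_r'_eigen (f := dl).
  have [l lE phixN] := phi_xk N.-1; rewrite prednK // in phixN.
  have rB : r' \in B by rewrite dx_base.
  have rE : r' \in E N by rewrite base_tower.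
  have lE' : l \in E N by apply: tower_mono lE; apply: leq_pred.
  have <- : X (T (phi (xk N))) - T (X (phi (xk N))) - Xm (phi (xk N)) = phi dl.
    rewrite cX // !cT ?XE // cX ?TE // (jet_commutes jXm) // /dl.
    by rewrite !rmorphB.
  have rxE : r' * xk N \in E N by rewrite rpredM.
  have /= ED := derD dZ rxE lE'; have /= EM := derM dZ rE xE.
  rewrite phixN ED EM -/dl.
  by rewrite !Zlow // ?base_tower // mul0r !addr0.
by exists c; rewrite -cE /dl Tx // -addrA -opprD TXx // [RHS]addrC subrK.
Qed.

Lemma bin_C2_eq n : (n = 'C(n, 2))%N -> (n <= 3)%N.
Proof.
rewrite bin2; case: n => // n /= nE; rewrite leqNgt; apply/negP => n3.
have := odd_double_half (n.+1 * n); rewrite -nE.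
by have := leq_mul (leqnn n.+1) (n3 : 3 <= n)%N; case: odd => /=; lia.
Qed.

Lemma commutator_der X Y : der_on idfun (E N) X -> der_on idfun (E N) Y ->
    (forall f, f \in E N -> X f \in E N) -> (forall f, f \in E N -> Y f \in E N) ->
  der_on idfun (E N) (fun f => X (Y f) - Y (X f)).
Proof.
move=> dX dY XE YE; split=> f g fE gE.
  by rewrite (derB dX) // !(derB dY) ?XE // (derB dX) ?YE //; ring.
rewrite (derM dX) // (derM dY) //= (derD dX) ?(derD dY) ?rpredM ?XE ?YE //.
by rewrite !(derM dX) ?(derM dY) ?XE ?YE //=; ring.
Qed.

(** For [N > 2] the bracket of the fields of indices 2 and [N] kills all generators, hence also
    [xk N.+1] by [top_in]. Computed directly, it sends [xk N.+1] to [N.+1 - 'C(N.+1, 2)] times [u],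
    both fields killing the unknown multiples of [u] of [jet_top]. The order in the name is
    [N.+1]. *)
Lemma order_le3 : (N <= 2)%N.
Proof.
have [T jets] := exists_jets; rewrite leqNgt; apply/negP => N3.
have [X2 j2] := jets 2%N; have [XN jN] := jets N.
have dZ := commutator_der (jet_der_on j2) (jet_der_on jN) (jet_stable j2) (jet_stable jN).
have X20 := der0 (jet_der_on j2); have XN0 := der0 (jet_der_on jN).
have Nle k : (k <= N)%N -> XN (xk k) = if k == N then u else 0.
  move=> kN; rewrite (jet_xk jN) //; case: eqP => [->|kN'].
    by rewrite binn mul1r subSnn.
  by rewrite bin_small ?mul0r // ltn_neqAle kN; case: eqP.
have XNu : XN u = 0 by rewrite -[u]/(xk 1) Nle ?(ltnW (ltnW N3)) //; case: eqP => // N1; move: N3; rewrite -N1.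
have X2u : X2 u = 0 by rewrite -[u]/(xk 1) (jet_xk j2) ?bin_small ?mul0r.
have Z0 : X2 (XN (xk N.+1)) - XN (X2 (xk N.+1)) = 0.
  apply: (tower_vanish dZ _ _ _ top_in) => [c||k kN].
  - by rewrite (jet_const j2) (jet_const jN) X20 XN0 subrr.
  - by rewrite (jet_t j2) (jet_t jN) X20 XN0 subrr.
  - have -> : X2 (XN (xk k)) = 0 by rewrite Nle //; case: eqP.
    rewrite (jet_xk j2) // (derM (jet_der_on jN)) ?rpred_nat ?xk_tower //=; last first.
      by lia.
    rewrite (der_nat (jet_der_on jN)) mul0r addr0; case: k kN => [|k] kN.
      by rewrite bin_small // mulr0n mul0r subrr.
    rewrite subSS Nle; last by lia.
    by case: eqP => [kE|_]; [lia|rewrite mulr0 subrr].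
have [c1 E1] := jet_top jN N_gt0; have [c2 E2] := jet_top j2 isT.
move: Z0; rewrite E1 E2.
have uE : u \in E N by apply: (@xk_tower 1).
rewrite (derD (jet_der_on j2)) ?rpredM ?rpred_nat ?const_tower ?xk_tower //; last by lia.
rewrite !(derM (jet_der_on j2)) ?rpred_nat ?const_tower ?xk_tower //; last by lia.
rewrite (derD (jet_der_on jN)) ?rpredM ?rpred_nat ?const_tower ?xk_tower //; last by lia.
rewrite !(derM (jet_der_on jN)) ?rpred_nat ?const_tower ?xk_tower //; last by lia.
rewrite /= !(der_nat (jet_der_on j2)) !(der_nat (jet_der_on jN)).
rewrite (jet_const j2) (jet_const jN) XNu X2u !mul0r !mulr0 !addr0.
have -> : (N.+2 - N = 2)%N by lia.
have -> : (N.+2 - 2 = N)%N by lia.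
rewrite (jet_xk j2); last by lia.
rewrite Nle // eqxx binn mul1r -[xk (3 - 2)]/u binSn -mulrBl => /eqP.
rewrite mulf_eq0 (negPf u_neq0) orbF subr_eq0 => /eqP.
move=> /eqP; rewrite -subr_eq0.
case: (leqP N.+1 'C(N.+1, 2)) => [le|lt].
  rewrite -opprB -natrB // oppr_eq0 natr0 => /eqP C0.
  by have := @bin_C2_eq N.+1; lia.
rewrite -natrB ?(ltnW lt) // natr0 => /eqP C0.
by have := @bin_C2_eq N.+1; lia.
Qed.

Lemma phi_x2 : phi (xk 2) = r' * xk 2 + dx r' * u ^+ 2.
Proof.
have tE := theta_der (E 2); have rE : r' \in E 2 by rewrite base_tower // dx_base.
rewrite -[xk 2]/(theta u) phi_theta phi_u (derM tE) ?(@xk_tower 1) //=.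
by rewrite [theta r']theta_dx; ring.
Qed.

Lemma phi_x3 :
  phi (xk 3) = r' * xk 3 + 3%:R * dx r' * u * xk 2 + dx (dx r') * u ^+ 3.
Proof.
have tE := theta_der (E 2); have rB : r' \in B by rewrite dx_base.
have rE : r' \in E 2 by rewrite base_tower.
have r2E : dx r' \in E 2 by rewrite base_tower // dx_base.
have uE : u \in E 2 by apply: (@xk_tower 1).
have x2E : xk 2 \in E 2 by apply: xk_tower.
rewrite -[xk 3]/(theta (xk 2)) phi_theta phi_x2 expr2.
have := theta_dx (dx r'); have := theta_dx r'; move: rE r2E {rB}.
move: (dx (dx r')) => r3; move: (dx r') => r2; move: (r') => r1 rE r2E T1 T2.
rewrite (derD tE) ?rpredM //.
rewrite !(derM tE) ?rpredM //=.
by rewrite -[theta u]/(xk 2) T1 T2; ring.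
Qed.

Lemma u_transc : transc (E 0) u.
Proof. exact: transc_lower N_gt0. Qed.

(** Applying [t d/dt] removes [g] and makes [X h * u ^+ e] invariant under [phi], hence constant.
    Were [X h] nonzero, [u ^+ e] would lie in [E 0], against the transcendence of [u]. *)
Lemma invariant_base e g h : (0 < e)%N -> g \in B -> h \in E 0 ->
  r' ^+ e * phi h = h + g -> h \in B.
Proof.
move=> e0 gB hE hphi.
have [X [dX XE XB Xt Xx]] := exists_t_der.
have cX := t_der_commutes dX XE XB Xt Xx.
have dX0 : der_on idfun (E 0) X by apply: der_onS dX; apply: tower_mono.
have X0E f : f \in E 0 -> X f \in E 0.
  by move: f; apply: (tower_stable dX0) => //; rewrite Xt t_tower.
apply: (der_const char0L transc_t dX0 XB) (hE) _; first by rewrite Xt.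
have rB : r' ^+ e \in B by rewrite rpredX // dx_base.
have hN : h \in E N by apply: tower_mono hE.
have : r' ^+ e * phi (X h) = X h.
  have rN : r' ^+ e \in E N by apply: base_tower.
  have /= XM := derM dX rN (phi_tower hN).
  have /= XD := derD dX hN (base_tower N gB).
  have := congr1 X hphi; rewrite XM XD (XB _ rB) (XB _ gB) cX // mul0r.
  by rewrite !addr0.
move=> inv; have [|c cE] := phi_fixed (f := X h * u ^+ e).
  by rewrite rmorphM rmorphXn phi_u exprMn mulrA [phi _ * _]mulrC inv.
apply/eqP; apply: contrapT => /negP Xh0.
have ue : u ^+ e = iota c / X h by rewrite -cE mulrC mulKf.
have ueE : u ^+ e \in E 0 by rewrite ue rpred_div ?const_tower ?X0E.
have pE : 'X^e - (u ^+ e)%:P \is a polyOver (E 0).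
  by rewrite rpredB ?polyOverC // rpredX // polyOverX.
have := u_transc pE; rewrite hornerD hornerN hornerXn hornerC subrr.
move=> /(_ erefl) /(congr1 (fun p : {poly L} => size p)).
by rewrite size_polyDl ?size_polyXn ?size_poly0 // size_polyN
  (leq_ltn_trans (size_polyC_leq1 _)).
Qed.

(** The equation is the transformation law of an affine connection on the line of [x]. *)
Lemma order2_affine : N = 1%N ->
  exists2 h, h \in B & r' * phi h = h + dx r' / r'.
Proof.
move=> N1; have [T jets] := exists_jets; have [X jX] := jets 1%N.
have dX := jet_der_on jX; have [c] := jet_top jX isT.
rewrite N1 -['C(2, 1)%:R]/(2%:R) -[xk (3 - 1)]/(xk 2) => Xx2.
have Xu : X u = u.
  by have := jet_xk jX (k := 1); rewrite N1 => /(_ isT); rewrite bin1 mul1r.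
have x2E : xk 2 \in E N by have := top_in; rewrite N1.
have uE : u \in E N by rewrite N1; apply: (@xk_tower 1).
have cE : iota c \in E N by apply: const_tower.
(* Under the scaling field [X] numerator and denominator both have weight one, the constant of
   [jet_top] being absorbed in the numerator. *)
pose h := (xk 2 / u + iota c) / u.
have Xh : X h = 0.
  rewrite /h (der_div dX) ?rpredD ?rpred_div //= (derD dX) ?rpred_div //.
  rewrite (der_div dX) //= (jet_const jX) Xx2 Xu.
  by field; apply: u_neq0.
have hE : h \in E 0.
  have hN : h \in E N by rewrite rpred_div ?rpredD ?rpred_div.
  rewrite N1 in hN.
  move: dX; rewrite N1 => dX.
  apply: (der_const char0L u_transc dX) Xh => //.
  - apply: tower_vanish (jet_t jX) _.
    + by apply: der_onS dX; apply: towerS.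
    + exact: (jet_const jX).
    + by case=> // _; rewrite (jet_xk jX) // bin_small // mul0r.
  - by rewrite Xu.
have hphi : r' * phi h = h + dx r' / r'.
  rewrite /h fmorph_div rmorphD fmorph_div phi_x2 phi_u phiK.
  by field; rewrite u_neq0 r'_neq0.
exists h => //; apply: (@invariant_base 1 (dx r' / r')) => //.
by rewrite rpred_div ?dx_base.
Qed.

(** A projective connection on the line of [x]. It is killed by [Y], which eliminates [xk 2], and by
    the scaling field [X], which eliminates [u]; [invariant_base] then eliminates [t]. *)
Lemma order3_projective : N = 2%N ->
  exists2 h, h \in B & r' ^+ 2 * phi h = h + schwarz dx (phi x).
Proof.
move=> N2; have [T jets] := exists_jets.
have [X jX] := jets 1%N; have [Y jY] := jets 2%N.
have dX := jet_der_on jX; have dY := jet_der_on jY.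
have [c0] := jet_top jX isT; have [c1] := jet_top jY isT.
rewrite N2 -['C(3, 1)%:R]/(3%:R) -['C(3, 2)%:R]/(3%:R).
rewrite -[xk (4 - 1)]/(xk 3) -[xk (4 - 2)]/(xk 2) => Yx3 Xx3.
have Xu : X u = u.
  by have := jet_xk jX (k := 1); rewrite N2 => /(_ isT); rewrite bin1 mul1r.
have Xx2 : X (xk 2) = 2%:R * xk 2.
  by have := jet_xk jX (k := 2); rewrite N2 => /(_ isT); rewrite bin1.
have Yu : Y u = 0.
  by have := jet_xk jY (k := 1); rewrite N2 => /(_ isT); rewrite bin_small // mul0r.
have Yx2 : Y (xk 2) = u.
  by have := jet_xk jY (k := 2); rewrite N2 => /(_ isT); rewrite binn mul1r.
have x3E : xk 3 \in E N by have := top_in; rewrite N2.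
have x2E : xk 2 \in E N by rewrite N2; apply: (@xk_tower 2).
have uE : u \in E N by rewrite N2; apply: (@xk_tower 1).
have kE c : iota c \in E N by apply: const_tower.
have nE n : n%:R \in E N by apply: rpred_nat.
have X0 := der0 dX; have Y0 := der0 dY.
have XK := jet_const jX; have YK := jet_const jY.
have Xn := der_nat dX; have Yn := der_nat dY.
(* The bracket of [X] and [Y] is [- Y] on the generators, hence on [xk 3], where all terms but a
   multiple of [iota c1 * u] cancel. *)
have c1u : iota c1 * u = 0.
  pose Z f := X (Y f) - Y (X f) + Y f.
  have dZ : der_on idfun (E N) Z.
    have dC := commutator_der dX dY (jet_stable jX) (jet_stable jY).
    split=> f g fE gE; rewrite /Z.
      by have /= -> := derB dC fE gE; rewrite (derB dY) //; ring.
    by have /= -> := derM dC fE gE; rewrite (derM dY) //=; ring.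
  have : Z (xk 3) = 0.
    apply: (tower_vanish dZ _ _ _ x3E) => [c||k]; rewrite /Z.
    - by rewrite XK YK X0 Y0; ring.
    - by rewrite (jet_t jX) (jet_t jY) X0 Y0; ring.
    - rewrite N2; case: k => [|[|[|k]]] // _.
      + have -> : X (xk 0) = 0 by rewrite (jet_base jX) ?x_base.
        have -> : Y (xk 0) = 0 by rewrite (jet_base jY) ?x_base.
        by rewrite X0 Y0; ring.
      + by rewrite -[xk 1]/u Xu Yu X0; ring.
      + by rewrite Yx2 Xu Xx2 (derM dY) //= Yx2 Yn; ring.
  rewrite /Z Yx3 Xx3 (derD dX) ?rpredM // !(derM dX) //= (derD dY) ?rpredM //.
  rewrite !(derM dY) //= Xn Yn XK YK Xx2 Xu Yu Yx3 => /eqP.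
  by rewrite -oppr_eq0 => /eqP <-; ring.
rewrite c1u addr0 in Yx3.
(* The Schwarzian of [x] with respect to [theta]. [Y] kills it, and it has weight two under [X] once
   shifted by [iota c0 / 2%:R]. *)
pose w := xk 3 / u - 3%:R / 2%:R * (xk 2 / u) ^+ 2.
have two0 : 2%:R != 0 :> L by rewrite natr0.
have qE : xk 2 / u \in E N by rewrite rpred_div.
have hfE : 3%:R / 2%:R \in E N by rewrite rpred_div.
have q3E : xk 3 / u \in E N by rewrite rpred_div.
have q2E : 3%:R / 2%:R * (xk 2 / u) ^+ 2 \in E N by rewrite rpredM ?rpredX.
have wE : w \in E N by rewrite rpredB.
have Xq : X (xk 2 / u) = xk 2 / u.
  by rewrite (der_div dX) //= Xx2 Xu; field.
have Yq : Y (xk 2 / u) = 1.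
  by rewrite (der_div dY) //= Yx2 Yu; field.
have q22E : (xk 2 / u) ^+ 2 \in E N by rewrite rpredX.
have Xhf : X (3%:R / 2%:R) = 0 by rewrite (der_div dX) //= !Xn mul0r mulr0 subrr mul0r.
have Yhf : Y (3%:R / 2%:R) = 0 by rewrite (der_div dY) //= !Yn mul0r mulr0 subrr mul0r.
have Xq2 : X ((xk 2 / u) ^+ 2) = 2%:R * (xk 2 / u) ^+ 2.
  by rewrite expr2 (derM dX qE qE) /= Xq; ring.
have Yq2 : Y ((xk 2 / u) ^+ 2) = 2%:R * (xk 2 / u).
  by rewrite expr2 (derM dY qE qE) /= Yq; ring.
have Xw : X w = 2%:R * w + iota c0.
  rewrite /w (derB dX q3E q2E) (derM dX hfE q22E) Xhf Xq2 (der_div dX) //= Xx3 Xu.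
  by field; rewrite u_neq0 two0.
have Yw : Y w = 0.
  rewrite /w (derB dY q3E q2E) (derM dY hfE q22E) Yhf Yq2 (der_div dY) //= Yx3 Yu.
  by field; rewrite u_neq0 two0.
have u2E : u ^+ 2 \in E N by rewrite rpredX.
have u20 : u ^+ 2 != 0 by rewrite expf_neq0.
have Xu2 : X (u ^+ 2) = 2%:R * u ^+ 2 by rewrite expr2 (derM dX) //= Xu; ring.
have Yu2 : Y (u ^+ 2) = 0 by rewrite expr2 (derM dY) //= Yu; ring.
have cE : iota c0 / 2%:R \in E N by rewrite rpred_div.
have ncE : w + iota c0 / 2%:R \in E N by rewrite rpredD.
pose h := (w + iota c0 / 2%:R) / u ^+ 2.
have Xh : X h = 0.
  rewrite /h (der_div dX ncE u2E u20) (derD dX wE cE).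
  rewrite (der_div dX (kE c0) (nE 2%N) two0) /=.
  by rewrite Xn XK Xw Xu2; field; rewrite u_neq0 !natr0.
have Yh : Y h = 0.
  rewrite /h (der_div dY ncE u2E u20) (derD dY wE cE).
  rewrite (der_div dY (kE c0) (nE 2%N) two0) /=.
  by rewrite Yn YK Yw Yu2; field; rewrite u_neq0 !natr0.
have h2 : h \in E N by exact: rpred_div.
rewrite N2 in h2.
have dX2 : der_on idfun (E 2) X by rewrite -N2.
have dY2 : der_on idfun (E 2) Y by rewrite -N2.
have h1 : h \in E 1.
  have tr : transc (E 1) (xk 2) by apply: transc_lower; rewrite N2.
  apply: (der_const char0L tr dY2) Yh => //; last by rewrite Yx2.
  apply: tower_vanish YK (jet_t jY) _.
  - by apply: der_onS dY2; apply: towerS.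
  - by case=> [|[|k]] // _; rewrite (jet_base jY) ?x_base.
have h0 : h \in E 0.
  have dX1 : der_on idfun (E 1) X by apply: der_onS dX2; apply: towerS.
  apply: (der_const char0L u_transc dX1) Xh => //; last by rewrite Xu.
  apply: tower_vanish XK (jet_t jX) _.
  - by apply: der_onS dX1; apply: towerS.
  - by case=> [|k] // _; rewrite (jet_base jX) ?x_base.
have hphi : r' ^+ 2 * phi h = h + schwarz dx (phi x).
  have pw : phi w = phi (xk 3) / phi u - 3%:R / 2%:R * (phi (xk 2) / phi u) ^+ 2.
    by rewrite rmorphB [X in _ - X]rmorphM rmorphXn !fmorph_div !rmorph_nat.
  have pc : phi (iota c0 / 2%:R) = iota c0 / 2%:R.
    by rewrite fmorph_div phiK rmorph_nat.
  rewrite /h fmorph_div rmorphD rmorphXn pw pc phi_x2 phi_x3 phi_u /w /schwarz.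
  by field; rewrite u_neq0 r'_neq0 !natr0.
exists h => //; apply: (@invariant_base 2 (schwarz dx (phi x))) => //.
have rB : r' \in B by rewrite dx_base.
have r2B : dx r' \in B by rewrite dx_base.
have qB : dx r' / r' \in B by apply: rpred_div.
have q3B : dx (dx r') / r' \in B by apply: rpred_div => //; apply: dx_base.
by apply: rpredB => //; apply: rpredM; [apply: rpred_div; apply: rpred_nat|apply: rpredX].
Qed.

End HigherOrder.

(** With [g = dx r' / r'] the Schwarzian is [dx g - g ^+ 2 / 2%:R]; the sign of the square in the
    new connection is chosen so that the cross terms in [h] and [g] cancel. *)
Lemma affine_projective h : h \in B -> r' * phi h = h + dx r' / r' ->
  r' ^+ 2 * phi (dx h + h ^+ 2 / 2%:R)
    = dx h + h ^+ 2 / 2%:R + schwarz dx (phi x).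
Proof.
move=> hB hphi.
have hE : phi h = (h + dx r' / r') / r' by rewrite -hphi mulrAC divff ?r'_neq0 ?mul1r.
have dB := dx_der B; have rB : r' \in B by rewrite dx_base.
have r2B : dx r' \in B by rewrite dx_base.
have r0 := r'_neq0.
have gB : dx r' / r' \in B by apply: rpred_div.
have hgB : h + dx r' / r' \in B by apply: rpredD.
have ph2 : phi (h ^+ 2 / 2%:R) = phi h ^+ 2 / 2%:R.
  by rewrite fmorph_div rmorphXn rmorph_nat.
rewrite rmorphD ph2 phi_dx hE (der_div dB hgB rB r0) (derD dB hB gB).
rewrite (der_div dB r2B rB r0) /schwarz /=.
by field; rewrite r0 !natr0.
Qed.

(* Order one gives a semi-invariant density; order two gives an invariant affine
   structure and hence, like order three, an invariant projective structure. *)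
Theorem elimination : (exists N, ~ transc (E N) (xk N.+1)) ->
  (exists n (j : int) A, [/\ (0 < n)%N, A \in B, A != 0
     & phi A = iota (q ^ j) * r' ^+ n * A]) \/
  (exists2 h, h \in B & r' ^+ 2 * phi h = h + schwarz dx (phi x)).
Proof.
move=> exN.
have exN' : exists N, `[< ~ transc (E N) (xk N.+1) >].
  by have [N ntr] := exN; exists N; apply/asboolP.
case: (ex_minnP exN') => N /asboolP ntr Nmin.
have low k : (k < N)%N -> transc (E k) (xk k.+1).
  move=> kN; apply: contrapT => nk; have := Nmin k; rewrite leqNgt kN => /(_ _)/negP.
  by case=> //; apply/asboolP.
case: N ntr {Nmin} low => [|N] ntr low; first by left; apply: semi_invariant_base.
right; have := order_le3 (ltn0Sn N) low ntr; case: N ntr low => [|[|N]] // ntr low _.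
  have [h hB hphi] := order2_affine (ltn0Sn 0) low ntr erefl.
  exists (dx h + h ^+ 2 / 2%:R); last exact: affine_projective.
  apply: rpredD; first exact: dx_base.
  by apply: rpred_div; [apply: rpredX|apply: rpred_nat].
exact: (order3_projective (ltn0Sn 1) low ntr).
Qed.

End Elimination.

(** * Orbifold weights of an invariant projective structure *)

Lemma mul_succ_le e k : ((e.+1 * k.+1).+2 <= k.+3)%N -> e = 0%N.
Proof. by case: e => // e; rewrite mulSn => le; exfalso; nia. Qed.

(** Orders at a preimage of index [e] in the identity of [density_exists]: the Wronskian to the
    power [M] and the local factor of [A] on the left, the pulled back factor on the right. *)
Lemma ramification_count M n e : (0 < e)%N -> (e * n <= M)%N ->
  (M * e.-1 + (M - e * n) = (M - n) * e)%N.
Proof. by case: e => // e _ le; rewrite /= mulnBl mulnS; nia. Qed.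

(** Degrees in the same identity, with [n.+1] the degree of [Q]. The conclusion says that the
    orbifold has Euler characteristic zero. *)
Lemma degree_count M S k n :
  (2 * n.+1 * M + 1 * S = n.+2 * S + n.+1 * k)%N -> (2 * M = S + k)%N.
Proof. by nia. Qed.

Section Dynamics.
Variables (K : numClosedFieldType) (L : fieldType) (iota : {rmorphism K -> L}).
Variables (phi : {rmorphism L -> L}) (del : L -> L) (x : L) (P Q : {poly K}).
Hypothesis phiK : forall c, phi (iota c) = iota c.
Hypothesis del_der : der_on idfun (total_field L) del.
Hypothesis delK : forall c, del (iota c) = 0.
Hypothesis del_x : del x = 1.
Hypothesis x_notin : x \notin consts iota.
Hypothesis copPQ : coprimep P Q.
Hypothesis sizeP : size P = (size Q).+1.
Hypothesis sizeQ : (1 < size Q)%N.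
Hypothesis phix : phi x = hev iota x P / hev iota x Q.

Notation tx := (notin_consts_transc x_notin).
Notation at_x := (at_ iota x).

Lemma natrL_eq0 n : (n%:R == 0 :> L) = (n == 0%N).
Proof. by rewrite -(rmorph_nat iota) fmorph_eq0 pnatr_eq0. Qed.

Lemma Q_neq0 : Q != 0. Proof. by rewrite -size_poly_gt0 ltnW. Qed.

Lemma P_neq0 : P != 0. Proof. by rewrite -size_poly_gt0 sizeP. Qed.

(** Its roots are the preimages of [a] under [S = P / Q], with ramification indices as
    multiplicities. Its degree does not depend on [a], because infinity is mapped to itself. *)
Definition fiber a := P - a *: Q.

Lemma size_fiber a : size (fiber a) = size P.
Proof.
by rewrite size_polyDl // size_polyN sizeP ltnS size_scale_leq.
Qed.

Lemma fiber_neq0 a : fiber a != 0.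
Proof. by rewrite -size_poly_gt0 size_fiber sizeP. Qed.

Lemma fiber_horner a p : (fiber a).[p] = P.[p] - a * Q.[p].
Proof. by rewrite hornerD hornerN hornerZ. Qed.

Lemma fiber_Q a p : root (fiber a) p -> Q.[p] != 0.
Proof.
rewrite rootE fiber_horner => /eqP fp; apply/eqP => Qp.
have Pp : root P p by move: fp; rewrite Qp mulr0 subr0 => /eqP.
by have := coprimep_root copPQ Pp; rewrite Qp eqxx.
Qed.

Lemma pole_P p : root Q p -> P.[p] != 0.
Proof. by apply: coprimep_root; rewrite coprimep_sym. Qed.

Lemma hevQ : hev iota x Q != 0. Proof. by rewrite (hev_eq0 tx) Q_neq0. Qed.

Lemma phi_uniformizer a : phi (x - iota a) = hev iota x (fiber a) / hev iota x Q.
Proof.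
rewrite rmorphB phiK phix hevD hevN hevZ.
by field; apply: hevQ.
Qed.

Lemma fiber_value a p : root (fiber a) p -> at_x p (phi x) a.
Proof.
move=> fp; have Qp := fiber_Q fp; exists P, Q; split=> //.
move: fp; rewrite rootE fiber_horner subr_eq0 => /eqP->.
by rewrite mulfK.
Qed.

Lemma fiber_local a p : root (fiber a) p -> exists f c,
  [/\ at_x p f c, c != 0 &
   phi (x - iota a) = f * (x - iota p) ^+ mup p (fiber a)].
Proof.
move=> fp; have Qp := fiber_Q fp.
have [f [c [fc c0 fE]]] := hev_factor iota x p (fiber_neq0 a).
exists (f / hev iota x Q), (c / Q.[p]); split.
- by apply: at_mul => //; apply: at_inv => //; apply: at_hev.
- by rewrite mulf_neq0 ?invr_eq0.
- by rewrite phi_uniformizer fE mulrAC.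
Qed.

Lemma pole_local p : root Q p -> exists f c,
  [/\ at_x p f c, c != 0 & phi x^-1 = f * (x - iota p) ^+ mup p Q].
Proof.
move=> Qp; have Pp := pole_P Qp.
have [f [c [fc c0 fE]]] := hev_factor iota x p Q_neq0.
exists (f / hev iota x P), (c / P.[p]); split.
- by apply: at_mul => //; apply: at_inv => //; apply: at_hev.
- by rewrite mulf_neq0 ?invr_eq0.
- by rewrite fmorphV phix invf_div fE mulrAC.
Qed.

Lemma phi_hev z N : phi (hev iota z N) = hev iota (phi z) N.
Proof.
rewrite /hev -horner_map -map_poly_comp; congr _.[_].
by apply: eq_map_poly => c /=; rewrite phiK.
Qed.

Lemma at_hev_comp p y a N : at_x p y a -> at_x p (hev iota y N) N.[a].
Proof.
move=> ya; elim/poly_ind: N => [|N c IH].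
  by rewrite horner0 /hev map_poly0 horner0 -(rmorph0 iota); apply: at_const.
rewrite hornerMXaddC hevD hevM hevX hevC; apply: (at_add tx).
  by apply: at_mul.
exact: at_const.
Qed.

(** [phi] is composition with [S]. The coordinate [z] at the image is [x], or [x^-1] when [p] is a
    pole of [S]. *)
Lemma at_comp p z a f c : at_x p (phi z) a -> at_ iota z a f c -> at_x p (phi f) c.
Proof.
move=> za [N [D [D0 -> ->]]]; rewrite fmorph_div !phi_hev.
by apply: at_mul; [|apply: at_inv => //]; apply: at_hev_comp.
Qed.

Lemma del_hev N : del (hev iota x N) = hev iota x N^`().
Proof.
elim/poly_ind: N => [|N c IH].
  by rewrite deriv0 /hev map_poly0 horner0 (der0 del_der).
rewrite derivMXaddC !(hevD, hevM, hevX, hevC) (tderD del_der) (tderM del_der).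
by rewrite delK IH del_x; ring.
Qed.

Lemma at_del p f c : at_x p f c -> exists c', at_x p (del f) c'.
Proof.
move=> [N [D [D0 -> _]]].
have hD : hev iota x D != 0 by rewrite (hev_eq0 tx) (poly_neq0_at D0).
exists ((N^`() * D - N * D^`()).[p] / (D ^+ 2).[p]).
exists (N^`() * D - N * D^`()), (D ^+ 2).
rewrite horner_exp expf_neq0 //; split=> //.
by rewrite (tder_div del_der) // !del_hev hevXn hevD hevN !hevM.
Qed.

(* All preimages of the [le]-maximal elements of [S] would be [le]-maximal and
   unramified, so that there would be [deg] times as many of them. *)
Lemma backward_growth (S : seq K) (le : rel K) :
    uniq S -> (forall a b, le a b || le b a) -> transitive le ->
    (forall a p, a \in S -> root (fiber a) p ->
       [/\ p \in S, le a p & le p a -> mup p (fiber a) = 1%N]) ->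
  S = [::].
Proof.
move=> uS tot tr back; case: (S =P [::]) => // /eqP S0.
pose M := [seq a <- S | all (le^~ a) S].
have [m mM] : exists m, m \in M.
  suff [m mS mmax] : exists2 m, m \in S & forall b, b \in S -> le b m.
    by exists m; rewrite mem_filter mS andbT; apply/allP.
  have refl a : le a a by have := tot a a; rewrite orbb.
  elim: {uS back M} S S0 => // a [|b S] IH _.
    by exists a; rewrite ?inE // => c; rewrite inE => /eqP->.
  have [//|m mS mmax] := IH; case/orP: (tot a m) => [am|ma].
    exists m; rewrite ?(inE, mS, orbT) // => c; rewrite in_cons => /predU1P[->//|].
    exact: mmax.
  exists a; rewrite ?mem_head // => c; rewrite in_cons => /predU1P[->//|/mmax cm].
  exact: tr ma.
have backM a p : a \in M -> root (fiber a) p -> p \in M /\ mup p (fiber a) = 1%N.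
  rewrite !mem_filter => /andP[/allP amax aS] fp; have [pS ap pa] := back a p aS fp.
  rewrite pS (pa (amax p pS)); split=> //; rewrite andbT.
  by apply/allP => b /amax ba; apply: tr ap.
(* Over a maximal element all roots are simple, so the fibre has as many points as its degree, which
   is [size Q]. *)
have rts a : a \in M -> exists s, [/\ uniq s, size s = size Q
    & forall p, p \in s -> root (fiber a) p].
  move=> aM; have [s sE] := closed_field_poly_normal (fiber a).
  have lc0 : lead_coef (fiber a) != 0 by rewrite lead_coef_eq0 fiber_neq0.
  have rs p : root (fiber a) p = (p \in s) by rewrite sE rootZ // root_prod_XsubC.
  exists s; split=> [||p]; last by rewrite rs.
    apply/count_mem_uniq => p; rewrite -mu_prod_XsubC; case: (boolP (p \in s)) => ps.
  - have fp : root (fiber a) p by rewrite rs.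
    have [_] := backM _ _ aM fp.
    by rewrite {1}sE -mul_polyC mupMr // rootC.
  - by rewrite mupNroot // root_prod_XsubC.
  have := size_fiber a; rewrite sE size_scale // size_prod_XsubC sizeP.
  by case.
have bigs (M' : seq K) : uniq M' -> {subset M' <= M} -> exists s, [/\ uniq s,
    size s = (size Q * size M')%N &
    forall p, p \in s -> exists2 a, a \in M' & root (fiber a) p].
  elim: M' => [|a M' IH] /= => [_ _|/andP[aM' uM'] sM].
    by exists [::]; rewrite muln0.
  have [|s [us ss rs]] := IH uM'.
    by move=> b bM'; apply: sM; rewrite inE bM' orbT.
  have [|s' [us' ss' rs']] := rts a; first by apply: sM; rewrite mem_head.
  exists (s' ++ s); split; last 1 first.
  - move=> p; rewrite mem_cat => /orP[/rs' fp|/rs[b bM' fp]].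
      by exists a; rewrite ?mem_head.
    by exists b; rewrite // inE bM' orbT.
  - rewrite cat_uniq us us' andbT /=; apply/hasPn => p /rs[b bM' fb].
    apply/negP => /rs' fa; have Qp := fiber_Q fa; move: aM'.
    suff -> : a = b by rewrite bM'.
    move: fa fb; rewrite !rootE !fiber_horner !subr_eq0 => /eqP-> /eqP.
    by move/(mulIf Qp).
  - by rewrite size_cat ss ss' mulnS.
(* The nonempty [M] would contain [size Q * size M] distinct elements; degree at least two, that is
   [size Q > 1], excludes this. *)
have [s [us ss rs]] := bigs M (filter_uniq _ uS) (fun=> id).
have sM : {subset s <= M} by move=> p /rs[a aM fp]; have [] := backM _ _ aM fp.
have := uniq_leq_size us sM; rewrite ss; have : (0 < size M)%N by case: (M) mM.
by move=> M0; rewrite leqNgt -[X in (X < _)%N]mul1n ltn_pmul2r ?sizeQ.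
Qed.

(** A zero of order [n] of the eigenvector pulls back to a zero of order [e * n] at a preimage of
    index [e]: apply [backward_growth] to the roots of [N], ordered by multiplicity. *)
Lemma numerator_const N D f k : N != 0 -> D != 0 -> coprimep N D ->
  f = hev iota x N / hev iota x D -> k != 0 -> phi f = iota k * f -> size N = 1%N.
Proof.
move=> N0 D0 cND fE k0 phif.
have [s sE] := closed_field_poly_normal N.
have lc0 : lead_coef N != 0 by rewrite lead_coef_eq0.
have rs p : root N p = (p \in s) by rewrite sE rootZ // root_prod_XsubC.
suff s0 : undup s = [::].
  have {}s0 : s = [::].
    case: s {sE rs} s0 => // a s s0.
    by have := mem_undup (a :: s) a; rewrite s0 mem_head.
  by rewrite sE s0 big_nil size_scale // size_poly1.
apply: (@backward_growth _ (fun a b => (mup a N <= mup b N)%N)).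
- exact: undup_uniq.
- by move=> a b; apply: leq_total.
- by move=> b a c; apply: leq_trans.
move=> a p; rewrite !mem_undup -!rs => Na fp.
have [g [c [gc c0 gE]]] := hev_factor iota x a N0.
have [h [d [hd d0 hE]]] := fiber_local fp.
set n := mup a N in gE *; set e := mup p (fiber a) in hE *.
have n0 : (0 < n)%N by rewrite mup_gt0.
have e0 : (0 < e)%N by rewrite mup_gt0 ?fiber_neq0.
have Da : D.[a] != 0 by apply: coprimep_root Na.
have rho : at_x p (phi (g / hev iota x D)) (c / D.[a]).
  apply: (@at_comp p x a); first exact: fiber_value.
  by apply: at_mul => //; apply: at_inv => //; apply: at_hev.
have mp : mup p N = (e * n)%N.
  apply: (@mup_num _ _ _ _ tx N D p (iota k^-1 * (phi (g / hev iota x D) * h ^+ n))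
     (k^-1 * (c / D.[a] * d ^+ n))) => //.
  - apply: at_mul; first exact: at_const.
    by apply: at_mul => //; apply: at_exp.
  - by rewrite !mulf_neq0 ?invr_eq0 ?expf_neq0.
  - by rewrite muln_gt0 e0.
  - have -> : hev iota x N / hev iota x D = iota k^-1 * phi f.
      by rewrite phif -fE mulrA -rmorphM mulVf // rmorph1 mul1r.
    have -> : phi f = phi (g / hev iota x D) * phi (x - iota a) ^+ n.
      by rewrite -rmorphXn -rmorphM fE gE mulrAC.
    by rewrite hE exprMn -exprM -!mulrA.
have Np : root N p by rewrite -(mup_gt0 p N0) mp muln_gt0 e0 n0.
split; [exact: Np|by rewrite mp leq_pmull|].
by rewrite mp -[X in (_ <= X)%N]mul1n leq_pmul2r // => e1; apply/eqP; rewrite eqn_leq e1.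
Qed.

Lemma eigen_const f k : f \in adj (consts iota) x -> k != 0 ->
  phi f = iota k * f -> f \in consts iota.
Proof.
move=> /(adj_constsP tx)[N [D [D0 cND fE]]] k0 phif.
have [N0|N0] := eqVneq N 0.
  by rewrite fE N0 /hev map_poly0 horner0 mul0r rpred0.
have sN := numerator_const N0 D0 cND fE k0 phif.
have sD : size D = 1%N.
  apply: (@numerator_const D N f^-1 k^-1) => //.
  - by rewrite coprimep_sym.
  - by rewrite fE invf_div.
  - by rewrite invr_eq0.
  - by rewrite fmorphV phif invfM fmorphV.
move/eqP/size_poly1P: sN => [a _ NE]; move/eqP/size_poly1P: sD => [b _ DE].
by rewrite fE NE DE !hevC rpred_div ?const_in.
Qed.

Lemma uniformizer_neq0_x p : x - iota p != 0.
Proof. exact: (uniformizer_neq0 tx). Qed.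

Lemma del_uniformizer p : del (x - iota p) = 1.
Proof. by rewrite (tderB del_der) delK del_x subr0. Qed.

Lemma at_nat p n : at_x p n%:R n%:R.
Proof. by rewrite -[X in at_ _ _ _ X _](rmorph_nat iota); apply: at_const. Qed.

(** The ramification index is [e.+1]. The logarithmic derivative of [del y] is [e / (x - p)] plus a
    regular term, and the Schwarzian is its derivative minus half its square; hence the coefficient
    [- e - e ^ 2 / 2] of the double pole. *)
Lemma schwarz_local p y f c e : at_x p f c -> c != 0 ->
    (exists a, y - iota a = f * (x - iota p) ^+ e.+1) ->
  exists y1 g d, [/\ at_x p y1 (e.+1%:R * c), at_x p g d,
    del y = y1 * (x - iota p) ^+ e &
    (x - iota p) ^+ 2 * schwarz del y
      = (1 - e.+1%:R ^+ 2) / 2%:R + (x - iota p) * g].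
Proof.
move=> fc c0 [a yE]; set pi := x - iota p in yE *.
have pi0 : pi != 0 by apply: uniformizer_neq0_x.
have pip : at_x p pi 0 by apply: (at_uniformizer tx).
have dpi1 : del pi = 1 by apply: del_uniformizer.
have [c' f'c'] := at_del fc.
pose y1 := e.+1%:R * f + pi * del f.
have y1c : at_x p y1 (e.+1%:R * c).
  rewrite -[e.+1%:R * c]addr0 -(mul0r c'); apply: (at_add tx).
    by apply: at_mul => //; apply: at_nat.
  exact: at_mul.
have c10 : e.+1%:R * c != 0 by rewrite mulf_neq0 ?pnatr_eq0.
have y10 : y1 != 0 by apply: (at_neq0 tx y1c).
have delyE : del y = y1 * pi ^+ e.
  have -> : del y = del (y - iota a) by rewrite (tderB del_der) delK subr0.
  rewrite yE (tderM del_der) (tderXn del_der) // dpi1 /y1 exprS.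
  by field.
have [d' y1'd'] := at_del y1c.
pose G := del y1 / y1.
have GG : at_x p G (d' / (e.+1%:R * c)) by apply: at_mul => //; apply: at_inv.
have [d'' G'd''] := at_del GG.
set cG := d' / _ in GG.
have pe0 : pi ^+ e != 0 by rewrite expf_neq0.
have del2 : del (del y) = del y * (e%:R / pi + G).
  rewrite delyE (tderM del_der) (tderXn del_der) // dpi1 /G.
  by field; rewrite y10 pi0.
have eK : e%:R = iota e%:R by rewrite rmorph_nat.
have del3 : del (e%:R / pi + G) = - e%:R / pi ^+ 2 + del G.
  rewrite (tderD del_der) (tder_div del_der) // dpi1 eK delK.
  by field.
have dely0 : del y != 0 by rewrite delyE mulf_neq0.
exists y1, (pi * del G - e%:R * G - pi * G ^+ 2 / 2%:R),
  (0 * d'' - e%:R * cG - 0 * cG ^+ 2 / 2%:R); split=> //.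
  have at2 : at_x p 2%:R^-1 2%:R^-1 by apply: at_inv; rewrite ?pnatr_eq0 //; apply: at_nat.
  apply: (at_add tx); last first.
    by apply: at_opp; apply: at_mul => //; apply: at_mul => //; apply: at_exp.
  apply: (at_add tx); first exact: at_mul.
  by apply: at_opp; apply: at_mul => //; apply: at_nat.
rewrite /schwarz {1}del2 (tderM del_der) del3 !del2 -[e.+1]addn1 natrD.
by field; rewrite pi0 dely0 !natrL_eq0.
Qed.

(** The pull-back has a pole of order [e.+1 * (k + 2)], which the square of [del (phi z)] lowers by
    [2 * e]. As [k > 0], the double pole of the Schwarzian cannot interfere. For the image at
    infinity, [z] is [x^-1] and [s1] is [s * x ^+ 4]. *)
Lemma transfer_pole p z a f c e s s1 k : transc (consts iota) z ->
    at_x p f c -> c != 0 -> at_x p (phi z) a ->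
    phi (z - iota a) = f * (x - iota p) ^+ e.+1 ->
    del (phi z) ^+ 2 * phi s1 = s + schwarz del (phi z) ->
    (0 < k)%N ->
    (exists h d, [/\ at_ iota z a h d, d != 0 & s1 = h / (z - iota a) ^+ (k + 2)]) ->
  exists h d, [/\ at_x p h d, d != 0 & s = h / (x - iota p) ^+ (e.+1 * k + 2)].
Proof.
move=> tz fc c0 za zE sE k0 [h [d [hd d0 s1E]]].
have [|y1 [g [d' [y1c gd' delE schE]]]] := @schwarz_local p (phi z) f c e fc c0.
  by exists a; rewrite -zE rmorphB phiK.
have pip : at_x p (x - iota p) 0 by apply: (at_uniformizer tx).
have pi0 := uniformizer_neq0_x p.
have f0 : f != 0 by apply: (at_neq0 tx fc).
have phd := at_comp za hd.
set pi := x - iota p in zE pip pi0 delE schE *.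
set c1 := e.+1%:R * c in y1c.
have c10 : c1 != 0 by rewrite mulf_neq0 ?pnatr_eq0.
exists (y1 ^+ 2 * phi h / f ^+ (k + 2)
   - pi ^+ (e.+1 * k) * ((1 - e.+1%:R ^+ 2) / 2%:R + pi * g)).
have pk0 : (0 : K) ^+ (e.+1 * k) = 0 by rewrite expr0n muln_eq0 /= -leqn0 leqNgt k0.
exists (c1 ^+ 2 * d / c ^+ (k + 2)
   - 0 ^+ (e.+1 * k) * ((1 - e.+1%:R ^+ 2) / 2%:R + 0 * d')); split.
- apply: (at_add tx).
    by apply: at_mul; [apply: at_mul => //; apply: at_exp|
      apply: at_inv; rewrite ?expf_neq0 //; apply: at_exp].
  apply: at_opp; apply: at_mul; first exact: at_exp.
  apply: (at_add tx); last exact: at_mul.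
  apply: at_mul; last by apply: at_inv; rewrite ?pnatr_eq0 //; apply: at_nat.
  apply: (at_add tx); first exact: (at_nat p 1).
  by apply: at_opp; apply: at_exp; apply: at_nat.
- rewrite pk0 mul0r subr0; apply: mulf_neq0.
    by apply: mulf_neq0 => //; apply: expf_neq0.
  by rewrite invr_eq0; apply: expf_neq0.
- have -> : s = del (phi z) ^+ 2 * phi s1 - schwarz del (phi z).
    by rewrite sE addrK.
  rewrite -schE s1E fmorph_div rmorphXn zE delE.
  rewrite [pi ^+ (e.+1 * k + 2)]exprD !exprMn -!exprM.
  have -> : (e.+1 * (k + 2) = e.+1 * k + 2 + e * 2)%N by lia.
  move: (e.+1 * k)%N => n; rewrite !exprD; set A := pi ^+ n; set C := pi ^+ (e * 2).
  have A0 : A != 0 by rewrite expf_neq0.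
  have C0 : C != 0 by rewrite expf_neq0.
  have F0 : f ^+ k != 0 by rewrite expf_neq0.
  clearbody A C; move: (f ^+ k) F0 => F F0.
  by field; rewrite F0 f0 pi0 A0 C0 ?natrL_eq0.
Qed.

(** At a double pole the Schwarzian does contribute, by the coefficient of [schwarz_local]; the
    combination [1 + 2 b] turns the resulting affine law into a multiplicative one. *)
Lemma transfer_index p z a f c e s s1 : transc (consts iota) z ->
    at_x p f c -> c != 0 -> at_x p (phi z) a ->
    phi (z - iota a) = f * (x - iota p) ^+ e.+1 ->
    del (phi z) ^+ 2 * phi s1 = s + schwarz del (phi z) ->
  forall al, at_ iota z a ((z - iota a) ^+ 2 * s1) al ->
  exists be, at_x p ((x - iota p) ^+ 2 * s) be /\
    1 + 2%:R * be = e.+1%:R ^+ 2 * (1 + 2%:R * al).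
Proof.
move=> tz fc c0 za zE sE al s1al.
have [|y1 [g [d' [y1c gd' delE schE]]]] := @schwarz_local p (phi z) f c e fc c0.
  by exists a; rewrite -zE rmorphB phiK.
have pip : at_x p (x - iota p) 0 by apply: (at_uniformizer tx).
have pi0 := uniformizer_neq0_x p.
have f0 : f != 0 by apply: (at_neq0 tx fc).
have phd := at_comp za s1al.
set pi := x - iota p in zE pip pi0 delE schE *.
set c1 := e.+1%:R * c in y1c.
exists (c1 ^+ 2 * al / c ^+ 2 - ((1 - e.+1%:R ^+ 2) / 2%:R + 0 * d')).
split; last first.
  have two0 : 2%:R != 0 :> K by rewrite pnatr_eq0.
  by rewrite mul0r addr0 /c1; field; rewrite ?two0 c0.
have -> : pi ^+ 2 * s = y1 ^+ 2 * phi ((z - iota a) ^+ 2 * s1) / f ^+ 2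
   - ((1 - e.+1%:R ^+ 2) / 2%:R + pi * g).
  rewrite -schE rmorphM rmorphXn zE.
  have -> : s = del (phi z) ^+ 2 * phi s1 - schwarz del (phi z) by rewrite sE addrK.
  rewrite delE [pi ^+ e.+1]exprS; have pe0 : pi ^+ e != 0 by rewrite expf_neq0.
  by field.
apply: (at_add tx).
  by apply: at_mul; [apply: at_mul => //; apply: at_exp|
    apply: at_inv; rewrite ?expf_neq0 //; apply: at_exp].
apply: at_opp; apply: (at_add tx); last exact: at_mul.
apply: at_mul; last by apply: at_inv; rewrite ?pnatr_eq0 //; apply: at_nat.
apply: (at_add tx); first exact: (at_nat p 1).
by apply: at_opp; apply: at_exp; apply: at_nat.
Qed.

Lemma schwarz_inv y : y != 0 -> del y != 0 -> schwarz del y^-1 = schwarz del y.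
Proof.
move=> y0 dy0.
have d1 : del y^-1 = - del y / y ^+ 2 by rewrite (tderV del_der).
have y20 : y ^+ 2 != 0 by rewrite expf_neq0.
have dy2 : del (y ^+ 2) = 2%:R * y * del y by rewrite expr2 (tderM del_der); ring.
have dN f : del (- f) = - del f by apply: (derN del_der).
have d2 : del (del y^-1) =
    (- del (del y) * y + 2%:R * del y ^+ 2) / y ^+ 3.
  by rewrite d1 (tder_div del_der) // dN dy2; field.
have y30 : y ^+ 3 != 0 by rewrite expf_neq0.
have dy3 : del (y ^+ 3) = 3%:R * y ^+ 2 * del y.
  by rewrite exprS (tderM del_der) dy2; ring.
have d3 : del (del (del y^-1)) = ((- del (del (del y)) * y - del (del y) * del y
    + 4%:R * del y * del (del y)) * y ^+ 3
    - (- del (del y) * y + 2%:R * del y ^+ 2) * (3%:R * y ^+ 2 * del y)) / y ^+ 6.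
  rewrite d2 (tder_div del_der) // dy3 (tderD del_der) !(tderM del_der) dN.
  have -> : del 2%:R = 0 by rewrite -(rmorph_nat iota) delK.
  by field.
rewrite /schwarz d3 d2 d1; field.
by rewrite y0 oppr_eq0 dy0 !natrL_eq0.
Qed.

Lemma eq_mup_proportional (f g : {poly K}) : f != 0 -> g != 0 ->
  (forall a, mup a f = mup a g) -> exists2 c, c != 0 & f = c *: g.
Proof.
move=> f0 g0 fg; have [s sE] := closed_field_poly_normal f.
have [s' s'E] := closed_field_poly_normal g.
have lf : lead_coef f != 0 by rewrite lead_coef_eq0.
have lg : lead_coef g != 0 by rewrite lead_coef_eq0.
have mupZ c (h : {poly K}) a : c != 0 -> mup a (c *: h) = mup a h.
  by move=> c0; rewrite -mul_polyC mupMr // rootC.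
have ss' : perm_eq s s'.
  apply/allP => a _ /=; rewrite -!mu_prod_XsubC.
  by have := fg a; rewrite {1}sE {1}s'E !mupZ // => ->.
exists (lead_coef f / lead_coef g); first by rewrite mulf_neq0 ?invr_eq0.
by rewrite {1}sE {2}s'E scalerA divfK // (perm_big _ ss').
Qed.

Notation wronskian := (P^`() * Q - P * Q^`()).

(** Riemann-Hurwitz: [S] has degree [d = size Q] and [2 d - 2] critical points, all finite since
    infinity is unramified. The leading terms do not cancel, their difference being the product of
    the leading coefficients times the difference 1 of the degrees. *)
Lemma size_wronskian : size wronskian = (2 * (size Q).-1).+1.
Proof.
have szd (p : {poly K}) : size p^`() = (size p).-1 /\
    lead_coef p^`() = ((size p).-1)%:R * lead_coef p.
  have [p1|p1] := leqP (size p) 1.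
    rewrite (size1_polyC p1) derivC size_poly0 lead_coef0 size_polyC.
    by case: eqP => _; rewrite /= mul0r.
  have [n sp] : exists n, size p = n.+2 by case: (size p) p1 => [|[|n]] //; exists n.
  have c0 : p^`()`_n != 0.
    rewrite coef_deriv mulrn_eq0 /=.
    have : lead_coef p != 0 by rewrite lead_coef_eq0 -size_poly_gt0 sp.
    by rewrite lead_coefE sp.
  have sd : size p^`() = n.+1.
    apply/eqP; rewrite eqn_leq; apply/andP; split.
      by rewrite -ltnS -sp lt_size_deriv // -size_poly_gt0 sp.
    by rewrite ltnNge; apply/negP => /leq_sizeP/(_ n (leqnn n)) /eqP; rewrite (negPf c0).
  by rewrite !lead_coefE sd sp /= coef_deriv mulr_natl.
have [sP' lP'] := szd P; have [sQ' lQ'] := szd Q.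
have lP : lead_coef P != 0 by rewrite lead_coef_eq0 P_neq0.
have lQ : lead_coef Q != 0 by rewrite lead_coef_eq0 Q_neq0.
have [n sQ] : exists n, size Q = n.+2.
  by case: (size Q) sizeQ => [|[|n]] //; exists n.
rewrite sizeP sQ /= in sP' lP' sQ' lQ' *.
have P'0 : P^`() != 0 by rewrite -size_poly_gt0 sP'.
have Q'0 : Q^`() != 0 by rewrite -size_poly_gt0 sQ'.
have s1 : size (P^`() * Q) = (2 * n.+1).+1 by rewrite size_mul ?Q_neq0 // sP' sQ; lia.
have s2 : size (P * Q^`()) = (2 * n.+1).+1 by rewrite size_mul ?P_neq0 // sizeP sQ sQ'; lia.
apply/eqP; rewrite eqn_leq; apply/andP; split.
  by rewrite (leq_trans (size_polyD _ _)) // size_polyN s1 s2 maxnn.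
rewrite ltnNge; apply/negP => /leq_sizeP/(_ _ (leqnn _)) /eqP.
have l1 := lead_coefM P^`() Q; have l2 := lead_coefM P Q^`().
rewrite lead_coefE s1 /= in l1; rewrite lead_coefE s2 /= in l2.
rewrite coefB l1 l2 lP' lQ'.
rewrite (_ : _ - _ = lead_coef P * lead_coef Q); last by rewrite -[n.+2]addn1 natrD; ring.
by rewrite mulf_eq0 (negPf lP) (negPf lQ).
Qed.

Lemma wronskian_neq0 : wronskian != 0.
Proof. by rewrite -size_poly_gt0 size_wronskian. Qed.

Lemma del_phix : del (phi x) = hev iota x wronskian / hev iota x Q ^+ 2.
Proof.
rewrite phix (tder_div del_der) ?hevQ // !del_hev.
by rewrite hevD hevN !hevM.
Qed.

Lemma del_phix_neq0 : del (phi x) != 0.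
Proof.
by rewrite del_phix mulf_neq0 ?invr_eq0 ?expf_neq0 ?hevQ // (hev_eq0 tx) wronskian_neq0.
Qed.

Lemma mup_wronskian_fiber a p : root (fiber a) p ->
  mup p wronskian = (mup p (fiber a)).-1.
Proof.
move=> fp; rewrite -(mup_wronskian (@pchar_num K) (fiber_neq0 a) fp (fiber_Q fp)).
congr mup; rewrite /fiber derivB derivZ -!mul_polyC; ring.
Qed.

Lemma mup_wronskian_pole p : root Q p -> mup p wronskian = (mup p Q).-1.
Proof.
move=> Qp; rewrite -(mup_wronskian (@pchar_num K) Q_neq0 Qp (pole_P Qp)).
have -> : Q^`() * P - Q * P^`() = (-1)%:P * wronskian by rewrite polyCN; ring.
by rewrite mupMr // rootC oppr_eq0 oner_eq0.
Qed.

Lemma at_quotient z N D a : D.[a] != 0 -> at_ iota z a (hev iota z N / hev iota z D) (N.[a] / D.[a]).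
Proof. by move=> Da; apply: at_mul; [|apply: at_inv => //]; apply: at_hev. Qed.

(** [M] clears the denominators of the square roots of the values; these roots are at most 1, whence
    [n <= M]. *)
Lemma common_denominator (vs : seq K) :
    (forall v, v \in vs -> v = 0 \/ exists2 m, (0 < m)%N & v = (m%:R ^+ 2)^-1) ->
  exists2 M, (0 < M)%N & forall v, v \in vs ->
    exists2 n, (n <= M)%N & n%:R ^+ 2 = M%:R ^+ 2 * v.
Proof.
elim: vs => [|v vs IH] H; first by exists 1%N.
have [|M M0 HM] := IH; first by move=> w wv; apply: H; rewrite inE wv orbT.
have [->|[m m0 ->]] := H v (mem_head _ _).
  exists M => // w; rewrite inE => /predU1P[->|/HM//].
  by exists 0%N => //; rewrite mulr0 expr0n.
have mK : m%:R != 0 :> K by rewrite pnatr_eq0 -lt0n.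
exists (M * m)%N; first by rewrite muln_gt0 M0.
move=> w; rewrite inE => /predU1P[->|/HM[n nM nE]].
  by exists M; rewrite ?leq_pmulr // natrM; field.
by exists (n * m)%N; rewrite ?leq_mul2r ?nM ?orbT // !natrM !exprMn nE; ring.
Qed.

Lemma nat_sqr_inj (m n : nat) : m%:R ^+ 2 = n%:R ^+ 2 :> K -> m = n.
Proof.
by move=> /eqP; rewrite -!natrX eqr_nat eqn_sqr => /eqP.
Qed.

(** * Poles and weights of a projective connection, and the resulting density *)

Section Projective.
Variables (s : L).
Hypothesis s_base : s \in adj (consts iota) x.
Hypothesis s_inv : del (phi x) ^+ 2 * phi s = s + schwarz del (phi x).

Lemma s_fraction : exists N D, [/\ D != 0, coprimep N D & s = hev iota x N / hev iota x D].
Proof. exact/(adj_constsP tx). Qed.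

Section Fraction.
Variables N D : {poly K}.
Hypothesis D_neq0 : D != 0.
Hypothesis copND : coprimep N D.
Hypothesis sE : s = hev iota x N / hev iota x D.

Let roots_of (p : {poly K}) : exists2 rs, uniq rs & forall a, p != 0 -> root p a = (a \in rs).
Proof.
have [rs rsE] := closed_field_poly_normal p.
exists (undup rs); rewrite ?undup_uniq // => a p0.
by rewrite mem_undup rsE rootZ ?lead_coef_eq0 // root_prod_XsubC.
Qed.

Lemma mup_pole p h d n : at_x p h d -> d != 0 -> s = h / (x - iota p) ^+ n.+1 ->
  mup p D = n.+1.
Proof.
move=> hd d0 shE; have N0 : N != 0.
  apply: contra_eq_neq shE => N0; rewrite sE N0 /hev map_poly0 horner0 mul0r eq_sym.
  by rewrite mulf_neq0 ?invr_eq0 ?expf_neq0 ?uniformizer_neq0_x // (at_neq0 tx hd).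
by apply: (mup_den tx copND N0 D_neq0 hd d0); rewrite // -sE.
Qed.

(** By [transfer_pole], the preimages of a pole of order at least 3 are such poles again, of larger
    order where [S] ramifies; [backward_growth] excludes this. *)
Lemma pole_le2 a : (mup a D <= 2)%N.
Proof.
have [rs urs rsE] := roots_of D; have {}rsE b := rsE b D_neq0.
suff S0 : [seq b <- rs | (2 < mup b D)%N] = [::].
  rewrite leqNgt; apply/negP => a2.
  have : a \in [seq b <- rs | (2 < mup b D)%N].
    by rewrite mem_filter a2 -rsE -mup_gt0 // ltnW // ltnW.
  by rewrite S0.
apply: (@backward_growth _ (fun b c => (mup b D <= mup c D)%N)).
- exact: filter_uniq.
- by move=> b c; apply: leq_total.
- by move=> b c d; apply: leq_trans.
move=> b p; rewrite !mem_filter -!rsE => /andP[b2 Db] fp.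
have [k mk] : exists k, mup b D = k.+3.
  by case: (mup b D) b2 => [|[|[|k]]] //; exists k.
have [f [c [fc c0 fE]]] := fiber_local fp.
have [g [d [gd d0 gE]]] := hev_factor iota x b D_neq0.
have Nb : N.[b] != 0 by apply: coprimep_root Db; rewrite coprimep_sym.
have e0 : (0 < mup p (fiber b))%N by rewrite mup_gt0 ?fiber_neq0.
have [e eE] : exists e, mup p (fiber b) = e.+1 by exists (mup p (fiber b)).-1; rewrite prednK.
rewrite eE in fE.
have [|h [dh [hdh dh0 shE]]] :=
    @transfer_pole p x b f c e s s k.+1 tx fc c0 (fiber_value fp) fE s_inv isT.
  exists (hev iota x N / g), (N.[b] / d); split.
  - by apply: at_mul; [apply: at_hev|apply: at_inv].
  - by rewrite mulf_neq0 ?invr_eq0.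
  - by rewrite sE gE mk invfM mulrA addnC.
rewrite addn2 in shE; have mp := mup_pole hdh dh0 shE.
have kp : (k.+1 <= e.+1 * k.+1)%N by rewrite leq_pmull.
split; first by rewrite -(mup_gt0 p D_neq0) mp !ltnS.
  by rewrite mp mk !ltnS.
by rewrite mp mk eE => /mul_succ_le ->.
Qed.

Lemma index_exists p : exists be, at_x p ((x - iota p) ^+ 2 * s) be.
Proof.
have [f [c [fc c0 fE]]] := hev_factor iota x p D_neq0.
have [j jE] : exists j, (2 = j + mup p D)%N.
  by exists (2 - mup p D)%N; rewrite subnK // pole_le2.
(* The power of 0 is 1 at a double pole, where [j = 0], and 0 elsewhere. *)
exists (N.[p] / c * 0 ^+ j).
have -> : (x - iota p) ^+ 2 * s = hev iota x N / f * (x - iota p) ^+ j.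
  rewrite sE fE jE exprD; have f0 := at_neq0 tx fc c0.
  have pm0 : (x - iota p) ^+ mup p D != 0 by rewrite expf_neq0 ?uniformizer_neq0_x.
  by move: (_ ^+ mup p D) pm0 => pm pm0; field; rewrite ?f0 ?pm0.
apply: at_mul; last by apply: at_exp; apply: (at_uniformizer tx).
by apply: at_mul; [apply: at_hev|apply: at_inv].
Qed.

Lemma index_regular p be : D.[p] != 0 -> at_x p ((x - iota p) ^+ 2 * s) be -> be = 0.
Proof.
move=> Dp bep; apply: (at_uniq tx bep).
rewrite sE -(mul0r (N.[p] / D.[p])) -[0](expr0n K 2).
by apply: at_mul; [apply: at_exp; apply: (at_uniformizer tx)|apply: at_quotient].
Qed.

Lemma x_neq0 : x != 0.
Proof. by apply: contraNneq x_notin => ->; rewrite rpred0. Qed.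

Lemma xV_notin : x^-1 \notin consts iota.
Proof. by rewrite rpredV. Qed.

Notation tV := (notin_consts_transc xV_notin).

(* [s * x ^+ 4] is the quadratic differential [s] in the coordinate [1/x]. *)
Lemma s_inv_infinity : del (phi x^-1) ^+ 2 * phi (s * x ^+ 4) = s + schwarz del (phi x^-1).
Proof.
have px0 : phi x != 0 by rewrite fmorph_eq0 x_neq0.
rewrite fmorphV schwarz_inv ?del_phix_neq0 // -s_inv (tderV del_der).
by rewrite rmorphM rmorphXn; field.
Qed.

Lemma pole_root : exists p, root Q p.
Proof. by apply/closed_rootP; rewrite neq_ltn sizeQ orbT. Qed.

Lemma pole_value p : root Q p -> at_x p (phi x^-1) 0.
Proof.
move=> Qp; rewrite fmorphV phix invf_div.
have <- : Q.[p] / P.[p] = 0 by rewrite (eqP Qp) mul0r.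
exact/at_quotient/pole_P.
Qed.

Lemma pole_data p : root Q p -> exists f c e, [/\ at_x p f c, c != 0,
  mup p Q = e.+1 & phi (x^-1 - iota 0) = f * (x - iota p) ^+ e.+1].
Proof.
move=> Qp; have [f [c [fc c0 fE]]] := pole_local Qp.
have e0 : (0 < mup p Q)%N by rewrite mup_gt0 // Q_neq0.
exists f, c, (mup p Q).-1; rewrite prednK //; split=> //.
by rewrite rmorph0 subr0.
Qed.

(** A pole of order above two at infinity would be transferred to the roots of [Q], finite points,
    against [pole_le2]. *)
Lemma index_infinity_exists : exists al,
  at_ iota x^-1 0 ((x^-1 - iota 0) ^+ 2 * (s * x ^+ 4)) al.
Proof.
set z := x^-1; set w := _ * _.
have xz : x \in adj (consts iota) z by rewrite -[x]invrK rpredV adj_gen.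
have wz : w \in adj (consts iota) z.
  rewrite /w rmorph0 subr0 rpredM ?rpredX ?adj_gen // rpredM ?rpredX //.
  by apply: adj_min s_base => // f; apply: sub_adj.
have [N1 [D1 [D10 cop1 wE]]] := (adj_constsP tV w).1 wz.
have [D1r|D1r] := boolP (root D1 0); last first.
  by exists (N1.[0] / D1.[0]); rewrite wE; apply: at_quotient.
have [p Qp] := pole_root; have [f [c [e [fc c0 eE fE]]]] := pole_data Qp.
have [g [d [gd d0 gE]]] := hev_factor iota z 0 D10.
have N1r : N1.[0] != 0 by apply: coprimep_root D1r; rewrite coprimep_sym.
have k0 : (0 < mup 0 D1)%N by rewrite mup_gt0.
have z0 : z - iota 0 != 0 by rewrite rmorph0 subr0 invr_eq0 x_neq0.
have [|h [dh [hdh dh0 shE]]] := @transfer_pole p z 0 f c e s (s * x ^+ 4)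
    (mup 0 D1) tV fc c0 (pole_value Qp) fE s_inv_infinity k0.
  exists (hev iota z N1 / g), (N1.[0] / d); split.
  - by apply: at_mul; [apply: at_hev|apply: at_inv].
  - by rewrite mulf_neq0 ?invr_eq0.
  - have -> : s * x ^+ 4 = w / (z - iota 0) ^+ 2 by rewrite /w mulrAC divff ?mul1r // expf_neq0.
    by rewrite wE gE exprD !invfM !mulrA.
rewrite addn2 in shE; have := pole_le2 p; rewrite (mup_pole hdh dh0 shE).
by rewrite !ltnS leqn0 muln_eq0 /= -leqn0 leqNgt k0.
Qed.

Lemma density_exists : exists n A c,
  [/\ (0 < n)%N, A \in adj (consts iota) x, A != 0, c != 0
    & phi A = iota c * del (phi x) ^+ n * A].
Proof.
have /choice[be beE] := index_exists; pose F p := 1 + 2%:R * be p.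
have [al alE] := index_infinity_exists; pose Finf := 1 + 2%:R * al.
have F_fiber a p : root (fiber a) p -> F p = (mup p (fiber a))%:R ^+ 2 * F a.
  move=> fp; have [f [c [fc c0 fE]]] := fiber_local fp.
  have e0 : (0 < mup p (fiber a))%N by rewrite mup_gt0 ?fiber_neq0.
  case: (mup p (fiber a)) e0 fE => // e _ fE.
  have [b [bp <-]] := @transfer_index p x a f c e s s tx fc c0 (fiber_value fp)
    fE s_inv _ (beE a).
  by rewrite /F (at_uniq tx (beE p) bp).
have F_pole p : root Q p -> F p = (mup p Q)%:R ^+ 2 * Finf.
  move=> Qp; have [f [c [e [fc c0 -> fE]]]] := pole_data Qp.
  have [b [bp <-]] := @transfer_index p x^-1 0 f c e s (s * x ^+ 4) tV fc c0
    (pole_value Qp) fE s_inv_infinity _ alE.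
  by rewrite /F (at_uniq tx (beE p) bp).
have F_regular p : ~~ root D p -> F p = 1.
  by move=> Dp; rewrite /F (index_regular Dp (beE p)) mulr0 addr0.
have [T uT TE] := roots_of D; have {}TE a := TE a D_neq0.
pose inv_sqr v := exists2 m, (0 < m)%N & v = (m%:R ^+ 2)^-1 :> K.
(* The exceptional points are poles of [s], as the weight is 1 elsewhere. They are stable under
   preimages, along which [F] is multiplied by the square of the ramification index, so
   [backward_growth] applies with the absolute value of [F]. *)
have F_val a : F a = 0 \/ inv_sqr (F a).
  apply: contrapT => /not_orP[/eqP Fa0 Fai].
  pose S := [seq b <- T | (F b != 0) && ~~ `[< inv_sqr (F b) >]].
  have memS b : F b != 0 -> ~ inv_sqr (F b) -> b \in S.
    move=> Fb0 Fbi; rewrite mem_filter Fb0; apply/andP; split.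
      by apply/negP => /asboolP.
    rewrite -TE; apply: contrapT => /negP Db; apply: Fbi.
    by exists 1%N => //; rewrite F_regular // expr1n invr1.
  suff S0 : S = [::] by have := memS a Fa0 Fai; rewrite S0.
  apply: (@backward_growth _ (fun b c => `|F b| <= `|F c|)).
  - exact: filter_uniq.
  - by move=> b c; apply: real_leVge; apply: normr_real.
  - by move=> b c d; apply: le_trans.
  move=> b p; rewrite mem_filter => /andP[/andP[Fb0 /asboolP Fbi] _] fp.
  have e0 : (0 < mup p (fiber b))%N by rewrite mup_gt0 ?fiber_neq0.
  have FE := F_fiber _ _ fp; set e := mup p (fiber b) in e0 FE *.
  have eK : e%:R != 0 :> K by rewrite pnatr_eq0 -lt0n.
  have nFE : `|F p| = (e ^ 2)%:R * `|F b|.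
    by rewrite FE normrM normrX normr_nat natrX.
  have nF0 : 0 < `|F b| by rewrite normr_gt0.
  split.
  - apply: memS; first by rewrite FE mulf_neq0 ?expf_neq0.
    move=> [m m0 FpE]; apply: Fbi; exists (e * m)%N; first by rewrite muln_gt0 e0.
    have -> : F b = F p / e%:R ^+ 2 by rewrite FE mulrC mulKf // expf_neq0.
    by rewrite FpE [in RHS]natrM exprMn [RHS]invfM [RHS]mulrC.
  - by rewrite nFE ler_peMl ?normr_ge0 // ler1n expn_gt0 e0.
  - rewrite nFE -[X in _ <= X]mul1r ler_pM2r // (ler_nat K _ 1).
    by move=> e1; apply/eqP; rewrite eqn_leq e0 andbT; move: e1; rewrite -[1%N in X in X -> _](exp1n 2) leq_sqr.
have Finf_val : Finf = 0 \/ inv_sqr Finf.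
  have [p Qp] := pole_root; have FE := F_pole _ Qp.
  have e0 : (0 < mup p Q)%N by rewrite mup_gt0 // Q_neq0.
  have eK : (mup p Q)%:R ^+ 2 != 0 :> K by rewrite expf_neq0 // pnatr_eq0 -lt0n.
  have [F0|[m m0 FpE]] := F_val p.
    by left; apply/eqP; have /eqP := FE; rewrite F0 eq_sym mulf_eq0 (negPf eK).
  right; exists (mup p Q * m)%N; first by rewrite muln_gt0 e0.
  have -> : Finf = F p / (mup p Q)%:R ^+ 2 by rewrite FE mulrC mulKf.
  by rewrite FpE [in RHS]natrM exprMn [RHS]invfM [RHS]mulrC.
(* The value 1 accounts for all points outside [T]. *)
have [|M M0 HM] := @common_denominator (1 :: Finf :: [seq F a | a <- T]).
  move=> v; rewrite !inE => /predU1P[->|/predU1P[->//|/mapP[a _ ->//]]].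
  by right; exists 1%N => //; rewrite expr1n invr1.
have [ni niM niE] : exists2 n, (n <= M)%N & n%:R ^+ 2 = M%:R ^+ 2 * Finf.
  by apply: HM; rewrite !inE eqxx orbT.
have /choice[nu nuE] : forall p, exists n, (n <= M)%N /\ n%:R ^+ 2 = M%:R ^+ 2 * F p.
  move=> p; have [|n nM nE] := HM (F p); last by exists n.
  rewrite !inE; have [Dp|Dp] := boolP (root D p); last by rewrite F_regular ?eqxx.
  by rewrite map_f ?orbT // -TE.
have nu_fiber a p : root (fiber a) p -> nu p = (mup p (fiber a) * nu a)%N.
  move=> fp; apply: nat_sqr_inj; rewrite (nuE p).2 (F_fiber a p fp).
  by rewrite natrM exprMn (nuE a).2 mulrCA.
have nu_pole p : root Q p -> nu p = (mup p Q * ni)%N.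
  move=> Qp; apply: nat_sqr_inj; rewrite (nuE p).2 (F_pole p Qp).
  by rewrite natrM exprMn niE mulrCA.
have nu_regular p : p \notin T -> nu p = M.
  by rewrite -TE => Dp; apply: nat_sqr_inj; rewrite (nuE p).2 F_regular // mulr1.
pose k p := (M - nu p)%N; pose ki := (M - ni)%N.
pose A := \prod_(a <- T) ('X - a%:P) ^+ k a.
pose H := \prod_(a <- T) fiber a ^+ k a.
have Xk0 a : ('X - a%:P) ^+ k a != 0 by rewrite expf_neq0 // polyXsubC_eq0.
have fk0 a : fiber a ^+ k a != 0 by rewrite expf_neq0 // fiber_neq0.
have A0 : A != 0 by rewrite prodf_seq_neq0; apply/allP => a _; apply: Xk0.
have H0 : H != 0 by rewrite prodf_seq_neq0; apply/allP => a _; apply: fk0.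
have WM0 : wronskian ^+ M != 0 by rewrite expf_neq0 // wronskian_neq0.
have Qk0 : Q ^+ ki != 0 by rewrite expf_neq0 // Q_neq0.
have sum1 (G : K -> nat) b : (forall a, a != b -> G a = 0%N) -> (b \notin T -> G b = 0%N) ->
    (\sum_(a <- T) G a = G b)%N.
  move=> G0 Gb; have [bT|bT] := boolP (b \in T).
    by rewrite (bigD1_seq b) //= big1 ?addn0.
  rewrite big_seq big1 ?Gb // => a aT; apply: G0.
  by apply: contraNneq bT => <-.
have k_regular p : p \notin T -> k p = 0%N by move=> pT; rewrite /k nu_regular // subnn.
have [c c0 cE] : exists2 c, c != 0 & wronskian ^+ M * A = c *: (H * Q ^+ ki).
  apply: eq_mup_proportional; rewrite ?mulf_neq0 // => p.
  rewrite !mupM // !mupXn ?wronskian_neq0 ?Q_neq0 // !mup_prod //.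
  rewrite (sum1 _ p); first last.
  - by move=> pT; rewrite k_regular // expr0 mupNroot // rootC oner_eq0.
  - by move=> a ap; rewrite mup_XsubCX (negPf ap).
  rewrite mup_XsubCX eqxx.
  have [Qp|Qp] := boolP (root Q p).
    rewrite big1_seq => [|a _]; last first.
      rewrite mupXn ?fiber_neq0 // mupNroot ?muln0 //.
      by apply/negP => /fiber_Q; rewrite (eqP Qp) eqxx.
    rewrite mup_wronskian_pole // /k /ki nu_pole //.
    have := (nuE p).1; rewrite nu_pole //.
    have : (0 < mup p Q)%N by rewrite mup_gt0 // Q_neq0.
    by move=> e0 le; rewrite add0n ramification_count.
  have [b fb] : exists b, root (fiber b) p.
    by exists (P.[p] / Q.[p]); rewrite rootE fiber_horner divfK // subrr.
  rewrite (sum1 _ b); first last.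
  - by move=> bT; rewrite k_regular // expr0 mupNroot // rootC oner_eq0.
  - move=> a ab; rewrite mupXn ?fiber_neq0 // mupNroot ?muln0 //.
    apply: contra ab; move: fb; rewrite !rootE !fiber_horner !subr_eq0.
    by move=> /eqP-> /eqP/(mulIf Qp)->.
  rewrite mupXn ?fiber_neq0 // [mup p Q]mupNroot // muln0 addn0.
  rewrite (mup_wronskian_fiber fb) /k (nu_fiber _ _ fb).
  have := (nuE p).1; rewrite (nu_fiber _ _ fb).
  have : (0 < mup p (fiber b))%N by rewrite mup_gt0 // fiber_neq0.
  by move=> e0 le; rewrite ramification_count.
pose Sk := (\sum_(a <- T) k a)%N.
have sizeprod (G : K -> {poly K}) (g : nat) : (forall a, size (G a) = g.+1) ->
    (size (\prod_(a <- T) G a ^+ k a)).-1 = (g * Sk)%N.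
  move=> sG; rewrite /Sk; elim: (T) => [|a T' IH]; first by rewrite !big_nil size_poly1 muln0.
  have G0 b : G b ^+ k b != 0 by rewrite expf_neq0 // -size_poly_gt0 sG.
  have P0 : \prod_(b <- T') G b ^+ k b != 0.
    by rewrite prodf_seq_neq0; apply/allP => b _; apply: G0.
  rewrite !big_cons size_mul // mulnDr -IH; have := size_exp (G a) (k a).
  rewrite sG /= => <-; move: (G0 a) P0; rewrite -!size_poly_gt0.
  by case: (size _) => // i _; case: (size _) => // j _; rewrite addSn addnS.
have szM (p q : {poly K}) : p != 0 -> q != 0 -> (size (p * q)%R).-1 = ((size p).-1 + (size q).-1)%N.
  move=> p0 q0; rewrite size_mul //; move: p0 q0; rewrite -!size_poly_gt0.
  by case: (size p) => // i _; case: (size q) => // j _; rewrite addSn addnS.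
(* This makes the powers of [Q] in the denominators of [phi A] and of [del (phi x) ^+ M] match. *)
have degE : (2 * M = Sk + ki)%N.
  have := congr1 (fun p : {poly K} => (size p).-1) cE.
  rewrite size_scale // !szM // !size_exp size_wronskian /=.
  rewrite (sizeprod (fun a => 'X - a%:P) 1%N) => [|a]; last exact: size_XsubC.
  rewrite (sizeprod fiber (size Q)) => [|a]; last by rewrite size_fiber.
  by case: (size Q) sizeQ => [|[|n]] //= _; apply: degree_count.
have hevA0 : hev iota x A != 0 by rewrite (hev_eq0 tx).
exists M, (hev iota x A), c^-1; split=> //; rewrite ?invr_eq0 //.
  by rewrite rpred_horner ?adj_gen //; apply: polyOverS (hev_polyOver _ _) => g; apply: sub_adj.
have q0 := hevQ.
have -> : phi (hev iota x A) = hev iota x H / hev iota x Q ^+ Sk.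
  rewrite /A /H /Sk !hev_prod; elim: (T) => [|a T' IH].
    by rewrite !big_nil rmorph1 expr0 divr1.
  rewrite !big_cons rmorphM IH !hevXn -uniformizerE rmorphXn phi_uniformizer expr_div_n.
  by rewrite exprD mulf_div.
have cH : hev iota x wronskian ^+ M * hev iota x A = iota c * (hev iota x H * hev iota x Q ^+ ki).
  by rewrite -!hevXn -!hevM cE hevZ.
rewrite del_phix expr_div_n -exprM degE exprD -mulrA mulrAC cH fmorphV.
have ic0 : iota c != 0 by rewrite fmorph_eq0.
have qk0 : hev iota x Q ^+ ki != 0 by rewrite expf_neq0.
have qs0 : hev iota x Q ^+ Sk != 0 by rewrite expf_neq0.
by field; rewrite ic0 qk0 qs0.
Qed.

End Fraction.

Lemma projective_density : exists n A c,
  [/\ (0 < n)%N, A \in adj (consts iota) x, A != 0, c != 0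
    & phi A = iota c * del (phi x) ^+ n * A].
Proof. by have [N [D [D0 cND sE]]] := s_fraction; apply: density_exists sE. Qed.

End Projective.
End Dynamics.

(** * Laurent series *)

Lemma eigen_shift (F : fieldType) (k q t f : F) m n : q != 0 -> t != 0 ->
  q ^+ m = k * q ^+ n -> k * f * (q * t) ^+ n / (q * t) ^+ m = f * t ^+ n / t ^+ m.
Proof.
move=> q0 t0 qmn; rewrite !exprMn; have qm0 : q ^+ m != 0 by rewrite expf_neq0.
have tm0 : t ^+ m != 0 by rewrite expf_neq0.
rewrite qmn mulf_eq0 in qm0 *; case/norP: qm0.
by move: (q ^+ n) (t ^+ n) (t ^+ m) tm0 => B T T' T0 k0 B0; field; rewrite T0 k0 B0.
Qed.

Lemma commutes_div (F : fieldType) (phi : {rmorphism F -> F}) (theta : F -> F) a b :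
    der_on idfun (total_field F) theta -> b != 0 ->
    phi (theta a) = theta (phi a) -> phi (theta b) = theta (phi b) ->
  phi (theta (a / b)) = theta (phi (a / b)).
Proof.
move=> td b0 ca cb; have pb0 : phi b != 0 by rewrite fmorph_eq0.
rewrite (tder_div td _ b0) fmorph_div rmorphXn rmorphB !rmorphM ca cb.
by rewrite fmorphV (tder_div td _ pb0).
Qed.

Lemma subf_div (F : fieldType) (a b c d : F) : b != 0 -> d != 0 ->
  a / b - c / d = (a * d - c * b) / (b * d).
Proof. by move=> b0 d0; rewrite -mulNr addf_div // mulNr. Qed.

Lemma quotient_rule_sub (F : fieldType) (a b c d a' b' c' d' : F) :
    b != 0 -> d != 0 ->
  ((a * d' + a' * d - (c * b' + c' * b)) * (b * d)
    - (a * d - c * b) * (b * d' + b' * d)) / (b * d) ^+ 2 =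
  (a' * b - a * b') / b ^+ 2 - (c' * d - c * d') / d ^+ 2.
Proof. by move=> b0 d0; field; rewrite b0 d0. Qed.

Lemma quotient_rule_mul (F : fieldType) (a b c d a' b' c' d' : F) :
    b != 0 -> d != 0 ->
  ((a * c' + a' * c) * (b * d) - a * c * (b * d' + b' * d)) / (b * d) ^+ 2 =
  a / b * ((c' * d - c * d') / d ^+ 2) + (a' * b - a * b') / b ^+ 2 * (c / d).
Proof. by move=> b0 d0; field; rewrite b0 d0. Qed.

(** * Extending morphisms and derivations to the fraction field *)

Section FractionExtensions.
Variable D : idomainType.

Lemma frac_repr (x : {fraction D}) : exists a b, b != 0 /\ x = a%:F / b%:F.
Proof. by exists \n_(repr x), \d_(repr x); rewrite denom_ratioP -frac_reprE. Qed.

Lemma frac_morphism (F : fieldType) (f : {rmorphism D -> F}) : injective f ->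
  exists g : {rmorphism {fraction D} -> F}, forall a, g a%:F = f a.
Proof.
move=> fI; have f0 a : (f a == 0) = (a == 0) by rewrite -(inj_eq fI) rmorph0.
pose g (x : {fraction D}) := f \n_(repr x) / f \d_(repr x).
have gE a b : b != 0 -> g (a%:F / b%:F) = f a / f b.
  move=> b0; rewrite /g; set x := a%:F / b%:F; have d0 := denom_ratioP (repr x).
  have /esym/eqP := frac_reprE x; rewrite {1}/x frac_eqE // => /eqP E.
  by apply/eqP; rewrite eqr_div ?f0 // -!rmorphM E.
have zm : zmod_morphism g.
  move=> x y; have [a [b [b0 ->]]] := frac_repr x; have [c [d [d0 ->]]] := frac_repr y.
  have -> : a%:F / b%:F - c%:F / d%:F = (a * d - c * b)%:F / (b * d)%:F.
    by rewrite tofracB !tofracM subf_div ?tofrac_eq0.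
  by rewrite !gE ?mulf_neq0 // rmorphB !rmorphM subf_div ?f0.
have mm : monoid_morphism g.
  split=> [|x y].
    have -> : 1 = 1%:F / 1%:F :> {fraction D} by rewrite divff // tofrac_eq0 oner_eq0.
    by rewrite gE ?oner_eq0 // rmorph1 divr1.
  have [a [b [b0 ->]]] := frac_repr x; have [c [d [d0 ->]]] := frac_repr y.
  by rewrite mulf_div -!tofracM !gE ?mulf_neq0 // !rmorphM mulf_div.
pose G : {rmorphism {fraction D} -> F} := HB.pack g
  (GRing.isZmodMorphism.Build _ _ g zm) (GRing.isMonoidMorphism.Build _ _ g mm).
exists G => a; rewrite -[a%:F]divr1 -tofrac1 [LHS]gE ?oner_eq0 //.
by rewrite rmorph1 divr1.
Qed.

Lemma frac_derivation (f : D -> D) :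
    (forall a b, f (a - b) = f a - f b) ->
    (forall a b, f (a * b) = a * f b + f a * b) ->
  exists g : {fraction D} -> {fraction D},
    (forall E : divringClosed {fraction D}, der_on idfun E g) /\
    (forall a, g a%:F = (f a)%:F).
Proof.
move=> fB fM; pose gg (a b : D) := (f a * b - a * f b)%:F / (b ^+ 2)%:F : {fraction D}.
pose g (x : {fraction D}) := gg \n_(repr x) \d_(repr x).
have gE a b : b != 0 -> g (a%:F / b%:F) = gg a b.
  move=> b0; rewrite /g; set x := a%:F / b%:F; have d0 := denom_ratioP (repr x).
  have /esym/eqP := frac_reprE x; rewrite {1}/x frac_eqE // => /eqP E.
  set n := \n_(repr x) in E *; set m := \d_(repr x) in d0 E *.
  have E' := congr1 f E; rewrite !fM in E'.
  apply/eqP; rewrite frac_eqE ?expf_neq0 //; apply/eqP.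
  have fn : f n * b = a * f m + f a * m - n * f b by rewrite -E' addrC addKr.
  have -> : (f n * m - n * f m) * b ^+ 2 = m * b * (f n * b) - (n * b) * b * f m by ring.
  rewrite fn E.
  have -> : m * b * (a * f m + f a * m - n * f b) =
     m * b * (a * f m + f a * m) - m * (n * b) * f b by ring.
  by rewrite E; ring.
have f1 : f 1 = 0.
  by have := fM 1 1; rewrite !mulr1 mul1r => /eqP; rewrite -subr_eq subrr eq_sym => /eqP.
exists g; split=> [E|a]; last first.
  rewrite -[a%:F]divr1 -tofrac1 gE ?oner_eq0 // /gg f1 mulr0 subr0 mulr1 expr1n.
  by rewrite tofrac1 divr1.
split=> x y _ _; have [a [b [b0 ->]]] := frac_repr x; have [c [d [d0 ->]]] := frac_repr y.
  have -> : a%:F / b%:F - c%:F / d%:F = (a * d - c * b)%:F / (b * d)%:F.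
    by rewrite tofracB !tofracM subf_div ?tofrac_eq0.
  rewrite !gE ?mulf_neq0 // /gg fB !fM !(tofracB, tofracD, tofracM, tofracXn).
  by apply: quotient_rule_sub; rewrite tofrac_eq0.
rewrite mulf_div -!tofracM !gE ?mulf_neq0 // /gg !fM.
rewrite !(tofracB, tofracD, tofracM, tofracXn).
by apply: quotient_rule_mul; rewrite tofrac_eq0.
Qed.

End FractionExtensions.

Section LaurentSeries.
Variables (K : numClosedFieldType) (q : K).
Hypothesis q_neq0 : q != 0.
Hypothesis q_nroot : forall n, (0 < n)%N -> q ^+ n != 1.
Notation F := (fps K).
Notation L := (laurent K).

Definition laurentC : {rmorphism K -> L} := (@FracField.tofrac F) \o (@fpsC K).

Lemma fps_dilate_zmod : zmod_morphism (@fps_dilate K q).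
Proof. by move=> f g; apply/fpsP => n; rewrite /fps_dilate !fpsDE !fpsNE mulrDr mulrN. Qed.

Lemma fps_dilate_monoid : monoid_morphism (@fps_dilate K q).
Proof.
split=> [|f g]; apply/fpsP => n.
  by rewrite /fps_dilate; case: n => [|n] /=; rewrite ?mulr1 ?mulr0.
rewrite /fps_dilate !fpsME mulr_sumr; apply: eq_bigr => i _.
by rewrite mulrACA -exprD subnKC // -ltnS.
Qed.

Lemma fps_dilate_inj : injective (@fps_dilate K q).
Proof.
move=> f g /fpsP fg; apply/fpsP => n; apply: (mulfI (expf_neq0 n q_neq0)); exact: fg.
Qed.

Definition fps_theta (f : F) : F := fun n => f n *+ n.

Lemma fpsX_mulE (f : F) n : (fpsX * f) n = if n is m.+1 then f m else 0.
Proof.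
rewrite fpsME; case: n => [|n]; first by rewrite big_ord1 mul0r.
rewrite big_ord_recl mul0r add0r big_ord_recl /= mul1r subn1 big1 ?addr0 // => i _.
by rewrite mul0r.
Qed.

Lemma fps_thetaE (f : F) : fps_theta f = fpsX * fps_deriv f.
Proof. by apply/fpsP => -[|n]; rewrite fpsX_mulE. Qed.

Lemma fps_thetaB (f g : F) : fps_theta (f - g) = fps_theta f - fps_theta g.
Proof. by apply/fpsP => n; rewrite /fps_theta !fpsDE !fpsNE mulrnBl. Qed.

Lemma fps_thetaM (f g : F) : fps_theta (f * g) = f * fps_theta g + fps_theta f * g.
Proof.
apply/fpsP => n; rewrite fpsDE /fps_theta !fpsME -sumrMnl -big_split.
apply: eq_bigr => i _ /=; rewrite mulrnAr mulrnAl -mulrnDr subnK // -ltnS.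
exact: ltn_ord.
Qed.

Lemma fps_mul_lead (f g : F) m n : (forall i, (i < m)%N -> f i = 0) ->
  (forall i, (i < n)%N -> g i = 0) -> (f * g) (m + n)%N = f m * g n.
Proof.
move=> fm gn; rewrite fpsME; have mP : (m < (m + n).+1)%N by rewrite ltnS leq_addr.
rewrite (bigD1 (Ordinal mP)) //= addKn big1 ?addr0 // => i.
rewrite -val_eqE /= neq_ltn => /orP[/fm->|mi]; first by rewrite mul0r.
by rewrite (gn (m + n - i)%N) ?mulr0 // ltn_subLR ?ltn_add2r // -ltnS.
Qed.

Lemma q_expI : injective (fun n => q ^+ n).
Proof.
have le m n : (m <= n)%N -> q ^+ m = q ^+ n -> m = n.
  move=> mn e; have : q ^+ (n - m) = 1.
    by apply: (mulIf (expf_neq0 m q_neq0)); rewrite -exprD subnK // mul1r.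
  case: (posnP (n - m)) => [/eqP nm _|/q_nroot/eqP//].
  by apply/eqP; rewrite eqn_leq mn -subn_eq0.
by move=> m n e; case: (leqP m n) => [/le|/ltnW/le h]; [exact|exact/esym/h].
Qed.

Lemma dilate_lead (f : F) m i : (forall i, (i < m)%N -> f i = 0) -> (i < m)%N ->
  fps_dilate q f i = 0.
Proof. by move=> fm im; rewrite /fps_dilate fm ?mulr0. Qed.

(** The powers of [q] being distinct, a nonzero solution [a] has the same order as [b]. Subtracting
    the multiple of [b] with the same leading coefficient gives a solution of larger order, hence
    0. *)
Lemma dilate_proportional (a b : F) : b != 0 ->
  fps_dilate q a * b = a * fps_dilate q b -> exists c, a = fpsC c * b.
Proof.
move=> b0 ab; have [n [bn bmin]] := fps_neq0_min b0.
have order (f : F) m : f m != 0 -> (forall i, (i < m)%N -> f i = 0) ->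
    fps_dilate q f * b = f * fps_dilate q b -> m = n.
  move=> fm fmin E; have := congr1 (fun g : F => g (m + n)%N) E => /=.
  rewrite !fps_mul_lead //; try by move=> i; apply: dilate_lead.
  rewrite /fps_dilate => E1; apply: q_expI; apply: (mulIf (mulf_neq0 fm bn)).
  by rewrite mulrA E1 mulrCA.
have [a0|a0] := eqVneq a 0; first by exists 0; rewrite rmorph0 mul0r.
have [m [am amin]] := fps_neq0_min a0; have mn := order a m am amin ab.
subst m; pose c := a n / b n; exists c; apply/eqP; rewrite -subr_eq0.
apply: contrapT => /negP; set d := a - _ => d0.
have cE i : (fpsC c * b) i = c * b i.
  rewrite fpsME big_ord_recl /= subn0 big1 ?addr0 // => j _; exact: mul0r.
have dE i : d i = a i - c * b i by rewrite /d fpsDE fpsNE cE.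
have [m [dm dmin]] := fps_neq0_min d0.
have mn : m = n.
  apply: (order d) => //.
  have -> : fps_dilate q d = fps_dilate q a - fpsC c * fps_dilate q b.
    apply/fpsP => i; rewrite fpsDE fpsNE [(fpsC c * _) i]fpsME big_ord_recl /= subn0.
    rewrite big1 ?addr0 => [|j _]; last exact: mul0r.
    by rewrite /fps_dilate dE mulrBr mulrCA.
  by rewrite mulrBl ab /d mulrBl; ring.
by move: dm; rewrite mn dE /c divfK // subrr eqxx.
Qed.

Lemma fpsX_neq0 : fpsX != 0 :> F.
Proof. by apply/eqP => /fpsP/(_ 1%N)/eqP; rewrite /fpsX /= oner_eq0. Qed.

Lemma dilateX : fps_dilate q fpsX = fpsC q * fpsX.
Proof.
rewrite mulrC; apply/fpsP => -[|[|n]]; rewrite fpsX_mulE /fps_dilate /fpsX /= ?mulr0 ?mulr1 //.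
Qed.

Lemma laurent_structure : exists (phi : {rmorphism L -> L}) (theta : L -> L),
  [/\ (forall a, phi a%:F = (fps_dilate q a)%:F),
      (forall a, theta a%:F = (fps_theta a)%:F),
      (forall E : divringClosed L, der_on idfun E theta),
      (forall f, phi (theta f) = theta (phi f)) &
      (forall f, phi f = f -> exists c, f = laurentC c)].
Proof.
pose dil : {rmorphism F -> F} := HB.pack (@fps_dilate K q)
  (GRing.isZmodMorphism.Build _ _ _ fps_dilate_zmod)
  (GRing.isMonoidMorphism.Build _ _ _ fps_dilate_monoid).
have dilI : injective ((@FracField.tofrac F) \o dil).
  move=> f g /eqP; rewrite /= tofrac_eq => /eqP; exact: fps_dilate_inj.
have [phi phiE] := frac_morphism dilI.
have [theta [thD thE]] := frac_derivation fps_thetaB fps_thetaM.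
exists phi, theta; split=> // [f|f].
  have [a [b [b0 ->]]] := frac_repr f.
  have b0' : b%:F != 0 :> L by rewrite tofrac_eq0.
  have com a' : phi (theta a'%:F) = theta (phi a'%:F).
    rewrite thE !phiE /= thE; congr (_%:F).
    by apply/fpsP => n; rewrite /fps_dilate /fps_theta mulrnAr.
  exact: (commutes_div (thD (total_field L)) b0' (com a) (com b)).
have [a [b [b0 ->]]] := frac_repr f.
rewrite fmorph_div !phiE /= => /eqP; rewrite frac_eqE //; last first.
  by rewrite -(rmorph0 dil) (inj_eq fps_dilate_inj).
move=> /eqP /(dilate_proportional b0)[c ->]; exists c.
by rewrite rmorphM mulfK // tofrac_eq0.
Qed.

Section Structure.
Variables (phi : {rmorphism L -> L}) (theta : L -> L).
Hypothesis phiE : forall a, phi a%:F = (fps_dilate q a)%:F.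
Hypothesis phi_fixed : forall f, phi f = f -> exists c, f = laurentC c.
Notation t := (fpsX%:F : L).

Lemma t_neq0 : t != 0. Proof. by rewrite tofrac_eq0 fpsX_neq0. Qed.

Lemma phi_t : phi t = laurentC q * t.
Proof. by rewrite phiE dilateX rmorphM. Qed.

Lemma phi_laurentC c : phi (laurentC c) = laurentC c.
Proof.
rewrite phiE; congr (_%:F); apply/fpsP => -[|n]; rewrite /fps_dilate /= ?mul1r //.
by rewrite mulr0.
Qed.

(** Leading coefficients give [k = q ^ (m - n)], with [m] and [n] the orders of numerator and
    denominator; dividing [f] by [t ^ (m - n)] leaves an invariant. *)
Lemma phi_eigen f k : f != 0 -> phi f = laurentC k * f ->
  exists c (l : int), f = laurentC c * t ^ l.
Proof.
move=> f0 phif; have [a [b [b0 fE]]] := frac_repr f.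
have b0' : b%:F != 0 :> L by rewrite tofrac_eq0.
have a0 : a != 0 by apply: contraNneq f0 => a0; rewrite fE a0 tofrac0 mul0r.
have [m [am amin]] := fps_neq0_min a0; have [n [bn bmin]] := fps_neq0_min b0.
have db0 : fps_dilate q b != 0.
  apply: contraNneq b0 => e; apply/eqP; apply: fps_dilate_inj; rewrite e.
  by apply/fpsP => i; rewrite /fps_dilate mulr0.
have E : fps_dilate q a * b = fpsC k * a * fps_dilate q b.
  move: phif; rewrite fE fmorph_div !phiE mulrA => /eqP.
  have -> : laurentC k * a%:F = (fpsC k * a)%:F by rewrite tofracM.
  by rewrite frac_eqE // => /eqP.
have qmn : q ^+ m = k * q ^+ n.
  have := congr1 (fun g : F => g (m + n)%N) E => /=.
  rewrite -mulrA [RHS](_ : _ = k * (a * fps_dilate q b) (m + n)%N); last first.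
    rewrite fpsME big_ord_recl /= subn0 big1 ?addr0 // => j _; exact: mul0r.
  rewrite !fps_mul_lead //; try by move=> i; apply: dilate_lead.
  rewrite /fps_dilate => E1; apply: (mulIf (mulf_neq0 am bn)).
  by rewrite mulrA E1; ring.
have lq0 : laurentC q != 0 by rewrite fmorph_eq0.
have [|c cE] := phi_fixed (f := f * t ^+ n / t ^+ m).
  rewrite fmorph_div rmorphM !rmorphXn phi_t phif.
  by apply: eigen_shift; rewrite ?t_neq0 // -!rmorphXn qmn rmorphM.
exists c, (m%:Z - n%:Z); have tn0 := expf_neq0 n t_neq0; have tm0 := expf_neq0 m t_neq0.
by rewrite -cE expfzDr ?t_neq0 // -invr_expz -!exprnP mulrA divfK // mulfK.
Qed.

End Structure.
End LaurentSeries.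

(** * The eigenvector attached to a density *)

Section SemiInvariantDensity.
Variables (K : numClosedFieldType) (L : fieldType) (iota : {rmorphism K -> L}).
Variables (phi : {rmorphism L -> L}) (theta : L -> L) (t : L) (q : K) (x : L).
Variables (P Q : {poly K}).
Hypothesis phiK : forall c, phi (iota c) = iota c.
Hypothesis theta_der : forall E : divringClosed L, der_on idfun E theta.
Hypothesis thetaK : forall c, theta (iota c) = 0.
Hypothesis phi_theta : forall f, phi (theta f) = theta (phi f).
Hypothesis t_neq0 : t != 0.
Hypothesis phit : phi t = iota q * t.
Hypothesis theta_t : theta t = t.
Hypothesis phi_fixed : forall f, phi f = f -> exists c, f = iota c.
Hypothesis q_neq0 : q != 0.
Hypothesis q_nroot : forall n, (0 < n)%N -> q ^+ n != 1.
Hypothesis x_notin : x \notin consts iota.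
Hypothesis u_neq0 : theta x != 0.
Hypothesis copPQ : coprimep P Q.
Hypothesis sizeP : size P = (size Q).+1.
Hypothesis sizeQ : (1 < size Q)%N.
Hypothesis phix : phi x = hev iota x P / hev iota x Q.

Lemma phix_base : phi x \in base iota x.
Proof.
rewrite phix; apply: rpred_div; rewrite rpred_horner ?adj_gen //;
  by apply: polyOverS (hev_polyOver _ _) => g; apply: sub_adj.
Qed.

(** If [t] were algebraic, its norm would be an eigenvector in [C(x)] with eigenvalue [q ^+ m],
    constant by [eigen_const], so that [q ^+ m = 1]. *)
Lemma t_transc : transc (base iota x) t.
Proof.
apply: contrapT => ntr; have iq0 : iota q != 0 by rewrite fmorph_eq0.
have qB : iota q \in base iota x by rewrite sub_adj ?const_in.
have [m [b [m0 bB b0]]] := semi_invariant (phi_base phiK phix_base) ntr t_neq0 qB iq0 phit.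
rewrite -rmorphXn => phib.
have qm0 : q ^+ m != 0 by rewrite expf_neq0.
have /constsP[c bE] := eigen_const phiK x_notin copPQ sizeP sizeQ phix bB qm0 phib.
have := q_nroot m0; rewrite -(inj_eq (fmorph_inj iota)) rmorph1 => /eqP; apply.
by apply: (mulIf b0); rewrite mul1r -phib bE phiK.
Qed.

Lemma semi_invariant_density : (exists N, ~ transc (tower iota theta t x N) (xk theta x N.+1)) ->
  exists n A k, [/\ (0 < n)%N, A \in adj (consts iota) x, A != 0
    & phi (theta x ^+ n / A) = iota k * (theta x ^+ n / A)].
Proof.
move=> alg; have r0 := r'_neq0 phi_theta u_neq0.
have final n A k : (0 < n)%N -> A \in adj (consts iota) x -> A != 0 -> k != 0 ->
    phi A = iota k * dx theta x (phi x) ^+ n * A ->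
  exists n A k, [/\ (0 < n)%N, A \in adj (consts iota) x, A != 0
    & phi (theta x ^+ n / A) = iota k * (theta x ^+ n / A)].
  move=> n0 AB A0 k0 phiA; exists n, A, k^-1; split=> //.
  rewrite fmorph_div rmorphXn (phi_u phi_theta u_neq0) phiA fmorphV exprMn.
  have rn0 : dx theta x (phi x) ^+ n != 0 by rewrite expf_neq0.
  have ik0 : iota k != 0 by rewrite fmorph_eq0.
  by move: (_ ^+ n) rn0 => r rn0; field; rewrite ik0 A0 rn0.
have [[n [j [A [n0 AB A0 phiA]]]]|[h hB hphi]] := elimination phiK theta_der thetaK
    phi_theta t_neq0 phit theta_t phi_fixed q_neq0 phix_base u_neq0 t_transc alg.
  by apply: final phiA => //; rewrite expfz_neq0.
have dxx : dx theta x x = 1 by rewrite /dx divff.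
have [n [A [c [n0 AB A0 c0 phiA]]]] := projective_density phiK
  (dx_der x theta_der (total_field L)) (dxK x thetaK) dxx x_notin copPQ sizeP sizeQ
  phix hB hphi.
exact: final phiA.
Qed.

End SemiInvariantDensity.

(** * Moving the fixed point from 0 to infinity *)

Section Reversal.
Variable F : fieldType.

(** The reciprocal polynomial for the formal degree [n], which may exceed the true one; it turns
    [R = p / d] into [S = revp n d / revp n p]. *)
Definition revp n (f : {poly F}) := \poly_(i < n.+1) f`_(n - i).

Lemma horner_revp n (f : {poly F}) w : (size f <= n.+1)%N -> w != 0 ->
  (revp n f).[w] = w ^+ n * f.[w^-1].
Proof.
move=> sf w0; rewrite horner_poly (horner_coef_wide _ sf) mulr_sumr.
rewrite (reindex_inj rev_ord_inj) /=; apply: eq_bigr => i _.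
have iN : (i <= n)%N by rewrite -ltnS.
rewrite subSS subKn // mulrCA exprVn; congr (_ * _).
by apply: (canRL (mulfK _)); rewrite ?expf_neq0 // -exprD subnK.
Qed.

Lemma size_revp n (f : {poly F}) : f`_0 != 0 -> size (revp n f) = n.+1.
Proof. by move=> f0; rewrite size_poly_eq //= subnn. Qed.

(** A simple zero of [R] at 0 makes the degree of the denominator of [S] one less than that of the
    numerator: infinity is fixed and unramified. *)
Lemma size_revp1 n (f : {poly F}) : f`_0 = 0 -> f`_1 != 0 -> size (revp n.+1 f) = n.+1.
Proof.
move=> f0 f1; have -> : revp n.+1 f = \poly_(i < n.+1) f`_(n.+1 - i).
  apply/polyP => i; rewrite !coef_poly ltnS; case: ltngtP => // ->.
  by rewrite subnn f0.
by rewrite size_poly_eq //= subSnn.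
Qed.

End Reversal.

Lemma map_revp (F G : fieldType) (f : {rmorphism F -> G}) n (p : {poly F}) :
  map_poly f (revp n p) = revp n (map_poly f p).
Proof.
apply/polyP => i; rewrite coef_map coef_poly [RHS]coef_poly; case: ifP => _.
  by rewrite coef_map.
exact: raddf0.
Qed.

(** Nonzero roots are inverses of roots of [p] and [d]. A common root 0 would put both degrees below
    the formal degree, which is their maximum. *)
Lemma coprimep_revp (K : closedFieldType) n (p d : {poly K}) : coprimep p d ->
    (maxn (size p) (size d) = n.+1)%N -> coprimep (revp n d) (revp n p).
Proof.
move=> cpd szn; have [sp sd] : (size p <= n.+1)%N /\ (size d <= n.+1)%N.
  by rewrite -szn leq_maxl leq_maxr.
apply: Pdiv.ClosedField.root_coprimep => w.
have [->|w0] := eqVneq w 0; last first.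
  rewrite rootE !horner_revp // mulf_eq0 expf_eq0 (negPf w0) andbF /= => dw.
  rewrite mulf_neq0 ?expf_neq0 //; apply: coprimep_root dw.
  by rewrite coprimep_sym.
rewrite rootE !horner_coef0 !coef_poly /= subn0 => /eqP dn; apply/eqP => pn.
have sz (f : {poly K}) : (size f <= n.+1)%N -> f`_n = 0 -> (size f <= n)%N.
  move=> sf fn; apply/leq_sizeP => j; rewrite leq_eqVlt => /predU1P[<-//|nj].
  by apply/leq_sizeP: nj.
have : (maxn (size p) (size d) <= n)%N by rewrite geq_max !sz.
by rewrite szn ltnn.
Qed.

(** * Equations of Ritt type *)

Section AbstractRitt.
Variables (K : numClosedFieldType) (L : fieldType) (iota : {rmorphism K -> L}).
Variables (phi : {rmorphism L -> L}) (theta : L -> L) (t : L) (q : K).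
Variables (D : nat -> L) (p d : {poly K}) (m : nat).
Hypothesis phiK : forall c, phi (iota c) = iota c.
Hypothesis theta_der : forall E : divringClosed L, der_on idfun E theta.
Hypothesis thetaK : forall c, theta (iota c) = 0.
Hypothesis phi_theta : forall f, phi (theta f) = theta (phi f).
Hypothesis t_neq0 : t != 0.
Hypothesis phit : phi t = iota q * t.
Hypothesis theta_t : theta t = t.
Hypothesis phi_fixed : forall f, phi f = f -> exists c, f = iota c.
Hypothesis phi_monomial : forall f k, f != 0 -> phi f = iota k * f ->
  exists c (l : int), f = iota c * t ^ l.
Hypothesis q_neq0 : q != 0.
Hypothesis q_nroot : forall n, (0 < n)%N -> q ^+ n != 1.
Hypothesis theta_D : forall k, theta (D k) = t * D k.+1.
Hypothesis D0_notin : D 0 \notin consts iota.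
Hypothesis D1_neq0 : D 1 != 0.
Hypothesis cop_pd : coprimep p d.
Hypothesis p_0 : p`_0 = 0.
Hypothesis p_1 : p`_1 != 0.
Hypothesis d_0 : d`_0 != 0.
Hypothesis size_pd : maxn (size p) (size d) = m.+3.
Hypothesis phi_D0 : phi (D 0) = hev iota (D 0) p / hev iota (D 0) d.

Theorem algebraic_ritt n (M : {mpoly K[n.+2]}) : M != 0 ->
    mmap iota (fun i : 'I_n.+2 => if val i is k.+1 then D k else t) M = 0 ->
  exists r (j : int) (N1 D1 : {poly K}), [/\ (0 < r)%N, D1 != 0
    & D 1 ^+ r = t ^ j * (hev iota (D 0) N1 / hev iota (D 0) D1)].
Proof.
move=> M0 MM; pose S := D 0; have tS := notin_consts_transc D0_notin.
have S0 : S != 0 by apply: contraNneq D0_notin => S00; rewrite -/S S00 rpred0.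
pose x := S^-1; have x_notin : x \notin consts iota by rewrite rpredV.
have x0 : x != 0 by rewrite invr_eq0.
have thx : theta x = - (t * D 1) * x ^+ 2.
  by rewrite /x (tderV (theta_der (total_field L))) theta_D exprVn.
have u0 : theta x != 0.
  by rewrite thx mulNr oppr_eq0 !mulf_neq0 ?expf_neq0.
have [sp sd] : (size p <= m.+3)%N /\ (size d <= m.+3)%N.
  by rewrite -size_pd leq_maxl leq_maxr.
pose P := revp m.+2 d; pose Q := revp m.+2 p.
have sQ : size Q = m.+2 by rewrite size_revp1.
have sP : size P = (size Q).+1 by rewrite sQ size_revp.
have sQ1 : (1 < size Q)%N by rewrite sQ.
have cPQ : coprimep P Q by rewrite coprimep_revp.
have hrev (f : {poly K}) : (size f <= m.+3)%N ->
    hev iota x (revp m.+2 f) = x ^+ m.+2 * hev iota S f.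
  by move=> sf; rewrite /hev map_revp horner_revp ?size_map_poly // invrK.
have phix : phi x = hev iota x P / hev iota x Q.
  rewrite fmorphV phi_D0 invf_div !hrev // -mulf_div divff ?mul1r //.
  by rewrite expf_neq0.
have D0 : D 0 = x^-1 by rewrite invrK.
have tB := t_transc phiK t_neq0 phit q_neq0 q_nroot x_notin cPQ sP sQ1 phix.
have alg := algebraic_tower theta_der thetaK t_neq0 theta_t u0 tB D0 theta_D
  (notin_consts_transc x_notin) M0 MM.
have [r [A [k [r0 AB A0 eig]]]] := semi_invariant_density phiK theta_der thetaK
  phi_theta t_neq0 phit theta_t phi_fixed q_neq0 q_nroot x_notin u0 cPQ sP sQ1 phix alg.
have f0 : theta x ^+ r / A != 0 by rewrite mulf_neq0 ?invr_eq0 // expf_neq0.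
have [c [l fE]] := phi_monomial f0 eig.
(* From [theta x = - t sigma' / sigma ^+ 2]: solving for [sigma'] produces the sign, the power of
   [S] and the shift of the exponent of [t] by [- r]. *)
pose A' := (-1) ^+ r * S ^+ (2 * r) * (iota c * A).
have A'B : A' \in adj (consts iota) S.
  have sB : S \in adj (consts iota) S by apply: adj_gen.
  have AB' : A \in adj (consts iota) S.
    by apply: adj_min AB => [f|]; [apply: sub_adj|rewrite rpredV].
  apply: rpredM; last by apply: rpredM => //; rewrite sub_adj ?const_in.
  by apply: rpredM; [apply: rpredX; rewrite rpredN1|apply: rpredX].
have [N1 [D1 [D10 _ A'E]]] := (adj_constsP tS A').1 A'B.
exists r, (l - r%:Z), N1, D1; split=> //; rewrite -A'E.
have uE : theta x ^+ r = iota c * t ^ l * A by rewrite -fE divfK.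
have tr0 : t ^+ r != 0 by rewrite expf_neq0.
have tl0 : t ^ l != 0 by rewrite expfz_neq0.
have icA : iota c * A = theta x ^+ r / t ^ l by rewrite uE mulrAC mulfK.
have -> : D 1 ^+ r = ((-1) ^+ r * S ^+ (2 * r) * theta x ^+ r) / t ^+ r.
  apply: (canRL (mulfK tr0)); rewrite exprM -!exprMn thx; congr (_ ^+ _).
  by rewrite /x; field.
rewrite expfzDr // -invr_expz -exprnP /A' icA.
move: (t ^ l) tl0 (t ^+ r) tr0 ((-1) ^+ r) (S ^+ (2 * r)) (theta x ^+ r).
by move=> T T0 T' T'0 Z Y W; field; rewrite T0 T'0.
Qed.

End AbstractRitt.

(** A negative [r] exchanges [P] and [D], a negative [j] moves the power of [t] to the other
    side. *)
Lemma clear_exponents (F : fieldType) (s t P D : F) (r j : int) :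
    s != 0 -> t != 0 -> D != 0 -> r != 0 -> s ^ r = t ^ j * (P / D) ->
  exists a b c : nat, (0 < a)%N /\
    (s ^+ a * t ^+ b * D = t ^+ c * P \/ P != 0 /\ s ^+ a * t ^+ b * P = t ^+ c * D).
Proof.
move=> s0 t0 D0 r0 E; case: r r0 E => a a0 E.
  case: j E => c E.
    exists a, 0%N, c; split; first by rewrite lt0n.
    by left; rewrite expr0 mulr1 [s ^+ a]E mulrA divfK.
  exists a, c.+1, 0%N; split; first by rewrite lt0n.
  left; rewrite [s ^+ a]E NegzE -invr_expz -exprnP expr0 mul1r.
  have tc0 : t ^+ c.+1 != 0 by rewrite expf_neq0.
  by move: (t ^+ c.+1) tc0 => T T0; field; rewrite T0 D0.
have P0 : P != 0.
  by apply: contra_eq_neq E => ->; rewrite mul0r mulr0 expfz_neq0.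
have sa0 : s ^+ a.+1 != 0 by rewrite expf_neq0.
have {}E : s ^+ a.+1 = (t ^ j * (P / D))^-1 by rewrite -E NegzE -invr_expz invrK.
case: j E => c E.
  exists a.+1, c, 0%N; split=> //; right; split=> //; rewrite E expr0 mul1r -exprnP.
  have tc0 : t ^+ c != 0 by rewrite expf_neq0.
  by move: (t ^+ c) tc0 => T T0; field; rewrite T0 P0 D0.
exists a.+1, 0%N, c.+1; split=> //; right; split=> //.
rewrite E NegzE -invr_expz -exprnP expr0 mulr1.
have tc0 : t ^+ c.+1 != 0 by rewrite expf_neq0.
by move: (t ^+ c.+1) tc0 => T T0; field; rewrite T0 P0 D0.
Qed.

Section RittTheorem.
Variables (K : numClosedFieldType) (R : ratfun K) (q : K) (sigma : fps K).
Notation L := (laurent K).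
Notation iota := (laurentC K).

Lemma polynomial_diff_algebraic a b c (p d : {poly K}) : (0 < a)%N -> d != 0 ->
    fps_deriv sigma ^+ a * fpsX ^+ b * (map_poly (@fpsC K) d).[sigma] =
      fpsX ^+ c * (map_poly (@fpsC K) p).[sigma] ->
  diff_algebraic sigma.
Proof.
move=> a0 d0 E; pose i0 : 'I_3 := Ordinal (isT : (0 < 3)%N); pose i1 : 'I_3 := Ordinal (isT : (1 < 3)%N).
pose i2 : 'I_3 := Ordinal (isT : (2 < 3)%N).
pose ev (f : {poly K}) : {mpoly K[3]} := (map_poly (@mpolyC 3 K) f).['X_i1].
pose M := 'X_i2 ^+ a * 'X_i0 ^+ b * ev d - 'X_i0 ^+ c * ev p.
have mmapX1 (S : comNzRingType) (f : {rmorphism K -> S}) h i :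
    mmap f h ('X_i : {mpoly K[3]}) = h i by rewrite mmapX mmap1U.
have mmap_ev (S : comNzRingType) (f : {rmorphism K -> S}) h g :
    mmap f h (ev g) = (map_poly f g).[h i1].
  rewrite -[mmap f h _]horner_map /= mmapX1 -map_poly_comp; congr _.[_].
  by apply: eq_map_poly => e /=; rewrite mmapC.
have mmapM (S : comNzRingType) (f : {rmorphism K -> S}) h :
    mmap f h M = h i2 ^+ a * h i0 ^+ b * (map_poly f d).[h i1]
      - h i0 ^+ c * (map_poly f p).[h i1].
  by rewrite rmorphB !rmorphM !rmorphXn /= !mmapX1 !mmap_ev.
exists 1%N, M; split; last first.
  set hh := fun i : 'I_3 => _.
  have h2 : hh i2 = fps_deriv sigma by [].
  have h1 : hh i1 = sigma by [].
  have h0 : hh i0 = fpsX by [].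
  by rewrite mmapM h2 h1 h0 E subrr.
(* Nonvanishing of [M]: put [t = 1], [sigma = e] off the roots of [d], and keep the derivative as an
   indeterminate. As [a > 0], the coefficient of degree [a] is [d.[e]]. *)
have [e de] : exists e, ~~ root d e by apply/closed_nonrootP.
pose h (i : 'I_3) : {poly K} := if val i is k.+1 then if k is 0 then e%:P else 'X else 1.
apply: contraNneq de => M0; have := mmapM _ (@polyC K) h.
rewrite M0 mmap0 /h /= !expr1n mulr1 mul1r.
have evC (f : {poly K}) : (map_poly polyC f).[e%:P] = f.[e]%:P.
  by rewrite horner_map.
rewrite !evC => /(congr1 (fun g : {poly K} => g`_a)).
rewrite coef0 coefB coefMC coefXn eqxx mul1r coefC eqn0Ngt a0 subr0 => e0.
by rewrite rootE -e0.
Qed.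

Lemma ritt_diff_algebraic : (exists (r j : int) (A : ratfun K), r != 0 /\ ritt_type r j A sigma) ->
  diff_algebraic sigma.
Proof.
move=> [r [j [A [r0 [y [[p [d [_ + yE]]] _ rel]]]]]].
have hevS f : (map_poly iota f).[sigma%:F] = ((map_poly (@fpsC K) f).[sigma])%:F.
  by rewrite /= -horner_map -map_poly_comp.
rewrite hevS tofrac_eq0 => d0.
have dn : d != 0 by apply: contraNneq d0 => ->; rewrite map_poly0 horner0.
rewrite !hevS in yE.
have [sc|sn] := eqVneq (fps_deriv sigma) 0.
  by apply: (@polynomial_diff_algebraic 1 0 0 0 1) => //;
    rewrite ?oner_eq0 // sc map_poly0 horner0 expr1 !mul0r mulr0.
have S0 : (fps_deriv sigma)%:F != 0 :> L by rewrite tofrac_eq0.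
have D0 : ((map_poly (@fpsC K) d).[sigma])%:F != 0 :> L by rewrite tofrac_eq0.
have [a [b [c [a0 [E|[P0 E]]]]]] := clear_exponents S0 (t_neq0 K) D0 r0 (etrans rel (congr1 _ yE)).
  apply: (@polynomial_diff_algebraic a b c p d) => //.
  by apply/eqP; rewrite -tofrac_eq !tofracM !tofracXn E.
apply: (@polynomial_diff_algebraic a b c d p) => //.
  by apply: contraNneq P0 => ->; rewrite map_poly0 horner0 tofrac0.
by apply/eqP; rewrite -tofrac_eq !tofracM !tofracXn E.
Qed.

Lemma diff_algebraic_ritt :
  ~ homography R -> rat_at R 0 0 -> rat_at (rat_deriv R) 0 q ->
  q != 0 -> (forall n : nat, (0 < n)%N -> q ^+ n != 1) ->
  rat_comp R sigma (fps_dilate q sigma)%:F ->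
  diff_algebraic sigma ->
  exists (r j : int) (A : ratfun K), r != 0 /\ ritt_type r j A sigma.
Proof.
move=> nhom [p0 [d0 [RE0 + +]]] Rq q0 qn Rsigma [n [M [M0 MM]]].
rewrite !map_poly_id // => d00 p00.
have d0n : d0 != 0 by apply: contraNneq d00 => ->; rewrite horner0.
(* The representative provided by [rat_at] need not be reduced, while the degree of [R] and its
   fibres require lowest terms. *)
pose g := gcdp p0 d0; pose p := p0 %/ g; pose d := d0 %/ g.
have pE : p0 = p * g by rewrite divpK // dvdp_gcdl.
have dE : d0 = d * g by rewrite divpK // dvdp_gcdr.
have gn : g != 0 by rewrite gcdp_eq0 negb_and d0n orbT.
have dn : d != 0 by apply: contraNneq d0n => e; rewrite dE e mul0r.
have cpd : coprimep p d by rewrite coprimep_div_gcd // d0n orbT.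
have RE : R = p%:F / d%:F.
  rewrite RE0 pE dE !tofracM -mulf_div divff ?mulr1 // tofrac_eq0 //.
have d00' : d.[0] != 0 by move: d00; rewrite dE hornerM mulf_eq0 => /norP[].
have g00 : g.[0] != 0 by move: d00; rewrite dE hornerM mulf_eq0 => /norP[].
have p00' : p.[0] = 0.
  have /eqP := p00; rewrite eq_sym mulf_eq0 invr_eq0 (negPf d00) orbF pE hornerM.
  by rewrite mulf_eq0 (negPf g00) orbF => /eqP.
have p1 : p`_1 != 0.
  have : rat_at (rat_deriv R) 0 ((p^`() * d - p * d^`()).[0] / (d ^+ 2).[0]).
    exists (p^`() * d - p * d^`()), (d ^+ 2); rewrite !map_poly_id //; split=> //.
      by rewrite RE rat_derivE.
    by rewrite horner_exp expf_neq0.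
  move=> /(rat_value_uniq Rq) qE; apply: contra_neq q0 => p10; rewrite qE.
  have p'0 : p^`().[0] = 0 by rewrite horner_coef0 coef_deriv p10 mul0rn.
  by rewrite hornerD hornerN !hornerM p'0 p00' !mul0r subr0 mul0r.
have p_0 : p`_0 = 0 by rewrite -horner_coef0.
have d_0 : d`_0 != 0 by rewrite -horner_coef0.
have [m mE] : exists m, maxn (size p) (size d) = m.+3.
  have [|le2] := ltnP 2 (maxn (size p) (size d)).
    by case: maxn => [|[|[|m]]] // _; exists m.
  case: nhom; exists p`_1, 0, d`_1, d`_0; split; first by rewrite mul0r subr0 mulf_neq0.
  rewrite RE; congr (_%:F / _%:F).
    apply/polyP => -[|[|i]]; rewrite !coefE /= ?mulr0 ?mulr1 ?addr0 ?p_0 //.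
    by rewrite nth_default // (leq_trans (leq_maxl _ (size d))) // (leq_trans le2).
  apply/polyP => -[|[|i]]; rewrite !coefE /= ?mulr0 ?mulr1 ?addr0 ?add0r //.
  by rewrite nth_default // (leq_trans (leq_maxr (size p) _)) // (leq_trans le2).
(* A constant series, for which [1 / sigma] is no coordinate, satisfies the equation with [r = 1]
   and [A = 0]. *)
have [sc|sn] := eqVneq (fps_deriv sigma) 0.
  exists 1, 0, 0; split=> //; exists 0; split=> //.
    exists 0, 1; split; first by rewrite tofrac0 mul0r.
      by rewrite (rmorph1 (map_poly _)) hornerC oner_eq0.
    by rewrite map_poly0 horner0 mul0r.
  by rewrite sc tofrac0 mulr0 expr1z.
have [phi [theta [phiE thE thD phi_th fixed]]] := laurent_structure q0 qn.
have phiK := phi_laurentC phiE; have phit := phi_t phiE; have t0 := t_neq0 K.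
have thS f : theta f%:F = fpsX%:F * (fps_deriv f)%:F.
  by rewrite thE fps_thetaE tofracM.
have thK c : theta (iota c) = 0.
  rewrite /= thE; have -> : fps_theta (fpsC c) = 0; last by rewrite tofrac0.
  by apply/fpsP => -[|i]; rewrite /fps_theta fps0E ?mulr0n ?mul0rn.
have tht : theta fpsX%:F = fpsX%:F.
  rewrite thE; congr (_%:F); apply/fpsP => -[|[|i]]; rewrite /fps_theta /fpsX //=.
  by rewrite mul0rn.
have S_notin : sigma%:F \notin consts iota.
  apply/negP => /constsP[c]; rewrite /= => /eqP; rewrite tofrac_eq => /eqP sE.
  case/eqP: sn; rewrite sE; apply/fpsP => i.
  by rewrite /fps_deriv /= mul0rn.
have tS := notin_consts_transc S_notin.
have phiS : phi sigma%:F = hev iota sigma%:F p / hev iota sigma%:F d.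
  rewrite phiE; apply: (rat_value_uniq Rsigma); exists p, d; split=> //.
  by rewrite -[_.[_]]/(hev iota sigma%:F d) (hev_eq0 tS).
pose D k : L := (iter k (@fps_deriv K) sigma)%:F.
have thDk k : theta (D k) = fpsX%:F * D k.+1 by rewrite thS.
have D10 : D 1%N != 0 by rewrite tofrac_eq0.
have MML : mmap iota (fun i : 'I_n.+2 => if val i is k.+1 then D k else fpsX%:F) M = 0.
  have := congr1 (@FracField.tofrac (fps K)) MM; rewrite tofrac0 => <-.
  rewrite /mmap rmorph_sum; apply: eq_bigr => mm _; rewrite [RHS]rmorphM; congr (_ * _).
  rewrite /mmap1 rmorph_prod; apply: eq_bigr => i _; rewrite [RHS]rmorphXn; congr (_ ^+ _).
  by case: (val i).
have [r [j [N1 [D1 [r0 D1n E]]]]] := algebraic_ritt phiK thD thK phi_th t0 phit tht fixed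
  (phi_eigen q0 phiE fixed) q0 qn thDk S_notin D10 cpd p_0 p1 d_0 mE phiS M0 MML.
exists r%:Z, j, (N1%:F / D1%:F); split; first by rewrite -lt0n.
exists (hev iota sigma%:F N1 / hev iota sigma%:F D1); split=> //.
by exists N1, D1; split=> //; rewrite -[_.[_]]/(hev iota sigma%:F D1) (hev_eq0 tS).
Qed.

End RittTheorem.

Theorem theorem1p2 (RR : realType) (R : ratfun RR[i]) (q : RR[i]) (sigma : fps RR[i]) :
  ~ homography R ->
  rat_at R 0 0 ->
  rat_at (rat_deriv R) 0 q ->
  q != 0 ->
  (forall n : nat, (0 < n)%N -> q ^+ n != 1) ->
  rat_comp R sigma (fps_dilate q sigma)%:F ->
  (diff_algebraic sigma <->
   exists (r j : int) (A : ratfun RR[i]), r != 0 /\ ritt_type r j A sigma).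
Proof.
move=> nhom R0 R'0 q0 qn Rsigma; split.
  exact: (@diff_algebraic_ritt RR[i] R q sigma).
exact: (@ritt_diff_algebraic RR[i] sigma).
Qed.
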